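(* Let $\mathbb G=\mathbb R^d$ or $\mathbb G=\mathbb Z^d$ act on the probability space $(\Omega,\mathcal F,\mathbb P)$ by $(\theta_g)_{g\in\mathbb G}$ and on $\mathbb R^d$ by the translations $\tau_gx=x+Vg$, with $V$ an invertible $d\times d$ matrix. Assume that $\mathbb P$ is $\mathbb G$-stationary and ergodic, and that $\omega\mapsto\mu_\omega$ is a random locally finite non-negative measure on $\mathbb R^d$ with $\mu_{\theta_g\omega}=\tau_g\mu_\omega$ for all $\omega\in\Omega$, $g\in\mathbb G$. Assume in addition that $\mathbb E[\mu_\omega(\Delta)^\alpha]<+\infty$ for some $\alpha>1$. Then: (a) There exists a $\mathbb G$-invariant set $\mathcal A\subset\Omega$ with $\mathbb P(\mathcal A)=1$ such that, for every continuous $\varphi:\mathbb R^d\to\mathbb R$ satisfying, for some $C>0$ and $\beta>d$, $|\varphi(x)|\le C(1+|x|)^{-\beta}$ for all $x\in\mathbb R^d$, and for every $\omega\in\mathcal A$, the integral $\int_{\mathbb R^d}|\varphi(x)|\,d\mu^\varepsilon_\omega(x)$ is finite (for all $\varepsilon>0$) and $\lim_{\varepsilon\downarrow0}\int_{\mathbb R^d}\varphi(x)\,d\mu^\varepsilon_\omega(x)=m\int_{\mathbb R^d}\varphi(x)\,dx$. (b) There exists a $\mathbb G$-invariant set $\mathcal C\subset\Omega$ with $\mathbb P(\mathcal C)=1$ such that, for every $\beta>d$, setting $\vartheta(r):=(1+r)^{-\beta}$, for all $\omega\in\mathcal C$ we have $\int_{\mathbb R^d}\vartheta(|x|)\,d\mu^\varepsilon_\omega(x)<+\infty$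 (for all $\varepsilon>0$) and $\lim_{\ell\uparrow+\infty}\limsup_{\varepsilon\downarrow0}\int_{\{|x|\ge\ell\}}\vartheta(|x|)\,d\mu^\varepsilon_\omega(x)=0$.
   Context: $|x|$ is the Euclidean norm; $\mathbb E$ is expectation with respect to $\mathbb P$. $\mathbb G$ is $\mathbb R^d$ with the Euclidean topology or $\mathbb Z^d$ with the discrete topology. The action $(\theta_g)_{g\in\mathbb G}$ on $\Omega$ satisfies: $\theta_0$ is the identity, $\theta_g\circ\theta_{g'}=\theta_{g+g'}$, and $(g,\omega)\mapsto\theta_g\omega$ is measurable. A set $A\in\mathcal F$ is $\mathbb G$-invariant if $\theta_gA=A$ for all $g\in\mathbb G$. Stationary: $\mathbb P\circ\theta_g^{-1}=\mathbb P$ for all $g$; ergodic: $\mathbb P(A)\in\{0,1\}$ for every $\mathbb G$-invariant $A\in\mathcal F$. $\mathcal M$ is the space of locally finite non-negative Borel measures on $\mathbb R^d$, with the (metrizable) vague topology ($\nu_n\to\nu$ iff $\int f\,d\nu_n\to\int f\,d\nu$ for all $f\in C_c(\mathbb R^d)$) and its Borel $\sigma$-algebra. A random measure is a measurable map $\Omega\ni\omega\mapsto\mu_\omega\in\mathcal M$. For $\mathfrak m\in\mathcal M$, $\tau_g\mathfrak m(A):=\mathfrak m(\tau_gA)$ for all Borel $A$. $\Delta:=\{\sum_{i=1}^dt_iv^i:0\le t_i<1\}$, where $v^1,\dots,v^d$ are the columns of $V$. The intensity is $m:=\mathrm{Leb}(\Delta)^{-1}\int_\Omega d\mathbb P(\omega)\,\mu_\omega(\Delta)$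 (finite under the moment assumption). The rescaled measure is $\mu^\varepsilon_\omega(A):=\varepsilon^d\mu_\omega(\varepsilon^{-1}A)$ for Borel $A$, $\varepsilon>0$. *)

(* Defs.v *)
From HB Require Import structures.
From mathcomp Require Import all_boot all_order all_algebra.
From mathcomp Require Import all_classical all_reals all_analysis.
From mathcomp Require Import measurable_realfun.

Set Implicit Arguments.
Unset Strict Implicit.
Unset Printing Implicit Defensive.

Import Order.TTheory GRing.Theory Num.Theory.
Import numFieldNormedType.Exports.

Local Open Scope classical_set_scope.
Local Open Scope ring_scope.

(* Matrices over a realType carry the Borel sigma-algebra of their topology;
   'cV[R]_d plays the role of R^d. *)
HB.instance Definition _ (R : realType) (m n : nat) :=
  Measurable.copy 'M[R]_(m, n) (g_sigma_algebraType (@open 'M[R]_(m, n))).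

Section borel_matrix.
Context {R : realType}.

Lemma open_measurable_mx m n (U : set 'M[R]_(m, n)) : open U -> measurable U.
Proof. by move=> oU; exact: sub_sigma_algebra. Qed.

Lemma continuous_measurable_mx m n (f : 'M[R]_(m, n) -> R) :
  continuous f -> measurable_fun setT f.
Proof.
move=> /continuousP cf; apply: (measurability _ (RGenOpens.measurableE R)).
move=> _ [_ [a [b ->]] <-]; rewrite setTI.
by apply: open_measurable_mx; apply: cf; exact: interval_open.
Qed.

Lemma measurable_coord m n (i : 'I_m) (j : 'I_n) :
  measurable_fun setT (fun M : 'M[R]_(m, n) => M i j).
Proof. by apply: continuous_measurable_mx => M; exact: coord_continuous. Qed.

Lemma measurable_fun_mx d (T : measurableType d) m n (f : T -> 'M[R]_(m, n)) :
  (forall i j, measurable_fun setT (fun t => f t i j)) -> measurable_fun setT f.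
Proof.
move=> mf; apply: (@measurability _ _ _ _ _ _ (@open 'M[R]_(m, n))) => //.
move=> _ [U oU <-]; rewrite setTI.
pose c (q : 'M[rat]_(m, n) * rat) : 'M[R]_(m, n) := map_mx ratr q.1.
pose B (q : 'M[rat]_(m, n) * rat) := if 0 < ratr q.2 :> R then
  \bigcap_(i in [set: 'I_m]) \bigcap_(j in [set: 'I_n])
    [set M : 'M[R]_(m, n) | `|c q i j - M i j| < ratr q.2] else set0.
have -> : U = \bigcup_q (if `[< B q `<=` U >] then B q else set0).
  apply/seteqP; split=> [M UM|M [q _]]; last by case: asboolP => // BU /BU.
  have : nbhs M U by apply: open_nbhs_nbhs.
  move=> /nbhs_ballP[e /= e0 MU].
  have /rat_in_itvoo[r] : 0 < e / 2 by rewrite divr_gt0.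
  rewrite in_itv/= => /andP[r0 re].
  have hq i j : exists q : rat, `|ratr q - M i j| < ratr r.
    have /rat_in_itvoo[q] : M i j - ratr r < M i j + ratr r.
      by rewrite ltrBlDr -addrA ltrDl addr_gt0.
    by rewrite in_itv/= => qM; exists q; rewrite ltr_distl.
  pose q := (\matrix_(i, j) projT1 (cid (hq i j)), r).
  exists q => //.
  have BM : B q M.
    rewrite /B r0 => i _ j _ /=; rewrite /c !mxE; exact: (projT2 (cid (hq i j))).
  case: asboolP => //; apply: contra_notP => _ N BN; apply: MU.
  split=> // i j; move: BM BN; rewrite /B r0 => /(_ i I j I)/= h1 /(_ i I j I)/= h2.
  rewrite /ball/= (le_lt_trans (ler_distD (c q i j) _ _))//.
  by rewrite [ltRHS]splitr ltrD// ?(lt_trans _ re)// distrC.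
rewrite preimage_bigcup; apply: countable_bigcupT_measurable => // q.
case: ifPn => _; last by rewrite preimage_set0.
rewrite /B; case: ifPn => q0; last by rewrite preimage_set0.
rewrite preimage_bigcap; apply: fin_bigcap_measurable => // i _.
rewrite preimage_bigcap; apply: fin_bigcap_measurable => // j _.
have -> : f @^-1` [set M : 'M[R]_(m, n) | `|c q i j - M i j| < ratr q.2] =
    (fun t => f t i j) @^-1` (ball (c q i j) (ratr q.2)) by [].
by rewrite -[X in measurable X]setTI; apply: mf => //;
  apply: open_measurable; exact: ball_open.
Qed.

End borel_matrix.

Lemma sigma_finite_measureP d (T : measurableType d) (R : realType)
    (nu : set T -> \bar R) :
  nu set0 = 0%E -> (forall A, 0 <= nu A)%E -> semi_sigma_additive nu ->
  sigma_finite setT nu ->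
  exists nu' : {sigma_finite_measure set T -> \bar R}, nu = nu'.
Proof.
move=> nu0 nu_ge0 nu_sigma nu_sf.
pose i1 := isMeasure.Build _ _ _ nu nu0 nu_ge0 nu_sigma.
pose nu1 : measure T R := HB.pack nu i1.
pose i2 := Measure_isSigmaFinite.Build _ _ _ nu1 nu_sf.
pose nu2 : sigma_finite_measure T R := HB.pack nu i1 i2.
by exists nu2.
Qed.

Lemma pushforward_iso d1 d2 (T1 : measurableType d1) (T2 : measurableType d2)
    (R : realType) (mu : {sigma_finite_measure set T1 -> \bar R})
    (f : T1 -> T2) (g : T2 -> T1) :
  measurable_fun setT f -> measurable_fun setT g -> cancel f g -> cancel g f ->
  exists nu : {sigma_finite_measure set T2 -> \bar R}, pushforward mu f = nu.
Proof.
move=> mf mg fK gK; pose nu := pushforward mu f.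
have nu0 : nu set0 = 0%E by rewrite /nu /pushforward preimage_set0.
have nu_ge0 A : (0 <= nu A)%E by exact: measure_ge0.
have nu_sigma : semi_sigma_additive nu.
  move=> F mF tF mUF; rewrite /nu /pushforward preimage_bigcup.
  apply: measure_semi_sigma_additive.
  - by move=> n; rewrite -[X in measurable X]setTI; exact: mf.
  - apply/trivIsetP => /= i j _ _ ij; rewrite -preimage_setI.
    by move/trivIsetP : tF => /(_ _ _ _ _ ij) ->//; rewrite preimage_set0.
  - by rewrite -preimage_bigcup -[X in measurable X]setTI; exact: mf.
have nu_sf : sigma_finite setT nu.
  have [F TF Foo] := sigma_finiteT mu.
  exists (fun n => g @^-1` F n); first by rewrite -preimage_bigcup -TF.
  move=> n; have [mF Ffin] := Foo n; split.
    by rewrite -[X in measurable X]setTI; exact: mg.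
  rewrite /nu /pushforward -comp_preimage.
  by rewrite (_ : g \o f = id)//; apply/funext => x /=; rewrite fK.
exact: sigma_finite_measureP.
Qed.

Lemma pushforward_prod d1 d2 d3 (T1 : measurableType d1)
    (T2 : measurableType d2) (T3 : measurableType d3) (R : realType)
    (m1 : {sigma_finite_measure set T1 -> \bar R})
    (m2 : {sigma_finite_measure set T2 -> \bar R})
    (f : T1 * T2 -> T3) (g : T3 -> T1 * T2) :
  measurable_fun setT f -> measurable_fun setT g -> cancel f g -> cancel g f ->
  exists nu : {sigma_finite_measure set T3 -> \bar R},
    pushforward (m1 \x m2)%E f = nu.
Proof.
move=> mf mg fK gK.
have [m mE] : exists m : {sigma_finite_measure set (T1 * T2)%type -> \bar R},
    (m1 \x m2)%E = m.
  apply: sigma_finite_measureP => //; first exact: measure_semi_sigma_additive.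
  have /sigma_finiteP[F [TF ndF Foo]] := sigma_finiteT m1.
  have /sigma_finiteP[G [TG ndG Goo]] := sigma_finiteT m2.
  exists (fun n => F n `*` G n).
    rewrite -setXTT TF TG predeqE => -[x y]; split.
      move=> [/= [n _ Fnx] [k _ Gky]]; exists (maxn n k) => //; split.
      - by move: x Fnx; exact/subsetPset/ndF/leq_maxl.
      - by move: y Gky; exact/subsetPset/ndG/leq_maxr.
    by move=> [n _ []/= ? ?]; split; exists n.
  move=> k; have [? ?] := Foo k; have [? ?] := Goo k.
  split; first exact: measurableX.
  by rewrite product_measure1E// lte_mul_pinfty// ge0_fin_numE.
by rewrite mE; exact: (pushforward_iso m mf mg fK gK).
Qed.

Section lebesgue.
Context {R : realType}.

Definition cV_cons d (p : R * 'cV[R]_d) : 'cV[R]_d.+1 :=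
  col_mx (const_mx p.1 : 'cV[R]_1) p.2.

Lemma measurable_cV_cons d : measurable_fun setT (@cV_cons d).
Proof.
apply: measurable_fun_mx => i j; rewrite /cV_cons.
have [k ->|k ->] := split_ordP (i : 'I_(1 + d)).
- rewrite (_ : (fun _ => _) = fst)//.
  by apply/funext => t; apply: etrans (col_mxEu _ _ _ _) _; rewrite mxE.
- rewrite (_ : (fun _ => _) = (fun M : 'cV[R]_d => M k j) \o snd).
    by apply: measurableT_comp => //; exact: measurable_coord.
  by apply/funext => t; exact: col_mxEd.
Qed.

Let cV_uncons d (x : 'cV[R]_d.+1) : R * 'cV[R]_d :=
  (x ord0 ord0, \col_i x (lift ord0 i) ord0).

Let cV_cons0 d (p : R * 'cV[R]_d) : cV_cons p 0 0 = p.1.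
Proof.
have -> : 0 = lshift d (0 : 'I_1) by exact: val_inj.
by apply: etrans (col_mxEu _ _ _ _) _; rewrite mxE.
Qed.

Let cV_consS d (p : R * 'cV[R]_d) i : cV_cons p (lift ord0 i) 0 = p.2 i 0.
Proof.
have -> : lift ord0 i = rshift 1 i by exact: val_inj.
exact: col_mxEd.
Qed.

Let cV_consK d : cancel (@cV_cons d) (@cV_uncons d).
Proof.
case=> a x; rewrite /cV_uncons cV_cons0; congr pair.
by apply/colP => i; rewrite mxE cV_consS.
Qed.

Let cV_unconsK d : cancel (@cV_uncons d) (@cV_cons d).
Proof.
move=> x; apply/colP => i; rewrite /cV_cons.
have [j ->|j ->] := split_ordP (i : 'I_(1 + d)).
  apply: etrans (col_mxEu _ _ _ _) _; rewrite mxE/=.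
  by congr (x _ _); apply: val_inj; rewrite /= (ord1 j).
apply: etrans (col_mxEd _ _ _ _) _; rewrite mxE/=.
by congr (x _ _); exact: val_inj.
Qed.

Let measurable_cV_uncons d :
  measurable_fun setT (@cV_uncons d : _ -> measurableTypeR R * _)%type.
Proof.
apply: measurable_fun_pair; first exact: measurable_coord.
apply: measurable_fun_mx => i j.
rewrite (_ : (fun _ => _) = (fun M : 'cV[R]_d.+1 => M (lift ord0 i) ord0)).
  exact: measurable_coord.
by apply/funext => x; rewrite mxE.
Qed.

(* d-fold product of the one-dimensional Lebesgue measure, transported to
   'cV[R]_d one coordinate at a time. *)
Fixpoint lebesgue_cV d : set 'cV[R]_d -> \bar R :=
  match d with
  | 0 => \d_ (0 : 'cV[R]_0)
  | d'.+1 => pushforward (@lebesgue_measure R \x @lebesgue_cV d')%E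
                         (@cV_cons d')
  end.

Let lebesgue_cVE d : exists nu : {sigma_finite_measure set 'cV[R]_d -> \bar R},
  @lebesgue_cV d = nu.
Proof.
elim: d => [|d [nu nuE]]; first by exists (\d_ (0 : 'cV[R]_0)).
rewrite /= nuE.
apply: (@pushforward_prod _ _ _ (measurableTypeR R) 'cV[R]_d _ _
  (@lebesgue_measure R) nu _ (@cV_uncons d)).
- exact: measurable_cV_cons.
- exact: measurable_cV_uncons.
- exact: cV_consK.
- exact: cV_unconsK.
Qed.

Let lebesgue_cV0 d : @lebesgue_cV d set0 = 0%E.
Proof. by have [nu ->] := lebesgue_cVE d; exact: measure0. Qed.

Let lebesgue_cV_ge0 d A : (0 <= @lebesgue_cV d A)%E.
Proof. by have [nu ->] := lebesgue_cVE d; exact: measure_ge0. Qed.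

Let lebesgue_cV_sigma_additive d : semi_sigma_additive (@lebesgue_cV d).
Proof.
by have [nu ->] := lebesgue_cVE d; exact: measure_semi_sigma_additive.
Qed.

HB.instance Definition _ d := isMeasure.Build _ 'cV[R]_d R (@lebesgue_cV d)
  (@lebesgue_cV0 d) (@lebesgue_cV_ge0 d) (@lebesgue_cV_sigma_additive d).

Let lebesgue_cV_sigma_finite d : sigma_finite setT (@lebesgue_cV d).
Proof. by have [nu ->] := lebesgue_cVE d; exact: sigma_finiteT. Qed.

HB.instance Definition _ d := Measure_isSigmaFinite.Build _ 'cV[R]_d R
  (@lebesgue_cV d) (@lebesgue_cV_sigma_finite d).

Lemma measurable_box d (a b : 'cV[R]_d) :
  measurable [set x : 'cV[R]_d | forall i, a i 0 <= x i 0 < b i 0].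
Proof.
rewrite (_ : mkset _ = \bigcap_(i in [set: 'I_d])
    (fun x : 'cV[R]_d => x i 0) @^-1` `[a i 0, b i 0[%classic).
  apply: fin_bigcap_measurable => // i _.
  by rewrite -[X in measurable X]setTI; apply: measurable_coord.
apply/seteqP; split=> x /= h i; last by have := h i I; rewrite /= in_itv.
by move=> _ /=; rewrite in_itv; exact: h.
Qed.

Lemma lebesgue_cV_box d (a b : 'cV[R]_d) : (forall i, a i 0 <= b i 0) ->
  lebesgue_cV [set x : 'cV[R]_d | forall i, a i 0 <= x i 0 < b i 0] =
  (\prod_(i < d) (b i 0 - a i 0))%:E.
Proof.
elim: d a b => [|d IHd] a b ab.
  by rewrite big_ord0 /= diracE mem_set//= => -[].
rewrite big_ord_recl /= /pushforward.
pose a' : 'cV[R]_d := \col_i a (lift ord0 i) 0.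
pose b' : 'cV[R]_d := \col_i b (lift ord0 i) 0.
rewrite (_ : _ @^-1` _ = `[a 0 0, b 0 0[%classic `*`
    [set x : 'cV[R]_d | forall i, a' i 0 <= x i 0 < b' i 0]); last first.
  apply/seteqP; split=> [[t x]/= h|[t x]/= []]; rewrite in_itv/=.
    split=> [|i]; first by have := h 0; rewrite cV_cons0.
    by have := h (lift ord0 i); rewrite cV_consS !mxE.
  move=> tab h i; case: (unliftP ord0 i) => [j ->|->]; last by rewrite cV_cons0.
  by rewrite cV_consS; have := h j; rewrite !mxE.
have [nu nuE] := lebesgue_cVE d.
rewrite nuE (product_measure1E (@lebesgue_measure R) nu)//; last first.
  exact: measurable_box.
rewrite -nuE IHd; last by move=> i; rewrite !mxE.
rewrite [X in (X * _)%E]lebesgue_measure_itv/= lte_fin EFinM.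
congr (_ * _)%E; last by congr EFin; apply: eq_bigr => i _; rewrite !mxE.
case: ltP => [//|ba]; have -> : b ord0 0 = a ord0 0.
  by apply/eqP; rewrite eq_le ba ab.
by rewrite subrr.
Qed.

End lebesgue.
Arguments lebesgue_cV {R d}.

Section locally_finite_measures.
Context {R : realType} {d : nat}.

Definition locally_finite (nu : set 'cV[R]_d -> \bar R) :=
  forall x, exists2 U, open_nbhs x U & (nu U < +oo)%E.

Record lf_measure := LFMeasure {
  lf_measure_val :> {measure set 'cV[R]_d -> \bar R} ;
  lf_measureP : locally_finite lf_measure_val }.

Let mzero_lf : locally_finite (mzero : set 'cV[R]_d -> \bar R).
Proof. move=> x; exists setT; last exact: ltry.
by split => //; exact: openT. Qed.

HB.instance Definition _ := gen_eqMixin lf_measure.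
HB.instance Definition _ := gen_choiceMixin lf_measure.
HB.instance Definition _ := isPointed.Build lf_measure (LFMeasure mzero_lf).

Definition Cc : set ('cV[R]_d -> R) :=
  [set f | continuous f /\ compact (closure [set x | f x != 0])].

(* Vague topology: the coarsest one for which nu |-> \int f dnu is continuous
   for all f in C_c. *)
HB.instance Definition _ := @isSubBaseTopological.Build lf_measure
  (('cV[R]_d -> R) * set R)%type [set fU | Cc fU.1 /\ open fU.2]
  (fun fU => [set nu : lf_measure | fU.2 (\int[nu]_x fU.1 x)]).

(* Two elements of lf_measure may differ outside the Borel sets; they are then
   topologically indistinguishable, so that the Borel sigma-algebra is that of
   the space of measures on Borel sets. *)
Definition random_measure dO (Omega : measurableType dO)
    (mu : Omega -> lf_measure) :=
  measurable_fun setT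
    (mu : Omega -> g_sigma_algebraType (@open lf_measure)).

End locally_finite_measures.
Arguments lf_measure : clear implicits.

Section group_action.
Context {R : realType} {d : nat} {dO} {Omega : measurableType dO}.

Definition int_vectors : set 'cV[R]_d :=
  [set g | forall i, g i 0 \is a Num.int].

(* The group is a subset G of R^d, to be taken equal to setT or int_vectors
   (both Borel); the values theta g for g outside G are irrelevant. In the second
   case the trace of the Borel sigma-algebra on G is discrete. *)
Definition measurable_action (G : set 'cV[R]_d)
    (theta : 'cV[R]_d -> Omega -> Omega) :=
  [/\ forall w, theta 0 w = w,
      forall g h, G g -> G h -> theta g \o theta h = theta (g + h) &
      measurable_fun (G `*` setT)
        (fun p : 'cV[R]_d * Omega => theta p.1 p.2)].

Variables (G : set 'cV[R]_d) (theta : 'cV[R]_d -> Omega -> Omega).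
Variable P : probability Omega R.

Definition invariant_set (A : set Omega) := forall g, G g -> theta g @` A = A.

Definition stationary := forall g, G g ->
  forall A, measurable A -> pushforward P (theta g) A = P A.

Definition ergodic := forall A, measurable A -> invariant_set A ->
  P A = 0%E \/ P A = 1%E.

End group_action.

Section statement_definitions.
Context {R : realType} {d : nat}.
Implicit Types (V : 'M[R]_d) (g x : 'cV[R]_d) (m : set 'cV[R]_d -> \bar R).

Definition enorm x : R := Num.sqrt (\sum_(i < d) x i 0 ^+ 2).

Definition tau V g x : 'cV[R]_d := x + V *m g.

Definition translate V g m : set 'cV[R]_d -> \bar R :=
  fun A => m (tau V g @` A).

(* Values on non-Borel sets are not constrained. *)
Definition equivariant dO (Omega : measurableType dO) (G : set 'cV[R]_d)
    (theta : 'cV[R]_d -> Omega -> Omega) V (mu : Omega -> lf_measure R d) :=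
  forall w g, G g ->
  forall A, measurable A -> mu (theta g w) A = translate V g (mu w) A.

Definition cell V : set 'cV[R]_d :=
  [set x | exists2 t : 'I_d -> R,
    (forall i, 0 <= t i < 1) & x = \sum_(i < d) t i *: col i V].

Definition intensity dO (Omega : measurableType dO) (P : probability Omega R)
    V (mu : Omega -> lf_measure R d) : \bar R :=
  ((fine (lebesgue_cV (cell V)))^-1%:E * \int[P]_w mu w (cell V))%E.

Definition rescale (eps : R) m : set 'cV[R]_d -> \bar R :=
  fun A => ((eps ^+ d)%:E * m ((fun x => eps^-1 *: x) @` A))%E.

Lemma rescale_measure (eps : R) (m : {measure set 'cV[R]_d -> \bar R}) :
  0 < eps -> exists nu : {measure set 'cV[R]_d -> \bar R}, rescale eps m = nu.
Proof.
move=> eps0; have eps_ge0 : 0 <= eps ^+ d by rewrite exprn_ge0// ltW.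
have meps : measurable_fun setT (fun x : 'cV[R]_d => eps *: x).
  apply: measurable_fun_mx => i j.
  rewrite (_ : (fun _ => _) = fun x : 'cV[R]_d => eps * x i j).
    by apply: measurable_funM => //; exact: measurable_coord.
  by apply/funext => x; rewrite mxE.
unshelve eexists (mscale (NngNum eps_ge0) (pushforward m (fun x => eps *: x))).
  exact: meps.
apply/funext => A; rewrite /rescale /mscale /pushforward /=.
congr (_ * m _)%E; apply/seteqP; split=> [_ [x Ax <-]|x Ax] /=.
  by rewrite scalerA divff ?gt_eqF// scale1r.
by exists (eps *: x) => //; rewrite scalerA mulVf ?gt_eqF// scale1r.
Qed.

End statement_definitions.

(* Main.v *)
(* In the coordinates t of x = V t, the mass of the box n[a, b), with n and the
   corners a, b integral, is a d-fold iterated ergodic sum of the mass of the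
   cell, with one commuting measure-preserving map per coordinate. The maximal
   function of a function with a weak moment of order > 1 has again such a
   moment; hence Birkhoff's theorem can be applied one coordinate at a time, and
   the averages over n[a, b) converge almost surely and dominatedly.

   When G = R^d the subgroup Z^d need not act ergodically, so the limit is not
   identified directly. Instead, the events that the averages over slightly enlarged
   (shrunk) boxes are eventually at most (at least) lam are stable under the
   whole group, hence have probability 0 or 1, and the mean of the averages
   decides which. Countably many boxes and levels lam give one invariant set of
   full measure on which the averages over all s[a, b) converge, s real.

   The rest is deterministic. Convergence on boxes gives the convergence of the
   integral of a continuous function over a large cube by uniform approximation
   with step functions on a fine grid. It also bounds the rescaled mass of the
   cube of side L by a multiple of L^d, so that summation over dyadic shells
   bounds the contribution of the decaying weight outside this cube by a
   multiple of L^(d - beta), uniformly in eps. *)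

Require Import Defs.
From mathcomp Require Import all_boot all_order all_algebra.
From mathcomp Require Import all_classical all_reals all_analysis.
From mathcomp Require Import measurable_realfun ring lra zify.

Set Implicit Arguments.
Unset Strict Implicit.
Unset Printing Implicit Defensive.

Import Order.TTheory GRing.Theory Num.Theory.
Import numFieldNormedType.Exports.

Local Open Scope classical_set_scope.
Local Open Scope ring_scope.

(** * The maximal ergodic theorem and Birkhoff's theorem *)

(** The required set must be invariant exactly, under each element of a group that may be
    uncountable, and must serve all [phi] and [beta] at once. Excluding a null set for each
    translation or each test function is therefore impossible; only countably many events, each of
    them stable on the nose, may be intersected. In the passage from one coordinate to the next, the
    function to be averaged depends on the same n as the number of summands. Birkhoff's theorem for
    a fixed function does not cover this. A common dominating function is needed, and the bound for
    the next coordinate is its maximal function, which may fail to be integrable when only a first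
    moment is assumed. This is where alpha > 1 enters. The volume of the cell is never computed as a
    determinant. Lebesgue measure over a one-point probability space satisfies the hypotheses of the
    ergodic theorem, and the theorem then yields the volumes of all integral boxes as multiples of
    the volume of the cell. The limit constant appears as mean mass of the cell over its volume,
    which is the intensity. *)

Section maximal.
Context {R : realType} {d : measure_display} {T : measurableType d}.
Variables (P : probability T R) (U : T -> T).
Hypothesis mU : measurable_fun setT U.
Hypothesis pU : forall A, measurable A -> P (U @^-1` A) = P A.

Lemma integral_comp_mp (f : T -> R) : measurable_fun setT f ->
  (forall x, 0 <= f x) ->
  (\int[P]_x (f (U x))%:E = \int[P]_x (f x)%:E)%E.
Proof.
move=> mf f0.
have -> : (\int[P]_x (f x)%:E = \int[pushforward P U]_x (f x)%:E)%E.
  apply: eq_measure_integral => A mA _; rewrite /pushforward.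
  exact/esym/pU.
rewrite ge0_integral_pushforward//; first exact/measurable_EFinP.
by move=> y _; rewrite lee_fin.
Qed.

Lemma measurable_iter k : measurable_fun setT (iter k U).
Proof.
by elim: k => [|k IH]; [exact: measurable_id|exact: measurableT_comp].
Qed.

Definition bsum (f : T -> R) n w := \sum_(k < n) f (iter k U w).

Lemma bsumS f n w : bsum f n.+1 w = f w + bsum f n (U w).
Proof.
by rewrite /bsum big_ord_recl /=; congr +%R; apply: eq_bigr => i _; rewrite -iterSr.
Qed.

Lemma bsum_recr f n w : bsum f n.+1 w = bsum f n w + f (iter n U w).
Proof. exact: big_ord_recr. Qed.

Lemma measurable_bsum (f : T -> R) n : measurable_fun setT f -> measurable_fun setT (bsum f n).
Proof.
move=> mf; apply: measurable_sum => k.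
by apply: measurableT_comp => //; exact: measurable_iter.
Qed.

Lemma bsum_ge0 f n w : (forall x, 0 <= f x) -> 0 <= bsum f n w.
Proof. by move=> f0; apply: sumr_ge0. Qed.

(** This is the maximum of [bsum u k w - bsum v k w] over k <= n, given by the recursion that
    Garsia's argument exploits. Two nonnegative functions are kept instead of their difference, so
    that all integrals are of nonnegative functions. *)
Fixpoint bmax (u v : T -> R) n w : R :=
  if n is n'.+1 then Num.max 0 (u w - v w + bmax u v n' (U w)) else 0.

Lemma bmax_ge0 u v n w : 0 <= bmax u v n w.
Proof. by case: n => [|n] //=; rewrite le_max lexx. Qed.

Lemma bmax_mono u v n w : bmax u v n w <= bmax u v n.+1 w.
Proof.
elim: n w => [|n IH] w; first exact: bmax_ge0.
rewrite [leLHS]/= [leRHS]/= ge_max le_max lexx/= le_max; apply/orP; right.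
by rewrite lerD2l; exact: IH.
Qed.

Lemma measurable_bmax u v n : measurable_fun setT u -> measurable_fun setT v ->
  measurable_fun setT (bmax u v n).
Proof.
move=> mu mv; elim: n => [|n IH] /=; first exact: measurable_cst.
apply: measurable_maxr; first exact: measurable_cst.
apply: measurable_funD; first exact: measurable_funB.
exact: measurableT_comp.
Qed.

Lemma bsum_le_bmax u v n k w : (k <= n)%N -> bsum u k w - bsum v k w <= bmax u v n w.
Proof.
elim: n k w => [|n IH] [|k] w //; rewrite ?ltnS => kn.
- by rewrite /bsum !big_ord0 subrr.
- by rewrite /bsum !big_ord0 subrr; exact: bmax_ge0.
rewrite !bsumS /= le_max; apply/orP; right.
rewrite opprD addrACA lerD2l; exact: IH.
Qed.

Lemma bmax_le u v n w : (forall x, 0 <= u x) -> (forall x, 0 <= v x) ->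
  bmax u v n w <= bsum u n w.
Proof.
move=> u0 v0; elim: n w => [|n IH] w /=; first by rewrite /bsum big_ord0.
rewrite bsumS ge_max addr_ge0 ?bsum_ge0//=.
by rewrite lerD// ?gerBl.
Qed.

Definition bpos u v : set T := \bigcup_n [set w | 0 < bmax u v n w].

Lemma measurable_bmax_pos u v n : measurable_fun setT u -> measurable_fun setT v ->
  measurable [set w | 0 < bmax u v n w].
Proof.
move=> mu mv.
have := measurable_bmax n mu mv.
move=> /(_ measurableT `]0, +oo[%classic (measurable_itv _)).
rewrite setTI; congr (measurable _); apply/seteqP.
by split=> x /=; rewrite in_itv/= andbT.
Qed.

Lemma measurable_bpos u v : measurable_fun setT u -> measurable_fun setT v ->
  measurable (bpos u v).
Proof.
by move=> mu mv; apply: bigcup_measurable => n _; exact: measurable_bmax_pos.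
Qed.

Lemma integral_bsum (f : T -> R) n : measurable_fun setT f -> (forall x, 0 <= f x) ->
  (\int[P]_x (bsum f n x)%:E = n%:R%:E * \int[P]_x (f x)%:E)%E.
Proof.
move=> mf f0; elim: n => [|n IH].
  rewrite mul0e; under eq_integral do rewrite /bsum big_ord0.
  exact: integral0.
under eq_integral do rewrite bsumS EFinD.
rewrite ge0_integralD//; first last.
- apply/measurable_EFinP; apply: measurableT_comp => //; exact: measurable_bsum.
- by move=> x _; rewrite lee_fin; exact: bsum_ge0.
- exact/measurable_EFinP.
- by move=> x _; rewrite lee_fin.
rewrite integral_comp_mp//; [|exact: measurable_bsum|by move=> x; exact: bsum_ge0].
rewrite IH -{1}[X in (X + _)%E]mul1e -ge0_muleDl ?lee_fin//.
by rewrite -EFinD -natr1 addrC.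
Qed.

(* Garsia's argument: M_(n+1) + v <= u + M_n \o U on the set where M_(n+1) > 0. *)
Lemma maximal_ergodic_n (u v : T -> R) n :
  measurable_fun setT u -> measurable_fun setT v ->
  (forall x, 0 <= u x) -> (forall x, 0 <= v x) ->
  (\int[P]_x (u x)%:E < +oo)%E ->
  (\int[P]_(x in [set w | (0 < bmax u v n w)%R]) (v x)%:E <=
   \int[P]_(x in [set w | (0 < bmax u v n w)%R]) (u x)%:E)%E.
Proof.
move=> mu mv u0 v0 uoo.
case: n => [|n].
  have -> : [set w | 0 < bmax u v 0 w] = set0.
    by apply/seteqP; split=> x //=; rewrite ltxx.
  by rewrite !integral_set0.
set B := [set w | _].
have mB : measurable B by exact: measurable_bmax_pos.
pose M k := (\int[P]_x (bmax u v k x)%:E)%E.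
(* Finiteness comes from [bmax_le] and the integrability of [u]; it permits the cancellation at the
   end. *)
have Mfin k : M k \is a fin_num.
  rewrite ge0_fin_numE; last first.
    by apply: integral_ge0 => x _; rewrite lee_fin; exact: bmax_ge0.
  apply: (@le_lt_trans _ _ (\int[P]_x (bsum u k x)%:E)%E).
    apply: ge0_le_integral => //.
    - by move=> x _; rewrite lee_fin bmax_ge0.
    - exact/measurable_EFinP/measurable_bmax.
    - exact/measurable_EFinP/measurable_bsum.
    - by move=> x _; rewrite lee_fin; exact: bmax_le.
  rewrite integral_bsum//.
  by rewrite lte_mul_pinfty ?lee_fin.
have mbm k : measurable_fun setT (bmax u v k) by exact: measurable_bmax.
(* On the right [bmax] will be composed with [U], which leaves its integral unchanged. By
   [bmax_mono] the index there may be [n.+1] instead of [n], so that the same number stands on both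
   sides. *)
have key : (M n.+1 + \int[P]_(x in B) (v x)%:E <=
            \int[P]_(x in B) (u x)%:E + M n.+1)%E.
  rewrite /M [X in (_ + X <= _)%E]integral_mkcond [X in (_ <= X + _)%E]integral_mkcond.
  have mr (g : T -> R) : measurable_fun setT g ->
     measurable_fun setT ((fun x => (g x)%:E) \_ B).
    move=> mg; apply/(measurable_restrictT _ _).1 => //.
    by apply/measurable_EFinP; exact: measurable_funTS.
  have r0 (g : T -> R) : (forall x, 0 <= g x) ->
     forall x, (0 <= ((fun x => (g x)%:E) \_ B) x)%E.
    by move=> g0 x; rewrite /patch; case: ifP => _ //; rewrite lee_fin.
  rewrite -[X in (_ <= _ + X)%E](@integral_comp_mp (bmax u v n.+1))//; last by move=> x; exact: bmax_ge0.
  rewrite -!ge0_integralD//; first last.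
  - exact: mr.
  - by move=> x _; exact: r0.
  - exact/measurable_EFinP.
  - by move=> x _; rewrite lee_fin bmax_ge0.
  - by apply/measurable_EFinP; exact: measurableT_comp.
  - by move=> x _; rewrite lee_fin bmax_ge0.
  - exact: mr.
  - by move=> x _; exact: r0.
  apply: ge0_le_integral => //.
  - by move=> x _; rewrite adde_ge0// ?lee_fin ?bmax_ge0//; exact: r0.
  - by apply: emeasurable_funD; [exact/measurable_EFinP|exact: mr].
  - apply: emeasurable_funD; [exact: mr|].
    by apply/measurable_EFinP; exact: measurableT_comp.
  move=> x _; rewrite /patch; have [xB|xB] := boolP (x \in B).
    rewrite -!EFinD lee_fin.
    have {}xB : 0 < bmax u v n.+1 x by move: xB; rewrite inE.
    have := bmax_mono u v n (U x).
    have -> : bmax u v n.+1 x = u x - v x + bmax u v n (U x).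
      by move: xB; rewrite /= /Num.max; case: ifPn => //; rewrite ltxx.
    lra.
  rewrite addeC leeD// lee_fin.
  have {}xB : bmax u v n.+1 x <= 0.
    by rewrite leNgt; apply/negP => h; move: xB; rewrite notin_setE.
  exact: le_trans xB (bmax_ge0 u v n.+1 (U x)).
by move: key; rewrite addeC leeD2rE.
Qed.

(** Monotone convergence: the sets where [bmax] is positive increase to [bpos]. *)
Lemma maximal_ergodic (u v : T -> R) :
  measurable_fun setT u -> measurable_fun setT v ->
  (forall x, 0 <= u x) -> (forall x, 0 <= v x) ->
  (\int[P]_x (u x)%:E < +oo)%E ->
  (\int[P]_(x in bpos u v) (v x)%:E <= \int[P]_(x in bpos u v) (u x)%:E)%E.
Proof.
move=> mu mv u0 v0 uoo.
have nd : nondecreasing_seq (fun n => [set w | 0 < bmax u v n w]).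
  apply/nondecreasing_seqP => n; rewrite subsetEset => w /= /lt_le_trans; apply.
  exact: bmax_mono.
have h (g : T -> R) : measurable_fun setT g -> (forall x, 0 <= g x) ->
  (\int[P]_(x in [set w | (0 < bmax u v n w)%R]) (g x)%:E @[n --> \oo] -->
   \int[P]_(x in bpos u v) (g x)%:E)%E.
  move=> mg g0; apply: ge0_nondecreasing_set_cvg_integral => //.
  - by move=> n; exact: measurable_bmax_pos.
  - by move=> n; apply/measurable_EFinP; exact: measurable_funTS.
  - by move=> n x _; rewrite lee_fin.
rewrite -(cvg_lim _ (h _ mv v0))// -(cvg_lim _ (h _ mu u0))//.
apply: lee_lim.
- exact/cvgP/(h _ mv v0).
- exact/cvgP/(h _ mu u0).
- by apply: nearW => n; exact: maximal_ergodic_n.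
Qed.

(* On an invariant set one can replace u, v by their restrictions. *)
Lemma maximal_ergodic_invariant (u v : T -> R) (E : set T) :
  measurable_fun setT u -> measurable_fun setT v ->
  (forall x, 0 <= u x) -> (forall x, 0 <= v x) ->
  (\int[P]_x (u x)%:E < +oo)%E ->
  measurable E -> U @^-1` E = E ->
  (forall w, E w -> exists k, bsum v k w < bsum u k w) ->
  (\int[P]_(x in E) (v x)%:E <= \int[P]_(x in E) (u x)%:E)%E.
Proof.
move=> mu mv u0 v0 uoo mE iE Ek.
pose u' x := u x * \1_E x; pose v' x := v x * \1_E x.
have EU x : E (U x) = E x by rewrite -[in RHS]iE.
have iterE k x : E (iter k U x) = E x by elim: k => //= k IH; rewrite EU.
have ind x : \1_E x = (if x \in E then 1 else 0) :> R.
  by rewrite indicE; case: (x \in E).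
have bE : bpos u' v' = E.
  apply/seteqP; split=> [x [n _ /=]|x Ex].
    apply: contraPP => nEx; apply/negP; rewrite -leNgt.
    elim: n x nEx => [|n IH] x nEx //=.
    rewrite ge_max lexx/= /u' /v' ind memNset// !mulr0 subrr add0r.
    by apply: IH; rewrite EU.
  have [k kx] := Ek x Ex; exists k => //=.
  apply: (lt_le_trans _ (bsum_le_bmax u' v' x (leqnn k))) => //.
  rewrite subr_gt0 /bsum.
  have e (g : T -> R) : \sum_(i < k) (g (iter i U x) * \1_E (iter i U x)) = bsum g k x.
    by apply: eq_bigr => i _; rewrite ind mem_set ?mulr1// iterE.
  by rewrite !e.
have mI : measurable_fun setT (\1_E : T -> R) by exact: measurable_indic.
have := @maximal_ergodic u' v'; rewrite bE.
have e (g : T -> R) : (\int[P]_(x in E) (g x * \1_E x)%:E = \int[P]_(x in E) (g x)%:E)%E.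
  by apply: eq_integral => x xE; rewrite ind xE mulr1.
rewrite !e; apply.
- exact: measurable_funM.
- exact: measurable_funM.
- by move=> x; rewrite mulr_ge0// indicE.
- by move=> x; rewrite mulr_ge0// indicE.
- apply: le_lt_trans uoo; apply: ge0_le_integral => //.
  + by move=> x _; rewrite lee_fin mulr_ge0// indicE.
  + by apply/measurable_EFinP; exact: measurable_funM.
  + exact/measurable_EFinP.
  + by move=> x _; rewrite lee_fin /u' ind; case: ifP; rewrite ?mulr1 ?mulr0.
Qed.

(** The maximal inequality with the constant [lam] in the place of [v]. *)
Lemma weak_type (h : T -> R) (lam : R) : 0 < lam ->
  measurable_fun setT h -> (forall x, 0 <= h x) ->
  (\int[P]_x (h x)%:E < +oo)%E ->
  exists2 B, measurable B &
    (forall w, (exists k, lam * k%:R < bsum h k w) -> B w) /\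
    (lam%:E * P B <= \int[P]_x (h x)%:E)%E.
Proof.
move=> lam0 mh h0 hoo; exists (bpos h (cst lam)).
  by apply: measurable_bpos => //; exact: measurable_cst.
split.
  move=> w [k kw]; exists k => //=.
  apply: (lt_le_trans _ (bsum_le_bmax h (cst lam) w (leqnn k))) => //.
  by rewrite subr_gt0 [ltLHS]/bsum /= sumr_const card_ord -mulr_natr.
have mB : measurable (bpos h (cst lam)).
  by apply: measurable_bpos => //; exact: measurable_cst.
have := @maximal_ergodic h (cst lam) mh (measurable_cst _) h0 _ hoo.
move=> /(_ (fun=> ltW lam0)); rewrite [leLHS](integral_cst P mB lam%:E).
move=> /le_trans; apply.
apply: ge0_subset_integral => //; first exact/measurable_EFinP.
by move=> x _; rewrite lee_fin.
Qed.

End maximal.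

Section measurable_comparison.
Context {R : realType} {d : measure_display} {T : measurableType d}.
Implicit Types (g : T -> R) (c : R).

Lemma measurable_set_gt g c : measurable_fun setT g -> measurable [set w | c < g w].
Proof.
move=> /(_ measurableT `]c, +oo[%classic (measurable_itv _)).
rewrite setTI; congr (measurable _); apply/seteqP.
by split=> x /=; rewrite in_itv/= andbT.
Qed.

Lemma measurable_set_lt g c : measurable_fun setT g -> measurable [set w | g w < c].
Proof.
move=> /(_ measurableT `]-oo, c[%classic (measurable_itv _)).
by rewrite setTI; congr (measurable _); apply/seteqP; split=> x /=; rewrite in_itv.
Qed.

Lemma measurable_set_ge g c : measurable_fun setT g -> measurable [set w | c <= g w].
Proof.
move=> /(measurable_set_lt c)/measurableC; congr (measurable _).
by apply/seteqP; split=> x /=; [move/negP; rewrite -leNgt|rewrite leNgt => /negP].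
Qed.

Lemma measurable_set_le g c : measurable_fun setT g -> measurable [set w | g w <= c].
Proof.
move=> /(measurable_set_gt c)/measurableC; congr (measurable _).
by apply/seteqP; split=> x /=; [move/negP; rewrite -leNgt|rewrite leNgt => /negP].
Qed.

End measurable_comparison.

Lemma ae_forall_countable {R : realType} {d : measure_display}
    {T : measurableType d} (P : {measure set T -> \bar R}) (I : countType)
    (Q : I -> T -> Prop) :
  (forall i, \forall x \ae P, Q i x) -> \forall x \ae P, forall i, Q i x.
Proof.
move=> hQ.
have : \forall x \ae P, forall n,
    (if unpickle n is Some i then Q i x else True) : Prop.
  apply: (@ae_foralln _ _ _ P (fun n x => if unpickle n is Some i then Q i x else True)).
  move=> n; case: (unpickle n) => [i|]; first exact: hQ.
  exact: aeW.
by apply: filterS => x /= h i; have := h (pickle i); rewrite pickleK.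
Qed.

Lemma ex_nat_ge {R : realType} (x : R) :
  exists n : nat, forall m, (n <= m)%N -> x <= m%:R.
Proof.
exists (Num.truncn x).+1 => m nm.
by rewrite (le_trans (ltW (truncnS_gt x)))// ler_nat.
Qed.

Section oscillation.
Context {R : realType}.

Definition often (A : pred nat) := forall N, exists2 n, (N <= n)%N & A n.

Lemma not_often (A : pred nat) : ~ often A ->
  exists N, forall n, (N <= n)%N -> ~~ A n.
Proof.
move=> /existsNP[N hN]; exists N => n Nn; apply/negP => An; apply: hN.
by exists n.
Qed.

(** The limit is the upper limit, obtained as the supremum of the levels exceeded infinitely often.
    If the sequence fell below it by [e] infinitely often, two rationals in between would be crossed
    infinitely often. *)
Lemma cvg_no_oscillation (x : R^nat) (K : R) : (forall n, 0 <= x n <= K) ->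
  (forall a b : rat, 0 <= a -> a < b ->
     ~ (often (fun n => x n < ratr a) /\ often (fun n => ratr b < x n))) ->
  cvgn x.
Proof.
move=> xK osc.
pose S := [set y : R | often (fun n => y < x n)].
have hS : has_sup S.
  split; first by exists (-1) => N; exists N => //; have := xK N; lra.
  exists K => y /(_ 0%N)[n _ yn]; have := xK n; lra.
apply/cvg_ex; exists (sup S); apply/cvgrPdist_le => /= e e0.
have [N1 h1] : exists N, forall n, (N <= n)%N -> ~~ (sup S + e < x n).
  apply: not_often => h; have : S (sup S + e) by [].
  by move=> /(ub_le_sup hS.2); lra.
have [N2 h2] : exists N, forall n, (N <= n)%N -> ~~ (x n < sup S - e).
  apply: not_often => h.
  have [y Sy ye] := sup_adherent (divr_gt0 e0 (ltr0n _ 2)) hS.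
  (* The lower rational has to be nonnegative: some term lies below [sup S - e], and all terms are
     nonnegative. *)
  have x0 : 0 < sup S - e.
    by have [n _ hn] := h 0%N; have := xK n; lra.
  have [a] : exists a : rat, ratr a \in `]sup S - e, sup S - e / 2 - e / 4[.
    by apply: rat_in_itvoo; lra.
  rewrite in_itv/= => /andP[a1 a2].
  have [b] : exists b : rat, ratr b \in `]sup S - e / 2 - e / 4, sup S - e / 2[.
    by apply: rat_in_itvoo; lra.
  rewrite in_itv/= => /andP[b1 b2].
  apply: (osc a b).
  - by rewrite -(ler0q R); lra.
  - by rewrite -(ltr_rat R); lra.
  split=> N.
    by have [n Nn hn] := h N; exists n => //; lra.
  by have [n Nn hn] := Sy N; exists n => //; lra.
near=> n.
have n1 : (N1 <= n)%N by near: n; exact: nbhs_infty_ge.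
have n2 : (N2 <= n)%N by near: n; exact: nbhs_infty_ge.
have := h1 _ n1; have := h2 _ n2; rewrite -!leNgt => ? ?.
rewrite ler_distl; lra.
Unshelve. all: by end_near.
Qed.

End oscillation.

(** * The pointwise ergodic theorem for one transformation *)

Section birkhoff.
Context {R : realType} {d : measure_display} {T : measurableType d}.
Variables (P : probability T R) (U : T -> T).
Hypothesis mU : measurable_fun setT U.
Hypothesis pU : forall A, measurable A -> P (U @^-1` A) = P A.

Lemma ae_comp_mp (Q : T -> Prop) : (\forall w \ae P, Q w) ->
  \forall w \ae P, Q (U w).
Proof.
move=> [N [mN N0 QN]]; exists (U @^-1` N); split.
- by rewrite -[X in measurable X]setTI; exact: mU.
- by rewrite pU.
- by move=> w /= nQ; exact: QN.
Qed.

Lemma ae_orbit (Q : T -> Prop) : (\forall w \ae P, Q w) ->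
  \forall w \ae P, forall k, Q (iter k U w).
Proof.
move=> hQ; apply: ae_foralln => k; elim: k => [//|k IH].
have := ae_comp_mp IH; apply: filterS => w.
by rewrite -iterSr.
Qed.

(** For every j some [h N] has integral at most e / (j + 1), so by the weak type inequality its
    averages exceed [e] only on a set of probability at most 1 / (j + 1). The exceptional points lie
    in all these sets; neither monotonicity nor summability in N is involved. *)
Lemma ae_small_maximal (h : nat -> T -> R) (e : R) : 0 < e ->
  (forall N, measurable_fun setT (h N)) -> (forall N w, 0 <= h N w) ->
  (forall s, 0 < s -> exists N, (\int[P]_w (h N w)%:E <= s%:E)%E) ->
  \forall w \ae P, exists N, forall k, bsum U (h N) k w <= e * k%:R.
Proof.
move=> e0 mh h0 hs.
have hB (j : nat) : exists NB : nat * set T, [/\ measurable NB.2,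
    (forall w, (exists k, e * k%:R < bsum U (h NB.1) k w) -> NB.2 w) &
    (P NB.2 <= (j.+1%:R^-1)%:E)%E].
  have [N hN] := hs (e / j.+1%:R) (divr_gt0 e0 (ltr0Sn _ _)).
  have [B mB [Bw BI]] := weak_type mU pU e0 (mh N) (h0 N) (le_lt_trans hN (ltry _)).
  exists (N, B); split => //=.
  have := le_trans BI hN; rewrite EFinM lee_pmul2l//.
pose B j := (projT1 (cid (hB j))).2.
have mB j : measurable (B j) by rewrite /B; case: cid => ? [].
exists (\bigcap_j B j); split.
- exact: bigcap_measurableType.
- apply/eqP; rewrite eq_le measure_ge0 andbT.
  apply/lee_addgt0Pr => s s0; rewrite add0e.
  have [n hn] := ex_nat_ge s^-1.
  apply: (@le_trans _ _ (P (B n))).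
    apply: le_measure; rewrite ?inE//; first exact: bigcap_measurableType.
    by move=> w; apply.
  have : (P (B n) <= (n.+1%:R^-1)%:E)%E by rewrite /B; case: cid => ? [].
  move=> /le_trans; apply; rewrite lee_fin -[leRHS]invrK.
  by rewrite lef_pV2 ?posrE ?invr_gt0// hn.
- move=> w /=; apply: contra_notP => hw.
  have [j Bj] : exists j, ~ B j w.
    by apply/existsNP => h'; apply: hw => j _; exact: h'.
  exists (projT1 (cid (hB j))).1 => n; rewrite leNgt; apply/negP => jn; apply: Bj.
  by rewrite /B; move: jn; case: cid => -[N B'] [_ hB' _] /= jn; apply: hB'; exists n.
Qed.

(** This is [ae_small_maximal] with e = 1 for the multiples f / (N + 1). *)
Lemma ae_bsum_bounded (f : T -> R) :
  measurable_fun setT f -> (forall x, 0 <= f x) ->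
  (\int[P]_x (f x)%:E < +oo)%E ->
  \forall w \ae P, exists K : R, forall n, bsum U f n w <= K * n%:R.
Proof.
move=> mf f0 foo.
have foo' : (\int[P]_x (f x)%:E)%E \is a fin_num.
  by rewrite ge0_fin_numE//; apply: integral_ge0 => x _; rewrite lee_fin.
have small : \forall w \ae P, exists N : nat, forall k,
    bsum U (fun x => N.+1%:R^-1 * f x) k w <= 1 * k%:R.
  apply: (ae_small_maximal (h := fun N x => N.+1%:R^-1 * f x) ltr01).
  - by move=> N; exact: measurable_funM.
  - by move=> N x; rewrite mulr_ge0.
  move=> s s0; have [N hN] := ex_nat_ge (fine (\int[P]_x (f x)%:E)%E / s).
  exists N; under eq_integral do rewrite EFinM.
  rewrite ge0_integralZl_EFin//.
  - rewrite -(fineK foo') -EFinM lee_fin ler_pdivrMl// -ler_pdivrMr//.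
    by apply: hN; exact: leqnSn.
  - by move=> x _; rewrite lee_fin.
  - exact/measurable_EFinP.
apply: filterS small => w [N hN]; exists N.+1%:R => k.
by have := hN k; rewrite /bsum -mulr_sumr mul1r ler_pdivrMl.
Qed.

(* limsup (bsum f n / n) > b, in a form that is exactly invariant. *)
Definition above (f : T -> R) (b : R) : set T :=
  [set w | exists j : nat,
     often (fun n => (b + j.+1%:R^-1) * n%:R < bsum U f n w)].

Lemma measurable_above f b : measurable_fun setT f -> measurable (above f b).
Proof.
move=> mf.
rewrite (_ : above f b = \bigcup_j \bigcap_N \bigcup_(n in [set n | (N <= n)%N])
    [set w | (b + j.+1%:R^-1) * n%:R < bsum U f n w]); last first.
  apply/seteqP; split=> [w [j h]|w [j _ h]]; exists j => // N.
    by move=> _; have [n Nn hn] := h N; exists n.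
  by have [n Nn hn] := h N I; exists n.
apply: bigcup_measurable => j _; apply: bigcap_measurableType => N _.
apply: bigcup_measurable => n _; apply: measurable_set_gt.
exact: measurable_bsum.
Qed.

(** Replacing w by [U w] removes the summand [f w] and changes n by one. For large n this costs at
    most half of the margin 1 / (j + 1), so the index 2j + 1, with margin 1 / (2j + 2), still
    works. *)
Lemma above_invariant f b : U @^-1` above f b = above f b.
Proof.
apply/seteqP; split=> w [j h]; exists (2 * j).+1; set e := _^-1.
  have ee : j.+1%:R^-1 = 2 * e.
    rewrite /e (_ : (2 * j).+2 = 2 * j.+1)%N; last by rewrite mulnS.
    by rewrite natrM invfM mulrA divff// mul1r.
  have e0 : 0 < e by rewrite /e invr_gt0.
  move=> N; have [n0 hn0] := ex_nat_ge ((b + e - f w) / e).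
  have [n] := h (maxn N n0); rewrite geq_max => /andP[Nn nn0] hn.
  exists n.+1; first exact: leqW.
  rewrite bsumS; move: hn; rewrite ee -natr1.
  have := hn0 _ nn0; rewrite ler_pdivrMr//; nra.
have ee : j.+1%:R^-1 = 2 * e.
  rewrite /e (_ : (2 * j).+2 = 2 * j.+1)%N; last by rewrite mulnS.
  by rewrite natrM invfM mulrA divff// mul1r.
have e0 : 0 < e by rewrite /e invr_gt0.
move=> N; have [n0 hn0] := ex_nat_ge ((f w - b) / e).
have [[//|n]] := h (maxn N n0).+1; rewrite ltnS geq_max => /andP[Nn nn0] hn.
exists n => //.
move: hn; rewrite bsumS ee -natr1.
have := hn0 _ nn0; rewrite ler_pdivrMr//; nra.
Qed.

Lemma bsum_cst c n w : bsum U (cst c) n w = c * n%:R :> R.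
Proof. by rewrite /bsum /= sumr_const card_ord mulr_natr. Qed.

Lemma bsumN f n w : bsum U (fun x => - f x) n w = - bsum U f n w :> R.
Proof. by rewrite /bsum sumrN. Qed.

Lemma lee_mul_eq0 (a b : R) (x : \bar R) : x \is a fin_num -> (0 <= x)%E ->
  a < b -> (b%:E * x <= a%:E * x)%E -> x = 0%E.
Proof.
case: x => // r _; rewrite -!EFinM !lee_fin => r0 ab h.
by congr EFin; nra.
Qed.

(** On the invariant set E where the averages oscillate across a < b, the maximal inequality applied
    in both directions gives b P(E) <= \int_E f <= a P(E), hence P(E) = 0. The limit is left
    unidentified, since [U] is not assumed ergodic. *)
Lemma birkhoff (f : T -> R) :
  measurable_fun setT f -> (forall x, 0 <= f x) ->
  (\int[P]_x (f x)%:E < +oo)%E ->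
  \forall w \ae P, cvgn (fun n => bsum U f n w / n%:R).
Proof.
move=> mf f0 foo.
have null (a b : R) : 0 <= a -> a < b ->
    \forall w \ae P, ~ (above f b w /\ above (fun x => - f x) (- a) w).
  move=> a0 ab; pose E := above f b `&` above (fun x => - f x) (- a).
  have mE : measurable E.
    by apply: measurableI; apply: measurable_above => //; exact: measurableT_comp.
  have iE : U @^-1` E = E by rewrite /E preimage_setI !above_invariant.
  have h1 : (\int[P]_(x in E) b%:E <= \int[P]_(x in E) (f x)%:E)%E.
    apply: (@maximal_ergodic_invariant _ _ _ _ _ mU pU f (cst b)) => //.
      by move=> _ /=; lra.
    move=> w [[j h] _]; have [n _ hn] := h 0%N; exists n.
    rewrite bsum_cst; apply: le_lt_trans hn.
    by rewrite ler_wpM2r// lerDl.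
  have h2 : (\int[P]_(x in E) (f x)%:E <= \int[P]_(x in E) a%:E)%E.
    apply: (@maximal_ergodic_invariant _ _ _ _ _ mU pU (cst a) f) => //.
      rewrite [ltLHS](integral_cst P measurableT a%:E).
      by rewrite lte_mul_pinfty ?lee_fin// (le_lt_trans (probability_le1 P measurableT))// ltry.
    move=> w [_ [j h]]; have [n _ hn] := h 0%N; exists n.
    rewrite bsum_cst; move: hn; rewrite bsumN.
    have : 0 <= j.+1%:R^-1 * n%:R :> R by rewrite mulr_ge0.
    by move: (j.+1%:R^-1) (n%:R) (bsum _ _ _ _) => e m s; lra.
  have : (b%:E * P E <= a%:E * P E)%E.
    by rewrite -!integral_cst//; exact: le_trans h1 h2.
  move=> /(lee_mul_eq0 (fin_num_measure P _ mE) (measure_ge0 P E) ab) PE0.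
  exists E; split => //.
  by move=> w /= /contrapT.
have : \forall w \ae P, forall ab : rat * rat, 0 <= ab.1 -> ab.1 < ab.2 ->
    ~ (above f (ratr ab.2) w /\ above (fun x => - f x) (- ratr ab.1) w).
  apply: ae_forall_countable => -[a b] /=.
  have [a0|_] := boolP (0 <= a); last exact: aeW.
  have [ab|_] := boolP (a < b); last exact: aeW.
  have := null (ratr a) (ratr b); rewrite ler0q a0 ltr_rat ab => /(_ isT isT).
  by apply: filterS.
have := ae_bsum_bounded mf f0 foo.
apply: filterS2 => w [K hK] hab.
have K0 : 0 <= K.
  have := hK 1%N; rewrite mulr1; apply: le_trans.
  exact: bsum_ge0.
apply: (@cvg_no_oscillation _ _ K).
  move=> n; rewrite divr_ge0 ?bsum_ge0//=.
  have [->|n0] := eqVneq n 0%N; first by rewrite invr0 mulr0.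
  by rewrite ler_pdivrMr ?ltr0n ?lt0n.
move=> a b a0 ab [ha hb].
(* The set [above] asks for a margin beyond its level; the levels a + e and b - e, still in order,
   leave the margin e on each side. *)
pose e := (b - a) / 3%:R.
have e0 : 0 < e by rewrite divr_gt0// subr_gt0.
apply: (hab (a + e, b - e)) => /=.
- by rewrite addr_ge0// ltW.
- rewrite /e; lra.
have er0 : 0 < ratr e :> R by rewrite ltr0q.
have [j hj] := ex_nat_ge (ratr e : R)^-1.
have je : j.+1%:R^-1 <= ratr e :> R.
  by rewrite -[leRHS]invrK lef_pV2 ?posrE ?invr_gt0// hj.
split; exists j => N.
  have [[//|n] Nn hn] := hb N.+1; exists n.+1; first exact: ltnW.
  move: hn; rewrite ltr_pdivlMr//; apply: le_lt_trans.
  by rewrite ler_wpM2r// rmorphB/= -addrA gerDl addrC subr_le0.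
have [[//|n] Nn hn] := ha N.+1; exists n.+1; first exact: ltnW.
move: hn; rewrite ltr_pdivrMr// bsumN => hn.
rewrite -[ltLHS]opprK ltrN2; apply: (lt_le_trans hn).
by rewrite -mulNr ler_wpM2r// opprD opprK rmorphD/= -addrA lerDl subr_ge0.
Qed.

End birkhoff.

(** * Ergodic averages of convergent sequences *)

Section light_tail.
Context {R : realType} {d : measure_display} {T : measurableType d}.
Variable P : probability T R.
Implicit Types f g : T -> R.

(* A dyadic form of weak L^p for some p > 1, with r = 2^(1-p); unlike the
   moment condition it is preserved, with the same r, by the ergodic maximal
   function. *)
Definition light_tail f := [/\ measurable_fun setT f, forall w, 0 <= f w &
  exists C r : R, [/\ 0 <= C, 0 < r < 1 &
    forall j : nat, (P [set w | (2 ^+ j < f w)%R] <= (C * (r / 2) ^+ j)%:E)%E]].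

Lemma light_tail_le f g : light_tail f -> measurable_fun setT g ->
  (forall w, 0 <= g w) -> (forall w, g w <= f w) -> light_tail g.
Proof.
move=> [mf f0 [C [r [C0 r01 h]]]] mg g0 gf; split=> //; exists C, r; split=> // j.
apply: le_trans (h j); apply: le_measure; rewrite ?inE; try exact: measurable_set_gt.
by move=> w /= /lt_le_trans; apply.
Qed.

Lemma light_tailD f g : light_tail f -> light_tail g -> light_tail (fun w => f w + g w).
Proof.
move=> [mf f0 [C [r [C0 /andP[r0 r1] hf]]]] [mg g0 [D [s [D0 /andP[s0 s1] hg]]]].
split; [exact: measurable_funD|by move=> w; rewrite addr_ge0|].
pose q := Num.max r s.
have q0 : 0 < q by rewrite /q lt_max r0.
have qr : r <= q by rewrite /q le_max lexx.
have qs : s <= q by rewrite /q le_max lexx orbT.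
have q1 : q < 1 by rewrite /q gt_max r1.
have ge1 : 1 <= 2 / q by rewrite ler_pdivlMr//; lra.
(* If f + g exceeds 2^(j+1), then f or g exceeds 2^j; the shift of the index costs the factor 2 / q.
   The summand 1 takes care of j = 0, where only P <= 1 is used. *)
exists (1 + (C + D) * (2 / q)), q; split.
- by rewrite addr_ge0// mulr_ge0 ?addr_ge0// (le_trans _ ge1).
- by rewrite q0.
case=> [|j].
  rewrite expr0 mulr1; apply: (@le_trans _ _ 1%E).
    by apply: probability_le1; apply: measurable_set_gt; exact: measurable_funD.
  by rewrite lee_fin lerDl mulr_ge0 ?addr_ge0// (le_trans _ ge1).
apply: (@le_trans _ _ (P [set w | (2 ^+ j < f w)%R] + P [set w | (2 ^+ j < g w)%R])%E).
  apply: le_trans (measureU2 _ _ _); try exact: measurable_set_gt.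
  apply: le_measure; rewrite ?inE.
  - by apply: measurable_set_gt; exact: measurable_funD.
  - by apply: measurableU; exact: measurable_set_gt.
  move=> w /= h; apply/orP; move: h; rewrite exprS.
  by case: (ltP (2 ^+ j) (f w)) => //= fw; case: ltP => // gw; lra.
apply: (le_trans (leeD (hf j) (hg j))); rewrite -EFinD lee_fin.
have le j' x : 0 < x -> x <= q -> (x / 2) ^+ j' <= (q / 2) ^+ j'.
  by move=> x0 xq; rewrite lerXn2r ?nnegrE; lra.
have -> : (1 + (C + D) * (2 / q)) * (q / 2) ^+ j.+1 =
    q / 2 * (q / 2) ^+ j + (C + D) * (q / 2) ^+ j.
  by rewrite exprS; move: ((q / 2) ^+ j) => y; field; rewrite gt_eqF.
have := ler_wpM2l C0 (le j r r0 qr); have := ler_wpM2l D0 (le j s s0 qs).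
have : 0 <= q / 2 * (q / 2) ^+ j by rewrite mulr_ge0 ?exprn_ge0//; lra.
lra.
Qed.

Lemma light_tailMn f n : light_tail f -> light_tail (fun w => n%:R * f w).
Proof.
move=> lf; elim: n => [|n IH].
  apply: (light_tail_le lf).
  - by under eq_fun do rewrite mul0r; exact: measurable_cst.
  - by move=> w; rewrite mul0r.
  - by move=> w; rewrite mul0r; case: lf.
rewrite (_ : (fun _ => _) = (fun w => n%:R * f w + f w)); first exact: light_tailD.
by apply/funext => w; rewrite -natr1 mulrDl mul1r.
Qed.

Lemma light_tail_comp f U : measurable_fun setT U ->
  (forall A, measurable A -> P (U @^-1` A) = P A) ->
  light_tail f -> light_tail (f \o U).
Proof.
move=> mU pU [mf f0 [C [r [C0 r01 h]]]]; split.
- exact: measurableT_comp.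
- by move=> w; exact: f0.
exists C, r; split=> // j.
rewrite (_ : mkset _ = U @^-1` [set w | 2 ^+ j < f w])//.
by rewrite pU//; exact: measurable_set_gt.
Qed.

(** Sum over the dyadic levels i >= j: between 2^i and 2^(i+1) the integral is at most 2^(i+1) P(f >
    2^i) <= 2 C r^i, a geometric series. *)
Lemma light_tail_integral f : light_tail f -> exists C r : R,
  [/\ 0 <= C, 0 < r < 1 & forall j : nat,
   (\int[P]_(w in [set w | (2 ^+ j < f w)%R]) (f w)%:E <= (C * r ^+ j)%:E)%E].
Proof.
move=> [mf f0 [C [r [C0 /andP[r0 r1] h]]]].
pose D := 2 * C / (1 - r).
have D0 : 0 <= D by rewrite /D divr_ge0 ?mulr_ge0// subr_ge0 ltW.
exists D, r; split; rewrite ?r0//.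
move=> j; pose B i := [set w | 2 ^+ i < f w].
have mB i : measurable (B i) by exact: measurable_set_gt.
have mfE A : measurable_fun A (EFin \o f).
  by apply/measurable_EFinP; exact: measurable_funTS.
have BS i k : (i <= k)%N -> B k `<=` B i.
  move=> ik w; rewrite /B /=; apply: le_lt_trans.
  by rewrite ler_eXn2l// ltr1n.
(* The partial geometric sum in telescoped form; D is chosen such that D (1 - r) = 2 C. *)
have bnd m : (\int[P]_(w in B j `\` B (j + m)%N) (f w)%:E <=
    (D * (r ^+ j - r ^+ (j + m)))%:E)%E.
  elim: m => [|m IH].
    by rewrite addn0 subrr mulr0 setDv integral_set0.
  have -> : B j `\` B (j + m.+1)%N =
      (B j `\` B (j + m)%N) `|` (B (j + m)%N `\` B (j + m.+1)%N).
    apply/seteqP; split=> w /=.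
      by move=> [Bj nB]; case: (pselect (B (j + m)%N w)) => h'; [right|left].
    case=> -[Bj nB]; split=> //.
      by move=> h'; apply: nB; apply: BS h'; rewrite leq_add2l.
    by apply: BS Bj; rewrite leq_addr.
  rewrite ge0_integral_setU//; first last.
  - apply/disj_setPRL => w /= [Bw nBw]; apply/not_andP; right.
    by move=> /(_ Bw).
  - by move=> w _; rewrite lee_fin.
  - exact: measurableD.
  - exact: measurableD.
  apply: (le_trans (leeD IH (_ : _ <= (2 * C * r ^+ (j + m))%:E)%E)); last first.
    rewrite -EFinD lee_fin addnS exprS.
    have -> : 2 * C = D * (1 - r) by rewrite /D divfK// subr_eq0 gt_eqF.
    by rewrite le_eqVlt; apply/orP; left; apply/eqP; ring.
  apply: (@le_trans _ _ (\int[P]_(w in B (j + m)%N) (2 ^+ (j + m).+1)%:E)%E).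
    apply: (@le_trans _ _
        (\int[P]_(w in B (j + m)%N `\` B (j + m.+1)%N) (2 ^+ (j + m).+1)%:E)%E).
      apply: ge0_le_integral => //.
      - exact: measurableD.
      - by move=> w _; rewrite lee_fin.
      - by move=> w [_]; rewrite /B /= addnS lee_fin => /negP; rewrite -leNgt.
    apply: ge0_subset_integral => //; exact: measurableD.
  rewrite integral_cst//.
  apply: (le_trans (lee_wpmul2l _ (h _))); first by rewrite lee_fin exprn_ge0.
  rewrite -EFinM lee_fin expr_div_n exprS le_eqVlt; apply/orP; left; apply/eqP.
  by field; rewrite expf_neq0.
have nd : nondecreasing_seq (fun m => B j `\` B (j + m)%N).
  apply/nondecreasing_seqP => m; rewrite subsetEset; apply: setDS.
  by apply: BS; rewrite leq_add2l.
have BU : \bigcup_m (B j `\` B (j + m)%N) = B j.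
  apply/seteqP; split=> [w [m _ []]//|w Bw].
  have [n hn] := ex_nat_ge (f w); exists n => //; split=> //.
  rewrite /B /=; apply/negP; rewrite -leNgt (le_trans (hn n (leqnn n)))//.
  apply: (@le_trans _ _ (2 ^+ n)); last by rewrite ler_eXn2l ?ltr1n// leq_addl.
  by rewrite -natrX ler_nat ltnW// ltn_expl.
have := @ge0_nondecreasing_set_cvg_integral _ _ _ _ (EFin \o f) P nd.
rewrite BU => hc.
have {}hc : (\int[P]_(x in B j `\` B (j + m)%N) (f x)%:E @[m --> \oo]
    --> \int[P]_(x in B j) (f x)%:E)%E.
  apply: hc => //; first by move=> i; exact: measurableD.
  by move=> i w _; rewrite lee_fin.
rewrite -(cvg_lim _ hc)//; apply: lime_le; first exact/cvgP/hc.
apply: nearW => m; apply: (le_trans (bnd m)); rewrite lee_fin ler_wpM2l//.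
by rewrite gerBl exprn_ge0// ltW.
Qed.

Lemma light_tail_fin f : light_tail f -> (\int[P]_w (f w)%:E < +oo)%E.
Proof.
move=> lf; have [mf f0 _] := lf; have [C [r [C0 r01 h]]] := light_tail_integral lf.
pose B := [set w | 2 ^+ 0 < f w].
have mB : measurable B by exact: measurable_set_gt.
rewrite -(setUv B) ge0_integral_setU//; first last.
- by rewrite disj_set2E setICr.
- by move=> w _; rewrite lee_fin.
- by rewrite setUv; exact/measurable_EFinP.
- exact: measurableC.
apply: lte_add_pinfty; first by rewrite (le_lt_trans (h 0%N))// ltry.
apply: (@le_lt_trans _ _ (\int[P]_(x in ~` B) 1%:E)%E).
  apply: ge0_le_integral => //.
  - exact: measurableC.
  - by move=> w _; rewrite lee_fin.
  - by apply/measurable_EFinP; exact: measurable_funTS.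
  - by move=> w; rewrite /B /= expr0 => /negP; rewrite -leNgt lee_fin.
rewrite integral_cst//; last exact: measurableC.
rewrite mul1e (le_lt_trans (probability_le1 P _))// ?ltry//.
exact: measurableC.
Qed.

End light_tail.

(** * Maximal functions and light tails *)

Section dunford_schwartz.
Context {R : realType} {d : measure_display} {T : measurableType d}.
Variables (P : probability T R).

(** Markov's inequality for the power alpha bounds the tail at 2^j by a multiple of 2^(-j alpha),
    which is (r / 2)^j for r = 2^(1 - alpha) < 1. *)
Lemma light_tail_moment (f : T -> R) (alpha : R) : 1 < alpha ->
  measurable_fun setT f -> (forall w, 0 <= f w) ->
  (\int[P]_w (f w `^ alpha)%:E < +oo)%E -> light_tail P f.
Proof.
move=> a1 mf f0 Ioo; split=> //.
have [I IE] : exists I : R, (\int[P]_w (f w `^ alpha)%:E)%E = I%:E.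
  exists (fine (\int[P]_w (f w `^ alpha)%:E)%E); rewrite fineK// ge0_fin_numE//.
  by apply: integral_ge0 => x _; rewrite lee_fin powR_ge0.
have I0 : 0 <= I.
  by rewrite -lee_fin -IE; apply: integral_ge0 => x _; rewrite lee_fin powR_ge0.
have p0 : 0 < 2 `^ alpha :> R by rewrite powR_gt0.
exists I, (2 / 2 `^ alpha); split=> //.
  rewrite divr_gt0//= ltr_pdivrMr// mul1r /powR pnatr_eq0/=.
  rewrite -[ltLHS](@lnK R 2) ?posrE// ltr_expR ltr_pMl//.
  by rewrite ln_gt0// ltr1n.
move=> j; set B := [set w | _].
have mB : measurable B by exact: measurable_set_gt.
have -> : 2 / 2 `^ alpha / 2 = (2 `^ alpha)^-1 :> R by field; rewrite gt_eqF.
rewrite exprVn EFinM lee_pdivlMr ?exprn_gt0// muleC -IE.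
rewrite -integral_cst//.
have mfa : measurable_fun setT (fun w => f w `^ alpha).
  by apply: (measurableT_comp (measurable_powR alpha)).
apply: (@le_trans _ _ (\int[P]_(w in B) (f w `^ alpha)%:E)%E).
  apply: ge0_le_integral => //.
  - by move=> w _; rewrite lee_fin exprn_ge0// ltW.
  - by apply/measurable_EFinP; exact: measurable_funTS.
  - move=> w; rewrite /B /= lee_fin => /ltW h.
    rewrite -powR_mulrn ?powR_ge0// -powRrM mulrC powRrM powR_mulrn//.
    by rewrite ge0_ler_powR// ?nnegrE ?exprn_ge0//; lra.
apply: ge0_subset_integral => //; first exact/measurable_EFinP.
by move=> w _; rewrite lee_fin powR_ge0.
Qed.

Variable U : T -> T.
Hypothesis mU : measurable_fun setT U.
Hypothesis pU : forall A, measurable A -> P (U @^-1` A) = P A.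

Lemma bsum_le (f g : T -> R) n w :
  (forall k, f (iter k U w) <= g (iter k U w)) -> bsum U f n w <= bsum U g n w.
Proof. by move=> fg; apply: ler_sum => i _. Qed.

(** The term n = 0 is 0 by the convention on division, so the supremum is nonnegative. An infinite
    supremum becomes 0 under [fine]; for integrable nonnegative [f] this affects only a null set, by
    [ae_bsum_bounded]. *)
Definition maximal_fun (f : T -> R) (w : T) : R :=
  fine (esups (fun n => (bsum U f n w / n%:R)%:E) 0%N).

Lemma measurable_maximal_fun f : measurable_fun setT f ->
  measurable_fun setT (maximal_fun f).
Proof.
move=> mf; apply: measurableT_comp; first exact: fine_measurable.
apply: measurable_fun_esups => n; apply/measurable_EFinP.
by apply: measurable_funM; [exact: measurable_bsum|exact: measurable_cst].
Qed.

Lemma esups0_ge (u : (\bar R)^nat) n : (u n <= esups u 0%N)%E.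
Proof. by apply: ereal_sup_ubound; exists n. Qed.

Lemma maximal_fun_ge0 f w : 0 <= maximal_fun f w.
Proof.
apply: fine_ge0; apply: le_trans (esups0_ge _ 0%N).
by rewrite lee_fin invr0 mulr0.
Qed.

Lemma ae_le_maximal_fun (f : T -> R) : measurable_fun setT f ->
  (forall w, 0 <= f w) -> (\int[P]_w (f w)%:E < +oo)%E ->
  \forall w \ae P, forall n, bsum U f n w <= maximal_fun f w * n%:R.
Proof.
move=> mf f0 foo; apply: filterS (ae_bsum_bounded mU pU mf f0 foo) => w [K hK] n.
have [->|n0] := eqVneq n 0%N; first by rewrite mulr0 /bsum big_ord0.
rewrite -ler_pdivrMr ?ltr0n ?lt0n// -lee_fin /maximal_fun.
set s := esups _ _.
have s0 : (0 <= s)%E.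
  by apply: le_trans (esups0_ge _ 0%N); rewrite lee_fin invr0 mulr0.
have K0 : 0 <= K by have := hK 1%N; rewrite mulr1; apply: le_trans; exact: bsum_ge0.
have sK : (s <= K%:E)%E.
  apply: ge_ereal_sup => _ [m _ <-]; rewrite lee_fin.
  have [->|m0] := eqVneq m 0%N; first by rewrite invr0 mulr0.
  by rewrite ler_pdivrMr ?ltr0n ?lt0n.
rewrite fineK; first exact: esups0_ge.
by rewrite ge0_fin_numE// (le_lt_trans sK)// ltry.
Qed.

(** Truncation: f is at most 2^j plus its restriction g to the set where f > 2^j. An average of f
    above 2^(j+1) forces an average of g above 2^j, and the weak type inequality bounds this event
    by 2^(-j) times the tail integral C r^j. The ratio r is thus unchanged. *)
Lemma light_tail_maximal (f : T -> R) : light_tail P f ->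
  light_tail P (maximal_fun f).
Proof.
move=> lf; have [mf f0 _] := lf.
have [C [r [C0 /andP[r0 r1] h]]] := light_tail_integral lf.
split; [exact: measurable_maximal_fun|exact: maximal_fun_ge0|].
have D0 : 0 <= 2 * C / r by rewrite divr_ge0 ?mulr_ge0// ltW.
exists (1 + 2 * C / r), r; split; [by rewrite addr_ge0|by rewrite r0|].
case=> [|j].
  rewrite expr0 mulr1; apply: (@le_trans _ _ 1%E).
    by apply: probability_le1; apply: measurable_set_gt; exact: measurable_maximal_fun.
  by rewrite lee_fin lerDl.
set B := [set w | 2 ^+ j < f w].
have mB : measurable B by exact: measurable_set_gt.
pose g w := f w * \1_B w.
have mI : measurable_fun setT (\1_B : T -> R) by exact: measurable_indic.
have mg : measurable_fun setT g by exact: measurable_funM.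
have g0 w : 0 <= g w by rewrite mulr_ge0// indicE.
have gI : (\int[P]_w (g w)%:E <= (C * r ^+ j)%:E)%E.
  apply: le_trans (h j); rewrite le_eqVlt; apply/orP; left; apply/eqP.
  rewrite [RHS]integral_mkcond; apply: eq_integral => w _.
  rewrite /g /patch indicE -/B; by case: (w \in B); rewrite ?mulr1 ?mulr0.
have j0 : 0 < 2 ^+ j :> R by rewrite exprn_gt0.
have [A mA [Aw AI]] := weak_type mU pU j0 mg g0 (le_lt_trans gI (ltry _)).
apply: (@le_trans _ _ (P A)).
  apply: le_measure; rewrite ?inE//.
    by apply: measurable_set_gt; exact: measurable_maximal_fun.
  move=> w /= hw; apply: Aw.
  have : ((2 ^+ j.+1)%:E < esups (fun n => (bsum U f n w / n%:R)%:E) 0%N)%E.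
    move: hw; rewrite /maximal_fun; case: (esups _ _) => [s|_|] //=.
    - exact: ltry.
    - by rewrite ltNge exprn_ge0.
  move=> /ereal_sup_gt[_ [n _ <-]]; rewrite lte_fin => hn; exists n.
  have n0 : (0 < n)%N.
    by rewrite lt0n; apply/eqP => n0; move: hn; rewrite n0 invr0 mulr0 ltNge exprn_ge0.
  move: hn; rewrite ltr_pdivlMr ?ltr0n// exprS.
  have : bsum U f n w <= bsum U g n w + 2 ^+ j * n%:R.
    rewrite -(bsum_cst U (2 ^+ j) n w) /bsum -big_split/=; apply: ler_sum => i _.
    rewrite /g indicE; have [_|] := boolP (_ \in B); first by rewrite mulr1 lerDl ltW.
    by rewrite notin_setE /B /= => /negP; rewrite -leNgt mulr0 add0r.
  lra.
have := le_trans AI gI; rewrite muleC -lee_pdivlMr// => /le_trans; apply.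
rewrite lee_fin expr_div_n exprS exprS.
have -> : (1 + 2 * C / r) * (r * r ^+ j / (2 * 2 ^+ j)) =
   (r / 2) * r ^+ j / 2 ^+ j + C * r ^+ j / 2 ^+ j.
  by field; rewrite !gt_eqF.
by rewrite lerDr !mulr_ge0// ?invr_ge0 ?exprn_ge0// ltW.
Qed.

End dunford_schwartz.

(** * Ergodic averages of a sequence of functions, in the manner of Maker's theorem *)

Section dunford_schwartz_step.
Context {R : realType} {d : measure_display} {T : measurableType d}.
Variables (P : probability T R).
Variable U : T -> T.
Hypothesis mU : measurable_fun setT U.
Hypothesis pU : forall A, measurable A -> P (U @^-1` A) = P A.
Variables (F : nat -> T -> R) (H : T -> R).
Hypotheses (mF : forall n, measurable_fun setT (F n))
  (F0 : forall n w, 0 <= F n w) (lH : light_tail P H)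
  (FH : \forall w \ae P, forall n, F n w <= H w)
  (cF : \forall w \ae P, cvgn (F ^~ w)).

(** The distance of the later terms from [F N]. Almost surely all terms lie in [0, H], so the
    supremum is at most H and [fine] changes nothing. *)
Let h N w := fine (esups (fun m => `|F m w - F N w|%:E) N).

Let mh N : measurable_fun setT (h N).
Proof.
apply: measurableT_comp; first exact: fine_measurable.
apply: measurable_fun_esups => m; apply/measurable_EFinP.
by apply: measurableT_comp => //; exact: measurable_funB.
Qed.

Let h0 N w : 0 <= h N w.
Proof.
apply: fine_ge0; apply: (@le_trans _ _ (`|F N w - F N w|%:E)).
  by rewrite lee_fin.
by apply: ereal_sup_ubound; exists N => //=.
Qed.

Let h_ae : \forall w \ae P, forall N, h N w <= H w /\
  forall m, (N <= m)%N -> `|F m w - F N w| <= h N w.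
Proof.
apply: filterS FH => w hw N; rewrite /h.
have sH : (esups (fun m => `|F m w - F N w|%:E) N <= (H w)%:E)%E.
  apply: ge_ereal_sup => _ [m _ <-]; rewrite lee_fin ler_norml.
  have := hw m; have := hw N; have := F0 m w; have := F0 N w; lra.
have s0 : (0 <= esups (fun m => `|F m w - F N w|%:E) N)%E.
  apply: (@le_trans _ _ (`|F N w - F N w|%:E)); first by rewrite lee_fin.
  by apply: ereal_sup_ubound; exists N => //=.
have sf : esups (fun m => `|F m w - F N w|%:E) N \is a fin_num.
  by rewrite ge0_fin_numE// (le_lt_trans sH)// ltry.
split; first by rewrite -lee_fin fineK.
move=> m Nm; rewrite -lee_fin fineK//.
by apply: ereal_sup_ubound; exists m.
Qed.

Let h_cvg : \forall w \ae P, h ^~ w @ \oo --> 0.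
Proof.
apply: filterS2 FH cF => w hw /cauchy_cvgP/cauchy_ballP cw.
apply/cvgrPdist_le => /= e e0; have e40 : 0 < e / 2 by rewrite divr_gt0.
have := cw _ e40; rewrite near_map2/= => -[[A B]/= [[N1 _ hA] [N2 _ hB]] AB].
exists (maxn N1 N2) => // N /=; rewrite geq_max => /andP[n1 n2].
rewrite sub0r normrN ger0_norm// -lee_fin /h.
have s0 : (0 <= esups (fun m => `|F m w - F N w|%:E) N)%E.
  apply: (@le_trans _ _ (`|F N w - F N w|%:E)); first by rewrite lee_fin.
  by apply: ereal_sup_ubound; exists N => //=.
have se : (esups (fun m => `|F m w - F N w|%:E) N <= e%:E)%E.
  apply: ge_ereal_sup => _ [m Nm <-]; rewrite lee_fin ltW//.
  have := AB (m, N); rewrite /ball /= => hmN; apply: lt_trans (hmN _) _.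
    by split; [apply: hA => /=; exact: leq_trans n1 Nm|exact: hB].
  lra.
by rewrite fineK// ge0_fin_numE// (le_lt_trans se)// ltry.
Qed.

Let h_int (s : R) : 0 < s -> exists N, (\int[P]_w (h N w)%:E <= s%:E)%E.
Proof.
move=> s0; have [mH H0 _] := lH.
have cae : \forall w \ae P, setT w -> (h N w)%:E @[N --> \oo] --> 0%E.
  by apply: filterS h_cvg => w hw _; apply: cvg_EFin; [exact: nearW|exact: hw].
have iH : P.-integrable setT (fun w => (H w)%:E).
  apply/integrableP; split; first exact/measurable_EFinP.
  under eq_integral do rewrite gee0_abs ?lee_fin//.
  exact: light_tail_fin.
have dom : \forall w \ae P, forall N, setT w -> (`|(h N w)%:E| <= (H w)%:E)%E.
  apply: filterS h_ae => w hw N _; rewrite gee0_abs ?lee_fin//.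
  by have [] := hw N.
have [_ _] := dominated_convergence measurableT
  (fun N => (measurable_EFinP _ _).2 (mh N)) (measurable_cst 0%E) cae iH dom.
rewrite integral0 => /fine_cvgP[[N1 _ fN]] /cvgrPdist_lt/(_ _ s0)[N2 _ hN].
exists (maxn N1 N2).
have fin : (\int[P]_w (h (maxn N1 N2) w)%:E)%E \is a fin_num.
  exact: fN (leq_maxl _ _).
rewrite -(fineK fin) lee_fin.
have := hN (maxn N1 N2) (leq_maxr _ _); rewrite /= sub0r normrN => h'.
exact: le_trans (ler_norm _) (ltW h').
Qed.

Variable b : nat.

(** For fixed N Birkhoff's theorem applies to [F N]. For n >= N the error of replacing [F n] by
    [F N] is an average of [h N], which is small for a suitable N, uniformly in the number of terms.
    Since the limits for different N are unknown, the conclusion is drawn from the Cauchy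
    criterion. *)
Lemma dunford_schwartz_cvg :
  \forall w \ae P, cvgn (fun n => bsum U (F n) (n * b) w / n%:R).
Proof.
have [b0|b_gt0] := posnP b.
  apply: aeW => w; apply/cvg_ex; exists 0.
  rewrite (_ : (fun _ => _) = cst 0); first exact: cvg_cst.
  by apply/funext => n; rewrite b0 muln0 /bsum big_ord0 mul0r.
have ib : \forall w \ae P, forall N, cvgn (fun n => bsum U (F N) n w / n%:R).
  apply: ae_foralln => N; apply: (@birkhoff _ _ _ P _ mU pU) => //.
  apply: le_lt_trans (light_tail_fin lH); have [mH H0 _] := lH.
  apply: ae_ge0_le_integral => //.
  - by move=> w _; rewrite lee_fin.
  - exact/measurable_EFinP.
  - by move=> w _; rewrite lee_fin.
  - exact/measurable_EFinP.
  - by apply: filterS FH => w /(_ N) hw _; rewrite lee_fin.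
have ih : \forall w \ae P, forall j : nat, exists N, forall k,
    bsum U (h N) k w <= j.+1%:R^-1 * k%:R.
  by apply: ae_foralln => j; exact: (ae_small_maximal mU pU _ mh h0 h_int).
apply: filterS3 ib ih (ae_orbit mU pU h_ae) => w wb wh wo.
apply/cauchy_cvgP/cauchy_exP => e e0.
(* A sum of n * b terms is divided by n only, so the bound 1 / (j + 1) on the averages of [h N]
   enters multiplied by b. *)
have [j hj] := ex_nat_ge (2 * b%:R / e).
have je : b%:R * j.+1%:R^-1 <= e / 2.
  have := hj j.+1 (leqnSn j); rewrite ler_pdivrMr// => h'.
  by rewrite ler_pdivrMr//; lra.
have [N hN] := wh j.
have /cvg_ex[/= l hl] := wb N.
exists (b%:R * l).
have : (fun n => b%:R * (bsum U (F N) (n * b) w / (n * b)%:R)) @ \oo --> b%:R * l.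
  apply: cvgM; first exact: cvg_cst.
  apply: (cvg_comp (fun n => (n * b)%N) _ _ hl).
  apply/cvgnyPge => A; exists A => // n /= An.
  by rewrite (leq_trans An)// leq_pmulr.
move=> /cvgrPdist_lt/(_ _ (divr_gt0 e0 (ltr0n _ 2)))[M _ hM].
exists (maxn M N).+1 => // n /= Mn.
have n0 : (0 < n)%N by case: n Mn.
move: Mn; rewrite gtn_max => /andP[/ltnW Mn /ltnW Nn].
rewrite /ball/=; have := hM n Mn; rewrite /= natrM invfM.
have -> : b%:R * (bsum U (F N) (n * b) w * (n%:R^-1 * b%:R^-1)) =
    bsum U (F N) (n * b) w / n%:R.
  by field; rewrite !pnatr_eq0 -!lt0n n0.
have : `|bsum U (F n) (n * b) w / n%:R - bsum U (F N) (n * b) w / n%:R| <= e / 2.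
  rewrite -mulrBl normrM [`|_^-1|]ger0_norm ?invr_ge0// ler_pdivrMr ?ltr0n//.
  rewrite -sumrB; apply: (le_trans (ler_norm_sum _ _ _)).
  apply: (@le_trans _ _ (bsum U (h N) (n * b) w)).
    by apply: ler_sum => k _; have [_] := wo k N; apply.
  apply: (le_trans (hN _)); rewrite natrM mulrA [_ * n%:R]mulrC -mulrA mulrC.
  by rewrite ler_wpM2r// mulrC.
rewrite !ltr_norml ler_norml; lra.
Qed.

Lemma dunford_schwartz_le : \forall w \ae P, forall n,
  bsum U (F n) (n * b) w / n%:R <= b%:R * maximal_fun U H w.
Proof.
have [mH H0 _] := lH.
have hm := ae_le_maximal_fun mU pU mH H0 (light_tail_fin lH).
apply: filterS2 (ae_orbit mU pU FH) hm => w hw hm n.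
have [->|n0] := eqVneq n 0%N.
  by rewrite invr0 mulr0 mulr_ge0// maximal_fun_ge0.
rewrite ler_pdivrMr ?ltr0n ?lt0n//.
apply: (@le_trans _ _ (bsum U H (n * b) w)); first by apply: bsum_le => k.
apply: (le_trans (hm _)); rewrite natrM.
by rewrite le_eqVlt; apply/orP; left; apply/eqP; ring.
Qed.

End dunford_schwartz_step.

(** * Averages over boxes *)

Section good_sequences.
Context {R : realType} {d : measure_display} {T : measurableType d}.
Variables (P : probability T R).
Implicit Types X Y : nat -> T -> R.

(** The property carried through the induction over coordinates. It bounds the absolute value
    because some boxes arise as differences of two others. *)
Definition ae_cvg_dominated X := [/\ forall n, measurable_fun setT (X n),
  exists2 H, light_tail P H & \forall w \ae P, forall n, `|X n w| <= H w &
  \forall w \ae P, cvgn (X ^~ w)].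

Lemma ae_cvg_dominatedD X Y : ae_cvg_dominated X -> ae_cvg_dominated Y ->
  ae_cvg_dominated (fun n w => X n w + Y n w).
Proof.
move=> [mX [H lH XH] cX] [mY [K lK YK] cY]; split.
- by move=> n; exact: measurable_funD.
- exists (fun w => H w + K w); first exact: light_tailD.
  apply: filterS2 XH YK => w hX hY n.
  by rewrite (le_trans (ler_normD _ _))// lerD.
- by apply: filterS2 cX cY => w hX hY; exact: is_cvgD.
Qed.

Lemma ae_cvg_dominatedB X Y : ae_cvg_dominated X -> ae_cvg_dominated Y ->
  ae_cvg_dominated (fun n w => X n w - Y n w).
Proof.
move=> gX [mY [K lK YK] cY]; apply: (ae_cvg_dominatedD gX); split.
- by move=> n; exact: measurableT_comp.
- by exists K => //; apply: filterS YK => w hY n; rewrite normrN.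
- by apply: filterS cY => w hY; exact: is_cvgN.
Qed.

Lemma ae_cvg_dominated_comp U X : measurable_fun setT U ->
  (forall A, measurable A -> P (U @^-1` A) = P A) ->
  ae_cvg_dominated X -> ae_cvg_dominated (fun n => X n \o U).
Proof.
move=> mU pU [mX [H lH XH] cX]; split.
- by move=> n; exact: measurableT_comp.
- exists (H \o U); first exact: light_tail_comp.
  exact: (ae_comp_mp mU pU XH).
- exact: (ae_comp_mp mU pU cX).
Qed.

Lemma ae_cvg_dominated_bsum U X b : measurable_fun setT U ->
  (forall A, measurable A -> P (U @^-1` A) = P A) -> (forall n w, 0 <= X n w) ->
  ae_cvg_dominated X ->
  ae_cvg_dominated (fun n w => bsum U (X n) (n * b) w / n%:R).
Proof.
move=> mU pU X0 [mX [H lH XH] cX].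
have XH' : \forall w \ae P, forall n, X n w <= H w.
  by apply: filterS XH => w hw n; rewrite (le_trans (ler_norm _)).
split.
- by move=> n; apply: measurable_funM => //; exact: measurable_bsum.
- exists (fun w => b%:R * maximal_fun U H w).
    by apply: light_tailMn; exact: light_tail_maximal.
  apply: filterS (dunford_schwartz_le mU pU lH XH' b) => w hw n.
  by rewrite ger0_norm// divr_ge0// bsum_ge0.
- exact: (dunford_schwartz_cvg mU pU mX X0 lH XH' cX).
Qed.

End good_sequences.

(** * An additive box functional, shifted by one pair of inverse unit steps per coordinate *)

Section box_functional.
Context {R : realType} {d : nat}.
Implicit Types (a b : 'I_d -> R) (j : 'I_d) (c : R).

Definition upd a j c : 'I_d -> R := fun i => if i == j then c else a i.

Lemma updE a j c : upd a j c j = c.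
Proof. by rewrite /upd eqxx. Qed.

Lemma upd_upd a j c c' : upd (upd a j c) j c' = upd a j c'.
Proof. by apply/funext => i; rewrite /upd; case: eqP. Qed.

Lemma upd_id a j : upd a j (a j) = a.
Proof. by apply/funext => i; rewrite /upd; case: eqP => [->|]. Qed.

Context {dT : measure_display} {T : measurableType dT}.
Variables (P : probability T R).
Variables (M : T -> ('I_d -> R) -> ('I_d -> R) -> R).
Variables (S S' : 'I_d -> T -> T).
Hypothesis M0 : forall w a b, 0 <= M w a b.
Hypothesis MD : forall w a b j c, a j <= c -> c <= b j ->
  M w a b = M w a (upd b j c) + M w (upd a j c) b.
Hypothesis MS : forall w a b j,
  M (S j w) a b = M w (upd a j (a j + 1)) (upd b j (b j + 1)).
Hypothesis MS' : forall w a b j,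
  M (S' j w) a b = M w (upd a j (a j - 1)) (upd b j (b j - 1)).
Hypothesis mS : forall j, measurable_fun setT (S j).
Hypothesis mS' : forall j, measurable_fun setT (S' j).
Hypothesis pS : forall j A, measurable A -> P (S j @^-1` A) = P A.
Hypothesis pS' : forall j A, measurable A -> P (S' j @^-1` A) = P A.

Lemma M_iter w a b j k :
  M (iter k (S j) w) a b = M w (upd a j (a j + k%:R)) (upd b j (b j + k%:R)).
Proof.
elim: k a b => [|k IH] a b; first by rewrite !addr0 !upd_id.
by rewrite /= MS IH !upd_upd !updE -!addrA [1 + _]addrC natr1.
Qed.

Lemma M_iter' w a b j k :
  M (iter k (S' j) w) a b = M w (upd a j (a j - k%:R)) (upd b j (b j - k%:R)).
Proof.
elim: k a b => [|k IH] a b; first by rewrite !subr0 !upd_id.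
by rewrite /= MS' IH !upd_upd !updE -!addrA -!opprD [1 + _]addrC natr1.
Qed.

(** Additivity at c = [a j] splits off this degenerate box and leaves the whole box. *)
Lemma M_empty w a b j : a j <= b j -> M w a (upd b j (a j)) = 0.
Proof.
move=> ab; have := MD w (lexx (a j)) ab; rewrite upd_id.
by move=> /eqP; rewrite -subr_eq0 opprD addrCA subrr addr0 oppr_eq0 => /eqP.
Qed.

Lemma M_bsum w a b j k : b j = a j + 1 ->
  M w a (upd b j (a j + k%:R)) = bsum (S j) (fun w => M w a b) k w.
Proof.
move=> bj; elim: k => [|k IH].
  by rewrite addr0 /bsum big_ord0 M_empty// bj lerDl.
rewrite bsum_recr -IH M_iter bj.
have -> : a j + 1 + k%:R = a j + k.+1%:R by rewrite -natr1; ring.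
by rewrite (@MD w a _ j (a j + k%:R)) ?updE ?lerDl ?lerD2l ?ler_nat// upd_upd.
Qed.

(** Below zero the first slab is [-1, 0), already one step away from the unit slab; this is why the
    summand is composed with [S' j], whereas [M_bsum] starts at the identity. *)
Lemma M_bsum' w a b j k : a j = 0 -> b j = 1 ->
  M w (upd a j (- k%:R)) (upd b j 0) =
  bsum (S' j) (fun w => M (S' j w) a b) k w.
Proof.
move=> aj bj; elim: k => [|k IH].
  rewrite /bsum big_ord0 oppr0.
  have -> : upd b j 0 = upd b j (upd a j 0 j) by rewrite updE.
  by apply: M_empty; rewrite updE bj.
rewrite bsum_recr -IH -iterS M_iter' aj bj sub0r.
rewrite (@MD w (upd a j _) _ j (- k%:R)) ?updE ?upd_upd ?oppr_le0// ?lerN2 ?ler_nat//.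
rewrite addrC; congr (_ + M _ _ (upd _ _ _)).
by rewrite -natr1 opprD addrCA subrr addr0.
Qed.

(* One coordinate is blown up from [0, 1) to [n p, n q). *)
Lemma M_step (al be : nat -> 'I_d -> R) j (u : nat -> R) (p q : int) :
  (forall n, al n j = 0) -> (forall n, be n j = 1) -> (forall n, 0 <= u n) ->
  p <= q ->
  ae_cvg_dominated P (fun n w => u n * M w (al n) (be n)) ->
  ae_cvg_dominated P (fun n w => n%:R^-1 * u n *
     M w (upd (al n) j (n%:R * p%:~R)) (upd (be n) j (n%:R * q%:~R))).
Proof.
move=> al0 be1 u0 pq gX.
have X0 n w : 0 <= u n * M w (al n) (be n) by rewrite mulr_ge0.
have pos k : ae_cvg_dominated P (fun n w => n%:R^-1 * u n *
    M w (upd (al n) j 0) (upd (be n) j (n%:R * k%:R))).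
  have := ae_cvg_dominated_bsum k (mS j) (@pS j) X0 gX.
  rewrite (_ : (fun n w => bsum _ _ _ _ / _) = (fun n w => n%:R^-1 * u n *
    M w (upd (al n) j 0) (upd (be n) j (n%:R * k%:R))))//.
  apply/funext => n; apply/funext => w.
  have -> : upd (al n) j 0 = al n by rewrite -(al0 n) upd_id.
  have -> : n%:R * k%:R = al n j + (n * k)%:R by rewrite al0 add0r natrM.
  rewrite M_bsum.
    by rewrite /bsum -mulr_sumr mulrC mulrA.
  by rewrite al0 be1 add0r.
have neg k : ae_cvg_dominated P (fun n w => n%:R^-1 * u n *
    M w (upd (al n) j (- (n%:R * k%:R))) (upd (be n) j 0)).
  have := ae_cvg_dominated_bsum k (mS' j) (@pS' j) _
     (ae_cvg_dominated_comp (mS' j) (@pS' j) gX).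
  rewrite (_ : (fun n w => bsum _ _ _ _ / _) = (fun n w => n%:R^-1 * u n *
    M w (upd (al n) j (- (n%:R * k%:R))) (upd (be n) j 0))).
    by apply=> n w /=; exact: X0.
  apply/funext => n; apply/funext => w.
  by rewrite -natrM M_bsum'// /bsum -mulr_sumr mulrC mulrA.
have sgn (z : int) : exists k : nat, z = k%:Z \/ z = - k%:Z.
  by case: z => k; [exists k; left|exists k.+1; right; rewrite NegzE].
(* A slab on one side of the origin is a difference of two slabs ending at 0; a slab across the
   origin is a sum. The case p >= 0 >= q with p <= q is degenerate. *)
have [k [pk|pk]] := sgn p; have [l [ql|ql]] := sgn q.
- rewrite (_ : (fun n w => _) = (fun n w =>
      n%:R^-1 * u n * M w (upd (al n) j 0) (upd (be n) j (n%:R * l%:R)) -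
      n%:R^-1 * u n * M w (upd (al n) j 0) (upd (be n) j (n%:R * k%:R)))).
    exact: ae_cvg_dominatedB.
  apply/funext => n; apply/funext => w; rewrite -mulrBr; congr (_ * _).
  rewrite pk ql !pmulrn; apply/eqP; rewrite -subr_eq opprK addrC; apply/eqP.
  rewrite (@MD w (upd (al n) j 0) (upd (be n) j (n%:R * l%:R)) j (n%:R * k%:R)).
  + by rewrite !upd_upd.
  + by rewrite updE mulr_ge0.
  + by rewrite updE ler_wpM2l// ler_nat; move: pq; rewrite pk ql lez_nat.
- have k0 : (k = 0)%N by lia.
  have l0 : (l = 0)%N by lia.
  rewrite (_ : (fun n w => _) = (fun n w =>
      n%:R^-1 * u n * M w (upd (al n) j 0) (upd (be n) j (n%:R * 0%:R)))).
    exact: pos.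
  by apply/funext => n; apply/funext => w; rewrite pk ql k0 l0 oppr0 !mulr0.
- rewrite (_ : (fun n w => _) = (fun n w =>
      n%:R^-1 * u n * M w (upd (al n) j (- (n%:R * k%:R))) (upd (be n) j 0) +
      n%:R^-1 * u n * M w (upd (al n) j 0) (upd (be n) j (n%:R * l%:R)))).
    exact: ae_cvg_dominatedD.
  apply/funext => n; apply/funext => w; rewrite -mulrDr; congr (_ * _).
  rewrite pk ql !pmulrn mulrNz mulrN.
  have nk : - (n%:R * k%:R) <= 0 :> R by rewrite oppr_le0 mulr_ge0.
  have nl : 0 <= n%:R * l%:R :> R by rewrite mulr_ge0.
  by rewrite (@MD w (upd (al n) j _) (upd (be n) j (n%:R * l%:R)) j 0) ?updE ?upd_upd.
- rewrite (_ : (fun n w => _) = (fun n w =>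
      n%:R^-1 * u n * M w (upd (al n) j (- (n%:R * k%:R))) (upd (be n) j 0) -
      n%:R^-1 * u n * M w (upd (al n) j (- (n%:R * l%:R))) (upd (be n) j 0))).
    exact: ae_cvg_dominatedB.
  apply/funext => n; apply/funext => w; rewrite -mulrBr; congr (_ * _).
  rewrite pk ql !pmulrn !mulrNz !mulrN; apply/eqP; rewrite -subr_eq opprK; apply/eqP.
  rewrite [RHS](@MD w (upd (al n) j _) (upd (be n) j 0) j (- (n%:R * l%:R))).
  + by rewrite !upd_upd.
  + rewrite updE lerN2 ler_wpM2l// ler_nat; move: pq; rewrite pk ql lerN2.
    by rewrite lez_nat.
  + by rewrite updE oppr_le0 mulr_ge0.
Qed.

Lemma mp_iter U k A : measurable_fun setT U ->
  (forall A, measurable A -> P (U @^-1` A) = P A) ->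
  measurable A -> P (iter k U @^-1` A) = P A.
Proof.
move=> mU pU; elim: k A => [//|k IH] A mA.
have -> : iter k.+1 U @^-1` A = iter k U @^-1` (U @^-1` A) by [].
by rewrite IH ?pU// -[X in measurable X]setTI; exact: mU.
Qed.

(** Each of the q - p unit slabs is a measure-preserving image of the slab [0, 1), so all have the
    same mean. The map [V] carries the first slab to [0, 1), in either direction. *)
Lemma M_int_box (al be : 'I_d -> R) j (p q : int) : al j = 0 -> be j = 1 ->
  p <= q -> measurable_fun setT (fun w => M w al be) ->
  measurable_fun setT (fun w => M w (upd al j p%:~R) (upd be j q%:~R)) /\
  (\int[P]_w (M w (upd al j p%:~R) (upd be j q%:~R))%:E =
   (q - p)%:~R%:E * \int[P]_w (M w al be)%:E)%E.
Proof.
move=> al0 be1 pq mM.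
have [V [mV pV MV]] : exists V : T -> T, [/\ measurable_fun setT V,
    forall A, measurable A -> P (V @^-1` A) = P A &
    forall w, M w (upd al j p%:~R) (upd be j (p%:~R + 1)) = M (V w) al be].
  case: p {pq} => k.
    exists (iter k (S j)); split.
    - exact: (measurable_iter (mS j)).
    - by move=> A mA; apply: (mp_iter _ (mS j) (@pS j) mA).
    - by move=> w; rewrite M_iter al0 be1 add0r pmulrn addrC.
  exists (iter k.+1 (S' j)); split.
  - exact: (measurable_iter (mS' j)).
  - by move=> A mA; apply: (mp_iter _ (mS' j) (@pS' j) mA).
  - by move=> w; rewrite M_iter' al0 be1 sub0r NegzE mulrNz pmulrn addrC.
have [k qE] : exists k : nat, q = p + k%:Z.
  by exists `|q - p|%N; rewrite gez0_abs ?subr_ge0// addrCA subrr addr0.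
have mM' : measurable_fun setT
    (fun w => M w (upd al j p%:~R) (upd be j (p%:~R + 1))).
  by under eq_fun do rewrite MV; exact: measurableT_comp mM mV.
have E w : M w (upd al j p%:~R) (upd be j q%:~R) =
    bsum (S j) (fun w => M w (upd al j p%:~R) (upd be j (p%:~R + 1))) k w.
  rewrite -M_bsum ?updE// upd_upd; congr (M w _ (upd be j _)).
  by rewrite qE intrD.
split.
  by under eq_fun do rewrite E; exact: measurable_bsum.
under eq_integral do rewrite E.
rewrite (integral_bsum (mS j) (@pS j))//; congr (_ * _)%E.
  by rewrite qE addrC addKr pmulrn.
under eq_integral do rewrite MV.
exact: (integral_comp_mp mV pV mM).
Qed.

(** For corners this interpolates, one coordinate per step, between the unit cell at k = 0 and the
    blown-up box at k = d. *)
Let mix (k : nat) (x y : 'I_d -> R) : 'I_d -> R := fun i => if (i < k)%N then y i else x i.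

Let mixS k (kd : (k < d)%N) x y :
  mix k.+1 x y = upd (mix k x y) (Ordinal kd) (y (Ordinal kd)).
Proof.
apply/funext => i; rewrite /mix /upd ltnS leq_eqVlt -val_eqE/=.
by case: eqP => //= ik; congr y; exact: val_inj.
Qed.

Theorem box_average (a b : 'I_d -> int) : (forall i, a i <= b i) ->
  light_tail P (fun w => M w (fun=> 0) (fun=> 1)) ->
  let X n w :=
    n%:R ^- d * M w (fun i => n%:R * (a i)%:~R) (fun i => n%:R * (b i)%:~R) in
  ae_cvg_dominated P X /\
  forall n, (0 < n)%N -> (\int[P]_w (X n w)%:E =
    (\prod_i (b i - a i)%:~R)%:E * \int[P]_w (M w (fun=> 0%R) (fun=> 1%R))%:E)%E.
Proof.
move=> ab lM.
pose al k n := mix k (fun=> 0) (fun i => n%:R * (a i)%:~R).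
pose be k n := mix k (fun=> 1) (fun i => n%:R * (b i)%:~R).
have main k : (k <= d)%N ->
  [/\ ae_cvg_dominated P (fun n w => n%:R ^- k * M w (al k n) (be k n)),
   forall n, measurable_fun setT (fun w => M w (al k n) (be k n)) &
   forall n, (0 < n)%N -> (\int[P]_w (M w (al k n) (be k n))%:E =
    (n%:R ^+ k * \prod_(i < d | (i < k)%N) (b i - a i)%:~R)%:E *
    \int[P]_w (M w (fun=> 0%R) (fun=> 1%R))%:E)%E].
  elim: k => [_|k IH kd].
    have alE n : al 0%N n = (fun=> 0) by [].
    have beE n : be 0%N n = (fun=> 1) by [].
    have [mM _ _] := lM.
    split=> [|n|n n0].
    - rewrite (_ : (fun n w => _) = (fun n w => M w (fun=> 0) (fun=> 1))); last first.
        by apply/funext => n; apply/funext => w; rewrite expr0 invr1 mul1r.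
      split=> //.
      + exists (fun w => M w (fun=> 0) (fun=> 1)) => //.
        by apply: aeW => w n; rewrite ger0_norm.
      + by apply: aeW => w; apply/cvg_ex; eexists; exact: cvg_cst.
    - by [].
    - by rewrite big_pred0 ?mulr1 ?expr0 ?mul1e.
  have [IH1 IH2 IH3] := IH (ltnW kd).
  pose j := Ordinal kd.
  have alS n : al k.+1 n = upd (al k n) j (n%:R * (a j)%:~R) by exact: mixS.
  have beS n : be k.+1 n = upd (be k n) j (n%:R * (b j)%:~R) by exact: mixS.
  have alj n : al k n j = 0 by rewrite /al /mix /= ltnn.
  have bej n : be k n j = 1 by rewrite /be /mix /= ltnn.
  have stepn n : measurable_fun setT (fun w => M w (al k.+1 n) (be k.+1 n)) /\
    (\int[P]_w (M w (al k.+1 n) (be k.+1 n))%:E =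
     (n%:R * (b j - a j)%:~R)%:E * \int[P]_w (M w (al k n) (be k n))%:E)%E.
    rewrite alS beS; have := @M_int_box (al k n) (be k n) j (n%:Z * a j) (n%:Z * b j).
    rewrite -mulrBr !intrM -!pmulrn; apply=> //.
    by rewrite ler_wpM2l.
  split=> [|n|n n0].
  - have := M_step alj bej (u := fun n => n%:R ^- k) _ (ab j) IH1.
    rewrite (_ : (fun n w => _ * _ * _) =
        (fun n w => n%:R ^- k.+1 * M w (al k.+1 n) (be k.+1 n))).
      by apply=> n; rewrite invr_ge0 exprn_ge0.
    apply/funext => n; apply/funext => w.
    by rewrite alS beS exprS invfM.
  - by have [] := stepn n.
  - have [_ ->] := stepn n; rewrite IH3// muleA -EFinM; congr (_%:E * _)%E.
    rewrite [in RHS](bigD1 j)//= exprS.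
    have -> : \prod_(i < d | (i < k.+1)%N && (i != j)) (b i - a i)%:~R =
        \prod_(i < d | (i < k)%N) (b i - a i)%:~R :> R.
      apply: eq_bigl => i; rewrite -val_eqE/= ltnS leq_eqVlt andbC.
      by case: eqP => //= ->; rewrite ltnn.
    by rewrite mulrACA.
move=> X; have [h1 h2 h3] := main d (leqnn d).
have alE n : al d n = (fun i => n%:R * (a i)%:~R).
  by apply/funext => i; rewrite /al /mix ltn_ord.
have beE n : be d n = (fun i => n%:R * (b i)%:~R).
  by apply/funext => i; rewrite /be /mix ltn_ord.
have XE n w : X n w = n%:R ^- d * M w (al d n) (be d n) by rewrite alE beE.
have -> : X = fun n w => n%:R ^- d * M w (al d n) (be d n).
  by apply/funext => n; apply/funext => w.
split=> // n n0.
under eq_integral do rewrite EFinM.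
have n0' : 0 <= n%:R ^- d :> R by rewrite invr_ge0 exprn_ge0.
have mE : measurable_fun setT (fun w => (M w (al d n) (be d n))%:E).
  exact/measurable_EFinP.
rewrite ge0_integralZl_EFin//; last by move=> w _; rewrite lee_fin.
rewrite h3// muleA -EFinM mulrA mulVf ?mul1r ?expf_neq0 ?pnatr_eq0 -?lt0n//.
congr (_%:E * _)%E; apply: eq_bigl => i.
exact: ltn_ord.
Qed.

End box_functional.

(** * Masses of boxes under a random measure *)

Section continuity_matrix.
Context {R : realType}.

Lemma continuous_mx_coord (X : topologicalType) m n (f : X -> 'M[R]_(m, n)) :
  (forall i j, continuous (fun x => f x i j)) -> continuous f.
Proof.
move=> cf x; apply/cvg_ballP => e e0.
have h : \forall y \near x, forall ij : 'I_m * 'I_n, ball (f x ij.1 ij.2) e (f y ij.1 ij.2).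
  apply: filter_forall => -[i j] /=.
  have /cvg_ballP h := cf i j x; exact: h.
by apply: filterS h => y hy; split=> // i j; exact: (hy (i, j)).
Qed.

Lemma continuous_sumr (X : topologicalType) (I : Type) (r : seq I)
    (f : I -> X -> R) :
  (forall i, continuous (f i)) -> continuous (fun x => \sum_(i <- r) f i x).
Proof.
move=> cf x; apply: (@cvg_big _ _ +%R 0 xpredT add_continuous).
by move=> i _; exact: cf.
Qed.

Lemma cvg_prodr (T : Type) (F : set_system T) (I : Type) (r : seq I)
    (f : I -> T -> R) (l : I -> R) : Filter F ->
  (forall i, f i x @[x --> F] --> l i) ->
  \prod_(i <- r) f i x @[x --> F] --> \prod_(i <- r) l i.
Proof.
move=> FF cf.
have := @cvg_big R I *%R 1 xpredT (@mul_continuous R) T F r f l FF.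
by apply=> i _; exact: cf.
Qed.

Lemma continuous_prodr (X : topologicalType) (I : Type) (r : seq I)
    (f : I -> X -> R) :
  (forall i, continuous (f i)) -> continuous (fun x => \prod_(i <- r) f i x).
Proof. by move=> cf x; apply: cvg_prodr => i; exact: cf. Qed.

Lemma mulmx_continuous m n p (A : 'M[R]_(m, n)) :
  continuous (fun B : 'M[R]_(n, p) => A *m B).
Proof.
apply: continuous_mx_coord => i j.
rewrite (_ : (fun _ => _) = (fun B : 'M[R]_(n, p) => \sum_k A i k * B k j)).
  by apply: continuous_sumr => k x; exact: (cvgM (cvg_cst _) (@coord_continuous R n p k j x)).
by apply/funext => B; rewrite mxE.
Qed.

Lemma cV_cube_compact d (a b : 'I_d -> R) :
  compact [set x : 'cV[R]_d | forall i, a i <= x i 0 <= b i].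
Proof.
have := @rV_compact R d (fun i => `[a i, b i]%classic)
  (fun i => @segment_compact R (a i) (b i)).
move=> /(@continuous_compact _ _ (@trmx R 1 d)); rewrite (_ : _ @` _ = [set x : 'cV[R]_d | forall i, a i <= x i 0 <= b i]).
  apply; apply: continuous_subspaceT; apply: continuous_mx_coord => i j.
  rewrite (_ : (fun _ => _) = (fun B : 'M[R]_(1, d) => B j i)).
    exact: coord_continuous.
  by apply/funext => B; rewrite mxE.
apply/seteqP; split=> [_ [v hv <-] i|x hx].
  by rewrite mxE; have := hv i; rewrite /= in_itv.
exists x^T; last by rewrite trmxK.
by move=> i /=; rewrite in_itv/= mxE; exact: hx.
Qed.

End continuity_matrix.

Lemma lf_measure_compact (R : realType) d (nu : lf_measure R d) (K : set 'cV[R]_d) :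
  compact K -> measurable K -> (nu K < +oo)%E.
Proof.
move=> cK mK.
have hU x : exists U, open_nbhs x U /\ (nu U < +oo)%E.
  by have [U ? ?] := lf_measureP nu x; exists U.
pose U x := projT1 (cid (hU x)).
have UP x : open_nbhs x (U x) /\ (nu (U x) < +oo)%E by rewrite /U; case: cid.
have mU x : measurable (U x) by apply: open_measurable_mx; have [[]] := UP x.
move: cK; rewrite compact_cover => /(_ _ setT U)[|x Kx|D _ KD].
- by move=> x _; have [[]] := UP x.
- by exists x => //; have [[]] := UP x.
pose C (s : seq 'cV[R]_d) := [set y | exists2 x, x \in s & U x y].
have h (s : seq 'cV[R]_d) : measurable (C s) /\ (nu (C s) < +oo)%E.
  elim: s => [|x s [mC Coo]].
    have -> : C [::] = set0 by apply/seteqP; split=> // y [].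
    by rewrite measure0.
  have -> : C (x :: s) = U x `|` C s.
    apply/seteqP; split=> y.
      move=> [z]; rewrite inE => /orP[/eqP->|zs] Uy; first by left.
      by right; exists z.
    move=> [Uy|[z zs Uy]]; first by exists x; rewrite ?inE ?eqxx.
    by exists z => //; rewrite inE zs orbT.
  split; first exact: measurableU.
  apply: le_lt_trans (measureU2 _ _ _) _ => //.
  by apply: lte_add_pinfty => //; have [] := UP x.
have [mC Coo] := h (finmap.enum_fset D).
apply: le_lt_trans Coo; apply: le_measure; [exact: mem_set|exact: mem_set|].
by move=> y /KD[x xD Uy]; exists x.
Qed.

Section boxes.
Context {R : realType} {d : nat}.
Variable V : 'M[R]_d.
Hypothesis hV : V \in unitmx.
Implicit Types (a b : 'I_d -> R) (x g : 'cV[R]_d).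

Definition coordV x (i : 'I_d) : R := (invmx V *m x) i 0.

Definition box a b := [set x | forall i, a i <= coordV x i < b i].

Lemma coordVD x g i : coordV (x + g) i = coordV x i + coordV g i.
Proof. by rewrite /coordV mulmxDr mxE. Qed.

Lemma coordVZ (s : R) x i : coordV (s *: x) i = s * coordV x i.
Proof. by rewrite /coordV -scalemxAr mxE. Qed.

Lemma coordV_mul g i : coordV (V *m g) i = g i 0.
Proof. by rewrite /coordV mulKmx. Qed.

Lemma coordV_continuous i : continuous (fun x => coordV x i).
Proof.
move=> x; apply: (@continuous_comp _ _ _ (mulmx (invmx V)) (fun y => y i 0)).
  exact: mulmx_continuous.
exact: coord_continuous.
Qed.

Lemma measurable_coordV i : measurable_fun setT (fun x => coordV x i).
Proof. by apply: continuous_measurable_mx; exact: coordV_continuous. Qed.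

Lemma measurable_forall_ord {dT : measure_display} {T : measurableType dT}
    (Q : 'I_d -> set T) :
  (forall i, measurable (Q i)) -> measurable [set x | forall i, Q i x].
Proof.
move=> mQ; rewrite (_ : mkset _ = \bigcap_(i in [set: 'I_d]) Q i).
  by apply: fin_bigcap_measurable.
by apply/seteqP; split=> x /= h i; [move=> _; exact: h|exact: h].
Qed.

Lemma measurable_boxV a b : measurable (box a b).
Proof.
apply: (@measurable_forall_ord _ _ (fun i => [set x | a i <= coordV x i < b i])) => i.
rewrite (_ : mkset _ = [set x | a i <= coordV x i] `&` [set x | coordV x i < b i]).
  apply: measurableI; first exact: (measurable_set_ge (a i) (measurable_coordV i)).
  exact: (measurable_set_lt (b i) (measurable_coordV i)).
by apply/seteqP; split=> x /= => [/andP[]|[-> ->]].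
Qed.

Lemma cell_box : cell V = box (fun=> 0) (fun=> 1).
Proof.
have e (t : 'I_d -> R) : \sum_(i < d) t i *: col i V = V *m (\col_i t i).
  apply/colP => k; rewrite summxE !mxE; apply: eq_bigr => i _.
  by rewrite !mxE mulrC.
apply/seteqP; split=> x.
  by move=> [t ht ->] i; rewrite e coordV_mul mxE.
move=> hx; exists (coordV x) => //.
rewrite e; have -> : \col_i coordV x i = invmx V *m x.
  by apply/colP => i; rewrite mxE.
by rewrite mulKVmx.
Qed.

Lemma tau_box g a b : tau V g @` box a b =
  box (fun i => a i + g i 0) (fun i => b i + g i 0).
Proof.
apply/seteqP; split=> [_ [x hx <-] i|x hx].
  by rewrite /tau coordVD coordV_mul lerD2r ltrD2r.
exists (x - V *m g); last by rewrite /tau subrK.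
move=> i; rewrite coordVD -mulmxN coordV_mul mxE.
by have := hx i; rewrite lerBrDr ltrBlDr.
Qed.

Lemma box_split a b j c : a j <= c -> c <= b j ->
  box a b = box a (upd b j c) `|` box (upd a j c) b.
Proof.
move=> ac cb; apply/seteqP; split=> [x hx|x [hx|hx] i].
- have [xc|cx] := ltP (coordV x j) c; [left|right] => i; rewrite /upd.
    case: eqP => [->|_]; last exact: hx.
    by rewrite xc andbT; have /andP[] := hx j.
  case: eqP => [->|_]; last exact: hx.
  by rewrite cx; have /andP[] := hx j.
- have := hx i; rewrite /upd; case: eqP => [->|//] /andP[-> /lt_le_trans]; exact.
- have := hx i; rewrite /upd; case: eqP => [->|//] /andP[h ->].
  by rewrite (le_trans ac h).
Qed.

Lemma box_split_disj a b j c :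
  box a (upd b j c) `&` box (upd a j c) b = set0.
Proof.
apply/seteqP; split=> // x [h1 h2].
have := h1 j; have := h2 j; rewrite !updE => /andP[/le_lt_trans h _] /andP[_].
by move=> /h; rewrite ltxx.
Qed.

Lemma box_sub a b a' b' : (forall i, a' i <= a i) -> (forall i, b i <= b' i) ->
  box a b `<=` box a' b'.
Proof.
move=> aa bb x hx i; have /andP[h1 h2] := hx i.
by rewrite (le_trans (aa i) h1) (lt_le_trans h2 (bb i)).
Qed.

Lemma scale_box (s : R) a b : 0 < s ->
  (fun x => s *: x) @` box a b = box (fun i => s * a i) (fun i => s * b i).
Proof.
move=> s0; apply/seteqP; split=> [_ [x hx <-] i|x hx].
  by rewrite coordVZ ler_pM2l// ltr_pM2l.
exists (s^-1 *: x); last by rewrite scalerA divff ?gt_eqF// scale1r.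
by move=> i; rewrite coordVZ ler_pdivlMl// ltr_pdivrMl.
Qed.

Definition cbox a b := [set x | forall i, a i <= coordV x i <= b i].

Lemma box_cbox a b : box a b `<=` cbox a b.
Proof. by move=> x hx i; have /andP[-> /ltW] := hx i. Qed.

Lemma cbox_compact a b : compact (cbox a b).
Proof.
have := @cV_cube_compact _ _ a b.
move=> /(@continuous_compact _ _ (mulmx V)); rewrite (_ : _ @` _ = cbox a b).
  by apply; apply: continuous_subspaceT; exact: mulmx_continuous.
apply/seteqP; split=> [_ [x hx <-] i|x hx]; first by rewrite coordV_mul; exact: hx.
exists (invmx V *m x); last by rewrite mulKVmx.
by move=> i; exact: hx.
Qed.

Lemma closed_cbox a b : closed (cbox a b).
Proof. by apply: compact_closed; [exact: norm_hausdorff|exact: cbox_compact]. Qed.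

Lemma measurable_cbox a b : measurable (cbox a b).
Proof.
rewrite -(setCK (cbox a b)); apply: measurableC; apply: open_measurable_mx.
by apply: closed_openC; exact: closed_cbox.
Qed.

Lemma lf_measure_box (nu : lf_measure R d) a b : (nu (box a b) < +oo)%E.
Proof.
apply: (@le_lt_trans _ _ (nu (cbox a b))).
  apply: le_measure; [by apply: mem_set; exact: measurable_boxV|by apply: mem_set; exact: measurable_cbox|].
  exact: box_cbox.
by apply: lf_measure_compact; [exact: cbox_compact|exact: measurable_cbox].
Qed.

End boxes.

Lemma cvg_maxr (R : realType) (T : Type) (F : set_system T) (f g : T -> R) (a b : R) :
  Filter F -> f x @[x --> F] --> a -> g x @[x --> F] --> b ->
  Num.max (f x) (g x) @[x --> F] --> Num.max a b.
Proof.
move=> FF fa gb; under eq_cvg do rewrite maxr_absE.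
rewrite maxr_absE; apply: cvgM; last exact: cvg_cst.
by apply: cvgD; [exact: cvgD|apply: cvg_norm; exact: cvgB].
Qed.

Lemma cvg_minr (R : realType) (T : Type) (F : set_system T) (f g : T -> R) (a b : R) :
  Filter F -> f x @[x --> F] --> a -> g x @[x --> F] --> b ->
  Num.min (f x) (g x) @[x --> F] --> Num.min a b.
Proof.
move=> FF fa gb; under eq_cvg do rewrite minr_absE.
rewrite minr_absE; apply: cvgM; last exact: cvg_cst.
by apply: cvgB; [exact: cvgD|apply: cvg_norm; exact: cvgB].
Qed.

(** * Measurability of the mass of the cell *)

Section measurability_of_masses.
Context {R : realType} {d : nat}.
Variable V : 'M[R]_d.
Hypothesis hV : V \in unitmx.

(** For n > 0 a trapezoid that rises on [-1/n, 0] and falls on [1 - 1/n, 1]. The ramps are placed so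
    that the pointwise limit is the indicator of the half-open interval [0, 1), endpoints
    included. *)
Let trap (n : nat) (s : R) : R :=
  Num.max 0 (Num.min 1 (Num.min (1 + n%:R * s) (n%:R * (1 - s)))).

Let trap_continuous n : continuous (trap n).
Proof.
move=> s; apply: cvg_maxr; first exact: cvg_cst.
apply: cvg_minr; first exact: cvg_cst.
apply: cvg_minr.
  by apply: cvgD; [exact: cvg_cst|apply: cvgM; [exact: cvg_cst|exact: cvg_id]].
apply: cvgM; first exact: cvg_cst.
by apply: cvgB; [exact: cvg_cst|exact: cvg_id].
Qed.

Let trap01 n s : 0 <= trap n s <= 1.
Proof. by rewrite /trap le_max lexx/= ge_max ler01/= ge_min lexx. Qed.

Let trap_supp n s : trap n s != 0 -> -1 <= s <= 1.
Proof.
apply: contraR; rewrite negb_and -!ltNge => h; apply/eqP.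
rewrite /trap; apply/max_idPl; rewrite !ge_min.
have n0 : 0 <= n%:R :> R by [].
case: n n0 => [|n] n0; first by rewrite !mul0r lexx !orbT.
have n1 : 1 <= n.+1%:R :> R by rewrite ler1n.
by case/orP: h => h; apply/orP; right; apply/orP; [left|right]; nra.
Qed.

Let trap_cvg s : trap n s @[n --> \oo] --> (if 0 <= s < 1 then 1 else 0 : R).
Proof.
case: ifPn => [/andP[s0 s1]|].
  have [N hN] := ex_nat_ge (1 - s)^-1.
  have h n : (N <= n)%N -> trap n s = 1.
    move=> Nn; have := hN n Nn; rewrite invf_ple ?posrE ?subr_gt0//; last first.
      by rewrite (lt_le_trans _ (hN n Nn))// invr_gt0 subr_gt0.
    move=> h; have n0 : 0 < n%:R :> R.
      by rewrite (lt_le_trans _ (hN n Nn))// invr_gt0 subr_gt0.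
    have h' : 1 <= n%:R * (1 - s).
      by rewrite mulrC -ler_pdivrMr// div1r.
    rewrite /trap (min_idPl _) ?le_min ?h' ?lerDl ?mulr_ge0//.
    by apply/max_idPr.
  apply/cvgrPdist_le => e e0; exists N => // n /= Nn.
  by rewrite h// subrr normr0 ltW.
rewrite negb_and -ltNge -leNgt => /orP[s0|s1].
  have [N hN] := ex_nat_ge (- s)^-1.
  apply/cvgrPdist_le => e e0; exists N => // n /= Nn.
  have n0 : 0 < n%:R :> R.
    by rewrite (lt_le_trans _ (hN n Nn))// invr_gt0 oppr_gt0.
  have h : 1 + n%:R * s <= 0.
    have := hN n Nn; rewrite -[leLHS]mul1r ler_pdivrMr ?oppr_gt0//; lra.
  have -> : trap n s = 0 by rewrite /trap; apply/max_idPl; rewrite !ge_min h/= orbT.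
  by rewrite subr0 normr0 ltW.
apply/cvgrPdist_le => e e0; exists 0%N => // n _ /=.
have -> : trap n s = 0.
  by rewrite /trap; apply/max_idPl; rewrite !ge_min mulr_ge0_le0 ?orbT// subr_le0.
by rewrite subr0 normr0 ltW.
Qed.

Let g (n : nat) (x : 'cV[R]_d) : R := \prod_(i < d) trap n (coordV V x i).

Let g_continuous n : continuous (g n).
Proof.
apply: continuous_prodr => i x.
apply: (@continuous_comp _ _ _ (fun x => coordV V x i) (trap n)).
  exact: coordV_continuous.
exact: trap_continuous.
Qed.

Let K : set 'cV[R]_d := cbox V (fun=> -1) (fun=> 1).

Let g_supp n x : g n x != 0 -> K x.
Proof.
move=> gx i; apply: (@trap_supp n); apply: contra gx => /eqP h.
by rewrite /g (bigD1 i)//= h mul0r.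
Qed.

Let g_Cc n : Cc (g n).
Proof.
split; first exact: g_continuous.
apply: (@subclosed_compact _ _ K); [exact: closed_closure|exact: cbox_compact|].
rewrite -/K (closure_id K).1; last exact: closed_cbox.
by apply: closureS => x; exact: g_supp.
Qed.

Let g01 n x : 0 <= g n x <= 1.
Proof.
apply/andP; split; first by apply: prodr_ge0 => i _; have /andP[] := trap01 n (coordV V x i).
by apply: prodr_ile1 => i _; exact: trap01.
Qed.

Let g_cvg x : g n x @[n --> \oo] --> (\1_(cell V) x : R).
Proof.
have -> : \1_(cell V) x = \prod_(i < d) (if 0 <= coordV V x i < 1 then 1 else 0) :> R.
  rewrite indicE; have [xc|xc] := boolP (x \in cell V).
    by rewrite big1// => i _; have := set_mem xc; rewrite cell_box// => /(_ i) h; rewrite h.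
  have [i hi] : exists i, ~~ (0 <= coordV V x i < 1).
    apply: contrapT => h; move/negP: xc; apply; apply: mem_set; rewrite cell_box// => i.
    by apply/negPn/negP => hi; apply: h; exists i.
  by rewrite (bigD1 i)//= (negbTE hi) mul0r.
by apply: cvg_prodr => i; exact: trap_cvg.
Qed.

Lemma measurable_cell : measurable (cell V).
Proof. by rewrite cell_box//; exact: measurable_boxV. Qed.

Lemma cvg_integral_cell (nu : lf_measure R d) :
  (\int[nu]_x g n x)%R @[n --> \oo] --> fine (nu (cell V)).
Proof.
have mK : measurable K by exact: measurable_cbox.
have mg n : measurable_fun setT (EFin \o g n).
  by apply/measurable_EFinP; apply: continuous_measurable_mx.
have mI : measurable_fun setT (fun x : 'cV[R]_d => (\1_(cell V) x : R)%:E).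
  by apply/measurable_EFinP; apply: measurable_indic; exact: measurable_cell.
have cae : \forall x \ae nu, setT x -> (EFin \o g n) x @[n --> \oo] -->
    (\1_(cell V) x : R)%:E.
  by apply: aeW => x _; apply: cvg_EFin; [exact: nearW|exact: g_cvg].
have iK : nu.-integrable setT (fun x => (\1_K x : R)%:E).
  apply/integrableP; split.
    by apply/measurable_EFinP; apply: measurable_indic; exact: mK.
  under eq_integral do rewrite gee0_abs ?lee_fin ?indicE//.
  by rewrite integral_indic// setIT; apply: lf_measure_compact => //; exact: cbox_compact.
have dom : \forall x \ae nu, forall n, setT x -> (`|(EFin \o g n) x| <= (\1_K x : R)%:E)%E.
  apply: aeW => x n _; rewrite /= lee_fin ger0_norm; last by have /andP[] := g01 n x.
  rewrite indicE; have [_|] := boolP (x \in K); first by have /andP[] := g01 n x.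
  rewrite notin_setE => nK; have [->//|/g_supp //] := eqVneq (g n x) 0.
have [_ _] := dominated_convergence measurableT mg mI cae iK dom.
rewrite integral_indic ?setIT//; last exact: measurable_cell.
rewrite -[X in _ --> X -> _]fineK; last first.
  rewrite ge0_fin_numE// cell_box//; exact: lf_measure_box.
exact: fine_cvg.
Qed.

Lemma open_mass (f : 'cV[R]_d -> R) (U : set R) : Cc f -> open U ->
  open [set nu : lf_measure R d | U (\int[nu]_x f x)].
Proof.
move=> cf oU; exists [set [set nu : lf_measure R d | U (\int[nu]_x f x)]].
  move=> _ ->.
  exact: (@finI_from1 _ _ [set fU : ('cV[R]_d -> R) * set R | Cc fU.1 /\ open fU.2]
    (fun fU => [set nu : lf_measure R d | fU.2 (\int[nu]_x fU.1 x)]) (f, U)).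
by rewrite bigcup_set1.
Qed.

(** The vague topology directly controls only integrals of functions in [Cc]. The mass of the cell
    is a pointwise limit of such integrals, by dominated convergence with the indicator of a compact
    set as a bound. *)
Lemma measurable_mass_cell {dO : measure_display} {Omega : measurableType dO}
    (mu : Omega -> lf_measure R d) : random_measure mu ->
  measurable_fun setT (fun w => fine (mu w (cell V))).
Proof.
move=> hmu; apply: (measurable_fun_cvg (h := fun n w => \int[mu w]_x g n x)).
  move=> n; apply: (measurability _ (RGenOpens.measurableE R)).
  move=> _ [_ [a [b ->]] <-]; rewrite setTI.
  rewrite (_ : _ @^-1` _ =
    mu @^-1` [set nu : lf_measure R d | `]a, b[%classic (\int[nu]_x g n x)])//.
  rewrite -[X in measurable X]setTI; apply: (hmu measurableT).
  apply: sub_sigma_algebra; apply: open_mass => //.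
by move=> w _; exact: cvg_integral_cell.
Qed.

End measurability_of_masses.

Lemma integral_cst_probability {R : realType} {d : measure_display}
    {T : measurableType d} (P : probability T R) (c : R) :
  (\int[P]_w c%:E = c%:E)%E.
Proof.
rewrite (integral_cst P measurableT c%:E) -[RHS]mule1; congr (_ * _)%E.
exact: probability_setT.
Qed.

(** * Comparison of the almost sure behaviour of averages with their common mean *)

Section eventual_bounds.
Context {R : realType} {d : measure_display} {T : measurableType d}.
Variables (P : probability T R) (X : nat -> T -> R) (kappa L : R).
Hypotheses (gX : ae_cvg_dominated P X) (X0 : forall n w, 0 <= X n w).

(** If almost surely the bound fails infinitely often, the almost sure limit is at least L. Then
    min(X n, L) tends to L boundedly, and comparison of means gives L <= kappa. *)
Lemma eventually_le_nonnull :
  (forall n, (0 < n)%N -> (\int[P]_w (X n w)%:E = kappa%:E)%E) -> kappa < L ->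
  ~ (\forall w \ae P, ~ exists N, forall n, (N <= n)%N -> X n w <= L).
Proof.
move=> EX kL hae; have [mX _ cX] := gX.
have k0 : 0 <= kappa.
  by rewrite -lee_fin -(EX 1%N)//; apply: integral_ge0 => w _; rewrite lee_fin.
have L0 : 0 < L by exact: le_lt_trans kL.
pose f n w := Num.min (X n w) L.
have mf n : measurable_fun setT (EFin \o f n).
  by apply/measurable_EFinP; apply: measurable_minr => //; exact: measurable_cst.
have f0 n w : 0 <= f n w by rewrite le_min X0 ltW.
have cae : \forall w \ae P, setT w -> (EFin \o f n) w @[n --> \oo] --> L%:E.
  apply: filterS2 hae cX => w nw /cvg_ex[/= l hl] _.
  apply: cvg_EFin; first exact: nearW.
  have lL : L <= l.
    rewrite leNgt; apply/negP => lL; apply: nw.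
    move/cvgrPdist_lt : hl => /(_ (L - l)); rewrite subr_gt0 => /(_ lL)[N _ hN].
    exists N => n Nn; have := hN n Nn; rewrite /= ltr_norml; lra.
  have -> : L = Num.min l L by apply/esym/min_idPr.
  rewrite /comp /=; apply: cvg_minr => //; exact: cvg_cst.
have iL : P.-integrable setT (fun=> L%:E).
  exact: finite_measure_integrable_cst.
have dom : \forall w \ae P, forall n, setT w -> (`|(EFin \o f n) w| <= L%:E)%E.
  apply: aeW => w n _; rewrite /= lee_fin ger0_norm//.
  by rewrite /f ge_min lexx orbT.
have [_ _] := dominated_convergence measurableT mf (measurable_cst L%:E) cae iL dom.
rewrite integral_cst_probability => hcv.
have : (L%:E <= kappa%:E)%E.
  apply: (cvge_to_le hcv); exists 1%N => // n /= n0.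
  rewrite -(EX n n0); apply: ge0_le_integral => //.
  - by move=> w _; rewrite lee_fin.
  - exact: (mf n).
  - exact/measurable_EFinP.
  - by move=> w _; rewrite lee_fin /f ge_min lexx.
by rewrite lee_fin leNgt kL.
Qed.

(** The mirror argument with max(X n, L), which is not bounded by a constant: here the integrable
    dominating function H is essential, as mass could otherwise escape. *)
Lemma eventually_ge_nonnull :
  (forall n, (0 < n)%N -> (\int[P]_w (X n w)%:E = kappa%:E)%E) -> L < kappa ->
  ~ (\forall w \ae P, ~ exists N, forall n, (N <= n)%N -> L <= X n w).
Proof.
move=> EX kL hae; have [mX [H lH XH] cX] := gX.
pose f n w := Num.max (X n w) L.
have mf n : measurable_fun setT (EFin \o f n).
  by apply/measurable_EFinP; apply: measurable_maxr => //; exact: measurable_cst.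
have f0 n w : 0 <= f n w by rewrite le_max X0.
have cae : \forall w \ae P, setT w -> (EFin \o f n) w @[n --> \oo] --> L%:E.
  apply: filterS2 hae cX => w nw /cvg_ex[/= l hl] _.
  apply: cvg_EFin; first exact: nearW.
  have lL : l <= L.
    rewrite leNgt; apply/negP => lL; apply: nw.
    move/cvgrPdist_lt : hl => /(_ (l - L)); rewrite subr_gt0 => /(_ lL)[N _ hN].
    exists N => n Nn; have := hN n Nn; rewrite /= ltr_norml; lra.
  have -> : L = Num.max l L by apply/esym/max_idPr.
  rewrite /comp /=; apply: cvg_maxr => //; exact: cvg_cst.
have [mH H0 _] := lH.
have iH : P.-integrable setT (fun w => (H w + `|L|)%:E).
  apply/integrableP; split.
    by apply/measurable_EFinP; apply: measurable_funD => //; exact: measurable_cst.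
  under eq_integral do rewrite gee0_abs ?lee_fin ?addr_ge0// EFinD.
  rewrite ge0_integralD//; first last.
  - exact/measurable_EFinP.
  - by move=> w _; rewrite lee_fin.
  apply: lte_add_pinfty; first exact: light_tail_fin.
  by rewrite integral_cst_probability ltry.
have dom : \forall w \ae P, forall n, setT w ->
    (`|(EFin \o f n) w| <= (H w + `|L|)%:E)%E.
  apply: filterS XH => w hw n _; rewrite /= lee_fin ger0_norm//.
  rewrite /f ge_max; apply/andP; split.
    by rewrite (le_trans (ler_norm _))// (le_trans (hw n))// lerDl.
  by rewrite (le_trans (ler_norm _))// lerDr.
have [_ _] := dominated_convergence measurableT mf (measurable_cst L%:E) cae iH dom.
rewrite integral_cst_probability => hcv.
have : (kappa%:E <= L%:E)%E.
  apply: (cvge_to_ge hcv); exists 1%N => // n /= n0.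
  rewrite -(EX n n0); apply: ge0_le_integral => //.
  - by move=> w _; rewrite lee_fin.
  - exact/measurable_EFinP.
  - exact: (mf n).
  - by move=> w _; rewrite lee_fin /f le_max lexx.
by rewrite lee_fin leNgt kL.
Qed.

End eventual_bounds.

Lemma measurable_forall_countable {dT : measure_display} {T : measurableType dT}
    (I : countType) (B : I -> set T) :
  (forall i, measurable (B i)) -> measurable [set w | forall i, B i w].
Proof.
move=> mB.
rewrite (_ : mkset _ = \bigcap_n (if unpickle n is Some i then B i else setT)).
  by apply: bigcap_measurableType => n _; case: unpickle.
apply/seteqP; split=> w h => [n _|i]; first by case: unpickle.
by have := h (pickle i) Logic.I; rewrite pickleK.
Qed.

Section ergodic_sets.
Context {R : realType} {d : nat} {dO : measure_display} {Omega : measurableType dO}.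
Variables (P : probability Omega R) (G : set 'cV[R]_d)
  (theta : 'cV[R]_d -> Omega -> Omega).
Hypotheses (hG : G = [set: 'cV[R]_d] \/ G = int_vectors)
  (htheta : measurable_action G theta).

Lemma int_vectorsN (g : 'cV[R]_d) : int_vectors g -> int_vectors (- g).
Proof. by move=> hg i; rewrite mxE rpredN. Qed.

Lemma group_opp g : G g -> G (- g).
Proof. by case: hG => -> //; exact: int_vectorsN. Qed.

Lemma group_int g : int_vectors g -> G g.
Proof. by case: hG => ->. Qed.

Lemma measurable_int_vectors : measurable (@int_vectors R d).
Proof.
apply: (@measurable_forall_ord d _ _ (fun i => [set g : 'cV[R]_d | g i 0 \is a Num.int])) => i.
rewrite (_ : mkset _ = \bigcup_(z in [set: int]) [set g : 'cV[R]_d | g i 0 = z%:~R]).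
  apply: countable_bigcupT_measurable => // z.
  have := @measurable_coord R d 1 i 0 measurableT [set z%:~R] (measurable_set1 _).
  by rewrite setTI; congr measurable; apply/seteqP; split.
apply/seteqP; split=> g /=; first by move=> /intrP[z gz]; exists z.
by move=> [z _ /= ->]; exact: intr_int.
Qed.

Lemma measurable_theta g : G g -> measurable_fun setT (theta g).
Proof.
move=> Gg; have [_ _ mt] := htheta.
have mG : measurable G.
  by case: hG => ->; [exact: measurableT|exact: measurable_int_vectors].
have -> : theta g = (fun p : 'cV[R]_d * Omega => theta p.1 p.2) \o (fun w => (g, w)) by [].
apply: (measurable_comp (F := G `*` setT)) => //.
- exact: measurableX.
- by move=> _ [w _ <-].
- by apply: measurable_fun_pair => //; exact: measurable_cst.
Qed.

Lemma thetaK g w : G g -> theta g (theta (- g) w) = w.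
Proof.
move=> Gg; have [t0 tD _] := htheta.
have := tD g (- g) Gg (group_opp Gg); rewrite subrr => /(congr1 (@^~ w)) /= ->.
exact: t0.
Qed.

(** Stability under g puts the image inside B; stability under -g gives the converse. *)
Lemma stable_invariant B : (forall g w, G g -> B w -> B (theta g w)) ->
  invariant_set G theta B.
Proof.
move=> hB g Gg; apply/seteqP; split=> [_ [w Bw <-]|w Bw]; first exact: hB.
by exists (theta (- g) w); [apply: hB => //; exact: group_opp|exact: thetaK].
Qed.

Lemma ergodic_stable_ae (B : set Omega) : ergodic G theta P -> measurable B ->
  (forall g w, G g -> B w -> B (theta g w)) ->
  ~ (\forall w \ae P, ~ B w) -> \forall w \ae P, B w.
Proof.
move=> erg mB sB nB; case: (erg B mB (stable_invariant sB)) => PB.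
  exfalso; apply: nB; exists B; split => //.
  by move=> w /= /contrapT.
exists (~` B); split => //; first exact: measurableC.
by rewrite probability_setC// PB subee.
Qed.

End ergodic_sets.

Section box_masses.
Context {R : realType} {d : nat}.
Variable V : 'M[R]_d.
Hypothesis hV : V \in unitmx.
Implicit Types (nu : lf_measure R d) (a b : 'I_d -> R) (s : R).

Definition mass nu a b : R := fine (nu (box V a b)).

Lemma massE nu a b : nu (box V a b) = (mass nu a b)%:E.
Proof. by rewrite /mass fineK// ge0_fin_numE// lf_measure_box. Qed.

Lemma mass_ge0 nu a b : 0 <= mass nu a b.
Proof. exact: fine_ge0. Qed.

Lemma mass_le nu a b a' b' : (forall i, a' i <= a i) -> (forall i, b i <= b' i) ->
  mass nu a b <= mass nu a' b'.
Proof.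
move=> aa bb; rewrite -lee_fin -!massE; apply: le_measure.
- by apply: mem_set; exact: measurable_boxV.
- by apply: mem_set; exact: measurable_boxV.
- exact: box_sub.
Qed.

Lemma mass_split nu a b j (c : R) : a j <= c -> c <= b j ->
  mass nu a b = mass nu a (upd b j c) + mass nu (upd a j c) b.
Proof.
move=> ac cb; apply: EFin_inj; rewrite EFinD -!massE (box_split V ac cb).
rewrite measureU//; try exact: measurable_boxV.
exact: box_split_disj.
Qed.

Lemma mass_eq0 nu a b i : b i <= a i -> mass nu a b = 0.
Proof.
move=> ba; rewrite /mass (_ : box V a b = set0) ?measure0//.
apply/seteqP; split=> // x /(_ i) /andP[h1 h2].
by have := le_lt_trans (le_trans ba h1) h2; rewrite ltxx.
Qed.

(** After division by q + 2 this is the corner a moved by e / (q + 2). The factor is at least 2 in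
    order that a box with integral a < b, shrunk by one unit at both ends, keeps sides of
    nonnegative length. *)
Definition real_corner (q : nat) (e : int) (a : 'I_d -> int) : 'I_d -> int :=
  fun i => q.+2%:Z * a i + e.

Definition avg nu (a b : 'I_d -> int) s : R :=
  s ^- d * mass nu (fun i => s * (a i)%:~R) (fun i => s * (b i)%:~R).

(* The box [a, b) is approximated at scale 1/(q+2) from outside by
   [(q+2)a - 1, (q+2)b + 1) and from inside by [(q+2)a + 1, (q+2)b - 1). The
   room left makes both conditions insensitive to translations. *)
Definition upper (a b : 'I_d -> int) (lam : R) nu :=
  exists q N, forall n, (N <= n)%N ->
    avg nu (real_corner q (-1) a) (real_corner q 1 b) n%:R <= lam * q.+2%:R ^+ d.

Definition lower (a b : 'I_d -> int) (lam : R) nu :=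
  exists q N, forall n, (N <= n)%N ->
    lam * q.+2%:R ^+ d <= avg nu (real_corner q 1 a) (real_corner q (-1) b) n%:R.

Lemma bound_coord (g : 'I_d -> R) :
  exists K : nat, forall n i, (K <= n)%N -> `|g i| <= n%:R.
Proof.
have [K hK] := ex_nat_ge (\sum_i `|g i|).
exists K => n i Kn; apply: le_trans (hK n Kn).
by rewrite (bigD1 i)//= lerDl sumr_ge0.
Qed.

Lemma avg_double nu (a b : 'I_d -> int) n : 2%:R ^+ d * avg nu a b (2 * n)%:R =
  n%:R ^- d * mass nu (fun i => (2 * n)%:R * (a i)%:~R) (fun i => (2 * n)%:R * (b i)%:~R).
Proof.
rewrite /avg mulrA; congr (_ * _).
by rewrite natrM exprMn invfM mulrA divff ?mul1r// expf_neq0.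
Qed.

Section translate.
Variables (nu nu' : lf_measure R d) (g : 'I_d -> R).
Hypothesis nu_g : forall a b,
  mass nu' a b = mass nu (fun i => a i + g i) (fun i => b i + g i).

(** Refinement 2(q + 2) has half the margin of refinement q + 2. Its box at scale n therefore lies
    inside the old box at scale 2n with room n on every side, enough for a shift by g as soon as n
    exceeds all |g i|. The factors 2^d of both sides agree. *)
Lemma upper_translate (a b : 'I_d -> int) lam : upper a b lam nu -> upper a b lam nu'.
Proof.
move=> [q [N hN]]; have [K hK] := bound_coord g.
exists (2 * q).+2, (maxn N K) => n; rewrite geq_max => /andP[Nn Kn].
have qE : (2 * q).+4 = (2 * q.+2)%N by rewrite !mulnS.
have := hN (2 * n)%N (leq_trans Nn (leq_pmull _ _)) => h.
have {}h : 2%:R ^+ d * avg nu (real_corner q (-1) a) (real_corner q 1 b) (2 * n)%:R <=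
    lam * (2 * q.+2)%:R ^+ d.
  rewrite [(2 * q.+2)%:R]natrM exprMn [leRHS]mulrCA; apply: ler_wpM2l; first exact: exprn_ge0.
  exact: h.
rewrite qE; apply: le_trans h; rewrite avg_double /avg nu_g.
apply: ler_wpM2l; first by rewrite invr_ge0 exprn_ge0.
apply: mass_le => i; have := hK n i Kn; rewrite ler_norml => /andP[g1 g2];
  rewrite /real_corner qE !intrD !intrM -!pmulrn !natrM ?mulrN1z -?[(-1)%:~R]/(-1) ?[1%:~R]/1; nra.
Qed.

Lemma lower_translate (a b : 'I_d -> int) lam : lower a b lam nu -> lower a b lam nu'.
Proof.
move=> [q [N hN]]; have [K hK] := bound_coord g.
exists (2 * q).+2, (maxn N K) => n; rewrite geq_max => /andP[Nn Kn].
have qE : (2 * q).+4 = (2 * q.+2)%N by rewrite !mulnS.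
have := hN (2 * n)%N (leq_trans Nn (leq_pmull _ _)) => h.
have {}h : lam * (2 * q.+2)%:R ^+ d <=
    2%:R ^+ d * avg nu (real_corner q 1 a) (real_corner q (-1) b) (2 * n)%:R.
  rewrite [(2 * q.+2)%:R]natrM exprMn [leLHS]mulrCA; apply: ler_wpM2l; first exact: exprn_ge0.
  exact: h.
rewrite qE; apply: (le_trans h); rewrite avg_double /avg nu_g.
apply: ler_wpM2l; first by rewrite invr_ge0 exprn_ge0.
apply: mass_le => i; have := hK n i Kn; rewrite ler_norml => /andP[g1 g2];
  rewrite /real_corner qE !intrD !intrM -!pmulrn !natrM ?mulrN1z -?[(-1)%:~R]/(-1) ?[1%:~R]/1; nra.
Qed.

End translate.

Section scaling_limit.
Variables (nu : lf_measure R d) (a b : 'I_d -> int).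

Let floor_scale q N s : (q.+2%:R * (N%:R + 1) <= s) ->
  exists n, [/\ (N <= n)%N, q.+2%:R * n%:R <= s & s <= q.+2%:R * (n.+1)%:R].
Proof.
move=> hs; exists (Num.truncn (s / q.+2%:R)).
have s0 : 0 <= s / q.+2%:R.
  by rewrite divr_ge0// (le_trans _ hs)// mulr_ge0// addr_ge0.
have := truncn_itv s0 => /andP[h1 h2].
split.
- rewrite -ltnS -(ltr_nat R); apply: le_lt_trans h2.
  by rewrite ler_pdivlMr// mulrC (le_trans _ hs)// ler_wpM2l// lerDl.
- by move: h1; rewrite ler_pdivlMr// mulrC.
- by move: h2; rewrite ltr_pdivrMr// mulrC => /ltW.
Qed.

(** Rounding the real scale to a multiple of Q = q + 2 moves a corner x by at most Q |x|, which for
    large m is less than the margin m reserved by [real_corner]. *)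
Let scale_err (Q m s' x : R) : 0 <= Q -> `|s' - Q * m| <= Q -> `|Q * x| <= m ->
  - m <= s' * x - m * (Q * x) <= m.
Proof.
move=> Q0 h hx; rewrite -ler_norml.
have -> : s' * x - m * (Q * x) = (s' - Q * m) * x by ring.
rewrite normrM; apply: le_trans hx; rewrite normrM (ger0_norm Q0).
by rewrite ler_wpM2r.
Qed.

(** The scale is rounded down to (q + 2) n <= s: the enlarged box still contains s[a, b), and its
    bound, proportional to ((q + 2) n)^d, is at most the one for s^d. *)
Lemma upper_scaling lam : 0 <= lam -> upper a b lam nu ->
  exists s0, forall s, s0 < s -> avg nu a b s <= lam.
Proof.
move=> lam0 [q [N hN]].
have [K hK] := bound_coord (fun i => q.+2%:R * (a i)%:~R).
have [K' hK'] := bound_coord (fun i => q.+2%:R * (b i)%:~R).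
exists (q.+2%:R * ((maxn N (maxn K K'))%:R + 1)) => s /ltW /floor_scale[n []].
rewrite !geq_max => /and3P[Nn Kn K'n] ns sn.
have s0 : 0 <= s by rewrite (le_trans _ ns)// mulr_ge0.
rewrite /avg; have [sd|sd] := eqVneq (s ^+ d) 0.
  by rewrite sd invr0 mul0r.
have sd0 : 0 < s ^+ d by rewrite lt0r sd exprn_ge0.
rewrite ler_pdivrMl// mulrC.
have err : `|s - q.+2%:R * n%:R| <= q.+2%:R.
  by rewrite ler_norml; move: ns sn; rewrite -[n.+1%:R]natr1 mulrDr mulr1; lra.
apply: (@le_trans _ _ (mass nu (fun i => n%:R * (real_corner q (-1) a i)%:~R)
   (fun i => n%:R * (real_corner q 1 b i)%:~R))).
  apply: mass_le => i; rewrite /real_corner !intrD !intrM -!pmulrn ?mulrN1z.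
    by have := scale_err (ler0n _ _) err (hK n i Kn); rewrite mulrDr mulrN1; lra.
  by have := scale_err (ler0n _ _) err (hK' n i K'n); rewrite mulrDr mulr1; lra.
(* This happens only for n = 0 and d > 0, when both corners of the comparison box are 0 and the box
   is empty. *)
have [nd|nd] := eqVneq (n%:R ^+ d : R) 0.
  have [n0 d0] : n = 0%N /\ (0 < d)%N.
    by move/eqP : nd; rewrite expf_eq0 pnatr_eq0 => /andP[-> /eqP].
  rewrite (@mass_eq0 _ _ _ (Ordinal d0)) ?n0 ?mul0r//.
  by rewrite mulr_ge0// ltW.
have nd0 : 0 < n%:R ^+ d :> R by rewrite lt0r nd exprn_ge0.
have := hN n Nn; rewrite /avg ler_pdivrMl// => /le_trans; apply.
rewrite mulrCA ler_wpM2l// -exprMn lerXn2r ?nnegrE ?mulr_ge0//.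
by rewrite mulrC.
Qed.

(** Here the scale is rounded up to (q + 2)(n + 1) >= s, so that the lower bound improves; for lam
    <= 0 the claim is trivial. *)
Lemma lower_scaling lam : lower a b lam nu ->
  exists s0, forall s, s0 < s -> lam <= avg nu a b s.
Proof.
move=> [q [N hN]].
have [K hK] := bound_coord (fun i => q.+2%:R * (a i)%:~R).
have [K' hK'] := bound_coord (fun i => q.+2%:R * (b i)%:~R).
exists (q.+2%:R * ((maxn N (maxn K K'))%:R + 1)) => s s_gt.
have [n []] := floor_scale (ltW s_gt).
rewrite !geq_max => /and3P[Nn Kn K'n] ns sn.
have s0 : 0 < s by rewrite (le_lt_trans _ s_gt)// mulr_ge0// addr_ge0.
rewrite /avg; have sd0 : 0 < s ^+ d by rewrite exprn_gt0.
have [lam0|lam0] := leP lam 0.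
  by rewrite (le_trans lam0)// mulr_ge0 ?mass_ge0// invr_ge0 ltW.
rewrite ler_pdivlMl// mulrC.
have err : `|s - q.+2%:R * n.+1%:R| <= q.+2%:R.
  by rewrite ler_norml; move: ns sn; rewrite -[n.+1%:R]natr1 mulrDr mulr1; lra.
apply: (@le_trans _ _ (mass nu (fun i => n.+1%:R * (real_corner q 1 a i)%:~R)
   (fun i => n.+1%:R * (real_corner q (-1) b i)%:~R))); last first.
  apply: mass_le => i; rewrite /real_corner !intrD !intrM -!pmulrn ?mulrN1z.
    have := scale_err (ler0n _ _) err (hK n.+1 i (leqW Kn)).
    by rewrite mulrDr mulr1; lra.
  have := scale_err (ler0n _ _) err (hK' n.+1 i (leqW K'n)).
  by rewrite mulrDr mulrN1; lra.
have nd0 : 0 < n.+1%:R ^+ d :> R by rewrite exprn_gt0.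
have := hN n.+1 (leqW Nn); rewrite /avg ler_pdivlMl// => /(le_trans _); apply.
rewrite mulrCA ler_wpM2l ?(ltW lam0)// -exprMn lerXn2r ?nnegrE ?mulr_ge0 ?(ltW s0)//.
by rewrite mulrC.
Qed.

End scaling_limit.
End box_masses.

(** * Convergence of the averages over all integral boxes, on one invariant set *)

Section spatial_ergodic_theorem.
Context {R : realType} {d : nat} {dO : measure_display} {Omega : measurableType dO}.
Variables (P : probability Omega R) (G : set 'cV[R]_d)
  (theta : 'cV[R]_d -> Omega -> Omega) (V : 'M[R]_d) (mu : Omega -> lf_measure R d).
Hypotheses (hG : G = [set: 'cV[R]_d] \/ G = int_vectors)
  (htheta : measurable_action G theta)
  (hV : V \in unitmx)
  (hstat : stationary G theta P)
  (herg : ergodic G theta P)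
  (hmu : random_measure mu)
  (hequiv : equivariant G theta V mu)
  (hmom : exists2 alpha : R, 1 < alpha &
     (\int[P]_w (mu w (cell V) `^ alpha) < +oo)%E).

Let M w a b := mass V (mu w) a b.

Let M_shift g w a b : G g ->
  M (theta g w) a b = M w (fun i => a i + g i 0) (fun i => b i + g i 0).
Proof.
move=> Gg; rewrite /M /mass (hequiv w Gg (measurable_boxV V a b)).
by rewrite /translate tau_box.
Qed.

Let f_light : light_tail P (fun w => M w (fun=> 0) (fun=> 1)).
Proof.
have [alpha a1 Ioo] := hmom.
apply: (light_tail_moment a1).
- by have := measurable_mass_cell hV hmu; rewrite (cell_box hV).
- by move=> w; exact: mass_ge0.
- apply: le_lt_trans Ioo; rewrite le_eqVlt; apply/orP; left; apply/eqP.
  by apply: eq_integral => w _; rewrite (cell_box hV) (massE hV) poweR_EFin.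
Qed.

Definition mean_mass : R := fine (\int[P]_w mu w (cell V)).

Lemma mean_massE : (\int[P]_w mu w (cell V) = mean_mass%:E)%E.
Proof.
rewrite /mean_mass fineK// ge0_fin_numE; last exact: integral_ge0.
apply: le_lt_trans (light_tail_fin f_light).
rewrite le_eqVlt; apply/orP; left; apply/eqP.
by apply: eq_integral => w _; rewrite (cell_box hV) (massE hV).
Qed.

Lemma mean_mass_ge0 : 0 <= mean_mass.
Proof. by apply: fine_ge0; exact: integral_ge0. Qed.

Let e (s : R) (j : 'I_d) : 'cV[R]_d := \col_i (if i == j then s else 0).

Let int_e s j : s \is a Num.int -> G (e s j).
Proof.
move=> hs; apply: (group_int hG) => i; rewrite mxE.
by case: ifP => // _; exact: int_num0.
Qed.

Let G1 j : G (e 1 j). Proof. by apply: int_e; exact: int_num1. Qed.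
Let GN1 j : G (e (-1) j). Proof. by apply: int_e; rewrite rpredN int_num1. Qed.

Let mp g : G g -> forall A, measurable A -> P (theta g @^-1` A) = P A.
Proof. by move=> Gg A mA; exact: hstat. Qed.

Let M_unit_shift s w a b j : G (e s j) ->
  M (theta (e s j) w) a b = M w (upd a j (a j + s)) (upd b j (b j + s)).
Proof.
move=> Gs; rewrite M_shift//; congr (M w _ _); apply/funext => i;
  by rewrite /upd mxE; case: eqP => [->//|_]; rewrite addr0.
Qed.

Let average (a b : 'I_d -> int) (ab : forall i, a i <= b i) :
  ae_cvg_dominated P (fun n w => avg V (mu w) a b n%:R) /\
  forall n, (0 < n)%N -> (\int[P]_w (avg V (mu w) a b n%:R)%:E =
    ((\prod_i (b i - a i)%:~R) * mean_mass)%:E)%E.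
Proof.
have := @box_average R d _ _ P M (fun j => theta (e 1 j)) (fun j => theta (e (-1) j))
  (fun w a b => mass_ge0 V (mu w) a b) (fun w a b j c => mass_split hV (mu w) (a := a) (b := b) (j := j) (c := c))
  (fun w a b j => M_unit_shift w a b (G1 j)) (fun w a b j => M_unit_shift w a b (GN1 j))
  (fun j => measurable_theta hG htheta (G1 j))
  (fun j => measurable_theta hG htheta (GN1 j))
  (fun j => mp (G1 j)) (fun j => mp (GN1 j)) a b ab f_light.
move=> [h1 h2]; split=> // n n0; rewrite EFinM (h2 n n0).
congr (_ * _)%E; rewrite -mean_massE; apply: eq_integral => w _.
by rewrite (cell_box hV) (massE hV).
Qed.

Let measurable_avg (a b : 'I_d -> int) n :
  measurable_fun setT (fun w => avg V (mu w) a b n%:R).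
Proof.
have [ab|] := boolP [forall i, a i <= b i].
  by have [[m _ _] _] := average (fun i => forallP ab i); exact: m.
(* The shrunk box of [lower] may have reversed corners when a < b fails; it is then empty. *)
move=> /forallPn[i]; rewrite -ltNge => ba.
rewrite (_ : (fun _ => _) = cst 0); first exact: measurable_cst.
apply/funext => w; rewrite /avg (@mass_eq0 _ _ _ _ _ _ i) ?mulr0//.
by rewrite ler_wpM2l// ler_int ltW.
Qed.

Let mupper a b lam : measurable [set w | upper V a b lam (mu w)].
Proof.
rewrite (_ : mkset _ = \bigcup_q \bigcup_N \bigcap_(n in [set n | (N <= n)%N])
  [set w | avg V (mu w) (real_corner q (-1) a) (real_corner q 1 b) n%:R <= lam * q.+2%:R ^+ d]); last first.
  by apply/seteqP; split=> w; [move=> [q [N h]]; exists q => //; exists N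
    |move=> [q _ [N _ h]]; exists q, N].
apply: bigcup_measurable => q _; apply: bigcup_measurable => N _.
by apply: bigcap_measurable => [|n _]; [exists N => /=|exact: measurable_set_le].
Qed.

Let mlower a b lam : measurable [set w | lower V a b lam (mu w)].
Proof.
rewrite (_ : mkset _ = \bigcup_q \bigcup_N \bigcap_(n in [set n | (N <= n)%N])
  [set w | lam * q.+2%:R ^+ d <= avg V (mu w) (real_corner q 1 a) (real_corner q (-1) b) n%:R]); last first.
  by apply/seteqP; split=> w; [move=> [q [N h]]; exists q => //; exists N
    |move=> [q _ [N _ h]]; exists q, N].
apply: bigcup_measurable => q _; apply: bigcup_measurable => N _.
by apply: bigcap_measurable => [|n _]; [exists N => /=|exact: measurable_set_ge].
Qed.

Let vol (a b : 'I_d -> int) : R := (\prod_i (b i - a i)%:~R) * mean_mass.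

Let vol_corner (a b : 'I_d -> int) (z1 z2 : int) :
  vol (real_corner q z1 a) (real_corner q z2 b) / q.+2%:R ^+ d @[q --> \oo] --> vol a b.
Proof.
have h q : vol (real_corner q z1 a) (real_corner q z2 b) / q.+2%:R ^+ d =
    (\prod_(i < d) ((b i - a i)%:~R + (z2 - z1)%:~R / q.+2%:R)) * mean_mass.
  have -> : q.+2%:R ^+ d = \prod_(i < d) q.+2%:R :> R.
    by rewrite prodr_const card_ord.
  rewrite /vol mulrAC -prodf_div; congr (_ * _); apply: eq_bigr => i _.
  have -> : real_corner q z2 b i - real_corner q z1 a i =
      q.+2%:Z * (b i - a i) + (z2 - z1) by rewrite /real_corner; ring.
  rewrite (intrD R (q.+2%:Z * (b i - a i)) (z2 - z1)) (intrM R q.+2%:Z (b i - a i)).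
  rewrite -pmulrn mulrDl.
  by rewrite mulrAC divff ?mul1r// pnatr_eq0.
under eq_cvg do rewrite h.
apply: cvgM; last exact: cvg_cst.
apply: cvg_prodr => i.
rewrite -[X in _ --> X]addr0; apply: cvgD; first exact: cvg_cst.
rewrite -(mulr0 (z2 - z1)%:~R); apply: cvgM; first exact: cvg_cst.
apply/cvgrPdist_le => eps eps0; have [N hN] := ex_nat_ge eps^-1.
exists N => // q /= Nq; rewrite sub0r normrN ger0_norm ?invr_ge0//.
rewrite -[leRHS]invrK lef_pV2 ?posrE ?invr_gt0//.
by apply: hN; rewrite (leq_trans Nq)// ltnW.
Qed.

(** For large q the enlarged box has mean average still below the level, so the event is not null;
    being stable under the group, it has probability one. *)
Let upper_ae (a b : 'I_d -> int) lam : (forall i, a i <= b i) -> vol a b < lam ->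
  \forall w \ae P, upper V a b lam (mu w).
Proof.
move=> ab hl.
apply: (ergodic_stable_ae hG htheta herg (B := [set w | upper V a b lam (mu w)])) => //.
  move=> g w Gg /=; apply: (upper_translate hV (g := fun i => g i 0)).
  by move=> *; exact: M_shift.
move=> hae.
have [q hq] : exists q, vol (real_corner q (-1) a) (real_corner q 1 b) < lam * q.+2%:R ^+ d.
  have /cvgrPdist_lt/(_ (lam - vol a b)) := @vol_corner a b (-1) 1.
  rewrite subr_gt0 => /(_ hl)[q _ /(_ q (leqnn q))/=].
  rewrite ltr_norml => /andP[h _]; exists q.
  by rewrite -ltr_pdivrMr ?exprn_gt0//; lra.
have ab' i : real_corner q (-1) a i <= real_corner q 1 b i.
  by rewrite /real_corner lerD// ler_wpM2l.
have [h1 h2] := average ab'.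
apply: (eventually_le_nonnull h1 _ h2 hq).
  by move=> n w; rewrite /avg mulr_ge0 ?mass_ge0// invr_ge0 exprn_ge0.
apply: filterS hae => w; apply: contra_not => -[N hN].
by exists q, N.
Qed.

Let lower_ae (a b : 'I_d -> int) lam : (forall i, a i < b i) -> lam < vol a b ->
  \forall w \ae P, lower V a b lam (mu w).
Proof.
move=> ab hl.
apply: (ergodic_stable_ae hG htheta herg (B := [set w | lower V a b lam (mu w)])) => //.
  move=> g w Gg /=; apply: (lower_translate hV (g := fun i => g i 0)).
  by move=> *; exact: M_shift.
move=> hae.
have [q hq] : exists q, lam * q.+2%:R ^+ d < vol (real_corner q 1 a) (real_corner q (-1) b).
  have /cvgrPdist_lt/(_ (vol a b - lam)) := @vol_corner a b 1 (-1).
  rewrite subr_gt0 => /(_ hl)[q _ /(_ q (leqnn q))/=].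
  rewrite ltr_norml => /andP[_ h]; exists q.
  by rewrite -ltr_pdivlMr ?exprn_gt0//; lra.
have ab' i : real_corner q 1 a i <= real_corner q (-1) b i.
  have := ab i; rewrite /real_corner => abi.
  have -> : b i = a i + 1 + (b i - a i - 1) by ring.
  have : 0 <= b i - a i - 1 by lia.
  move: (b i - a i - 1) => z z0; nia.
have [h1 h2] := average ab'.
apply: (eventually_ge_nonnull h1 _ h2 hq).
  by move=> n w; rewrite /avg mulr_ge0 ?mass_ge0// invr_ge0 exprn_ge0.
apply: filterS hae => w; apply: contra_not => -[N hN].
by exists q, N.
Qed.

(** The set consists of the points that satisfy [upper] at every rational level above the expected
    limit and [lower] at every rational level below it, for all integral corners. Squeezing between
    such levels gives convergence along real scales. *)
Theorem spatial_ergodic_theorem : exists A : set Omega,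
  [/\ measurable A, invariant_set G theta A, P A = 1%E &
   forall w, A w -> forall a b : 'I_d -> int, (forall i, a i < b i) ->
    avg V (mu w) a b s @[s --> +oo] --> (\prod_i (b i - a i)%:~R) * mean_mass].
Proof.
(* Finite functions represent the corners, so that the index type is countable. *)
pose I : countType := ({ffun 'I_d -> int} * {ffun 'I_d -> int} * rat)%type.
pose B (i : I) : set Omega := [set w | (forall k, i.1.1 k < i.1.2 k) ->
  (vol i.1.1 i.1.2 < ratr i.2 -> upper V i.1.1 i.1.2 (ratr i.2) (mu w)) /\
  (ratr i.2 < vol i.1.1 i.1.2 -> lower V i.1.1 i.1.2 (ratr i.2) (mu w))].
pose A := [set w | forall i, B i w].
have imp_meas (Q : Prop) (C : set Omega) : measurable C -> measurable [set w | Q -> C w].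
  move=> mC; have [q|nq] := pselect Q.
    by rewrite (_ : mkset _ = C)//; apply/seteqP; split=> w //= h; exact: h.
  by rewrite (_ : mkset _ = setT)//; apply/seteqP; split=> w //=.
have mA : measurable A.
  apply: measurable_forall_countable => i; apply: (imp_meas).
  apply: (@measurableI _ _
    [set w | vol i.1.1 i.1.2 < ratr i.2 -> upper V i.1.1 i.1.2 (ratr i.2) (mu w)]
    [set w | ratr i.2 < vol i.1.1 i.1.2 -> lower V i.1.1 i.1.2 (ratr i.2) (mu w)]).
    by apply: (imp_meas); exact: mupper.
  by apply: (imp_meas); exact: mlower.
have sA g w : G g -> A w -> A (theta g w).
  move=> Gg Aw i hi; have [h1 h2] := Aw i hi.
  have tr a b : mass V (mu (theta g w)) a b =
      mass V (mu w) (fun i => a i + g i 0) (fun i => b i + g i 0) by exact: M_shift.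
  split=> h; [apply: (upper_translate hV tr); exact: h1|apply: (lower_translate hV tr); exact: h2].
exists A; split=> //.
- exact: (stable_invariant hG htheta).
- have : \forall w \ae P, A w.
    apply: ae_forall_countable => i.
    have [hi|hi] := pselect (forall k, i.1.1 k < i.1.2 k); last by apply: aeW => w /hi.
    have u : \forall w \ae P, vol i.1.1 i.1.2 < ratr i.2 ->
        upper V i.1.1 i.1.2 (ratr i.2) (mu w).
      have [h|h] := pselect (vol i.1.1 i.1.2 < ratr i.2); last by apply: aeW => w /h.
      have := upper_ae (fun k => ltW (hi k)) h; exact: filterS.
    have l : \forall w \ae P, ratr i.2 < vol i.1.1 i.1.2 ->
        lower V i.1.1 i.1.2 (ratr i.2) (mu w).
      have [h|h] := pselect (ratr i.2 < vol i.1.1 i.1.2); last by apply: aeW => w /h.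
      have := lower_ae hi h; exact: filterS.
    by apply: filterS2 u l.
  move=> /(measure_negligible (measurableC mA)) PA0.
  by rewrite -[A]setCK probability_setC ?PA0 ?sube0//; exact: measurableC.
move=> w Aw a b ab; rewrite -/(vol a b).
pose i (c : rat) : I := ([ffun k => a k], [ffun k => b k], c).
have volE c : vol (i c).1.1 (i c).1.2 = vol a b.
  by rewrite /vol; congr (_ * _); apply: eq_bigr => k _; rewrite !ffunE.
have iE c : ((i c).1.1 : 'I_d -> int) = a /\ ((i c).1.2 : 'I_d -> int) = b.
  by split; apply/funext => k; rewrite ffunE.
have Ai c : (vol a b < ratr c -> upper V a b (ratr c) (mu w)) /\
    (ratr c < vol a b -> lower V a b (ratr c) (mu w)).
  have := Aw (i c); rewrite /B /= (volE c).
  have [-> ->] := iE c; exact.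
have vol0 : 0 <= vol a b.
  rewrite mulr_ge0 ?mean_mass_ge0// prodr_ge0// => k _.
  by rewrite ler0z subr_ge0 ltW.
apply/cvgrPdist_le => eps eps0.
have [c1] : exists c : rat, ratr c \in `]vol a b, vol a b + eps[.
  by apply: rat_in_itvoo; rewrite ltrDl.
rewrite in_itv/= => /andP[c1l c1u].
have [c2] : exists c : rat, ratr c \in `]vol a b - eps, vol a b[.
  by apply: rat_in_itvoo; rewrite gtrBl.
rewrite in_itv/= => /andP[c2l c2u].
have [s1 h1] := upper_scaling hV (ltW (le_lt_trans vol0 c1l)) ((Ai c1).1 c1l).
have [s2 h2] := lower_scaling hV ((Ai c2).2 c2u).
exists (Num.max s1 s2); split; first exact: num_real.
move=> s /=; rewrite gt_max => /andP[hs1 hs2].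
have := h1 s hs1; have := h2 s hs2; rewrite ler_norml; lra.
Qed.

End spatial_ergodic_theorem.

(** * The Lebesgue measure *)

Section lebesgue_boxes.
Context {R : realType} {d : nat}.

Let stdbox (a b : 'cV[R]_d) := [set x : 'cV[R]_d | forall i, a i 0 <= x i 0 < b i 0].

Let boxes : set (set 'cV[R]_d) := [set A | exists a b, A = stdbox a b].

Let stdboxI : setI_closed boxes.
Proof.
move=> _ _ [a [b ->]] [a' [b' ->]].
exists (\col_i Num.max (a i 0) (a' i 0)), (\col_i Num.min (b i 0) (b' i 0)).
apply/seteqP; split=> [x [h h'] i|x h].
  by rewrite !mxE ge_max lt_min; have /andP[-> ->] := h i; have /andP[-> ->] := h' i.
by split=> i; have := h i; rewrite !mxE ge_max lt_min => /andP[/andP[? ?] /andP[? ?]];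
  apply/andP.
Qed.

(** It suffices that the coordinates are measurable for the generated sigma-algebra: a half-space
    x_i >= c is a countable union of boxes. *)
Let boxes_gen : @measurable _ 'cV[R]_d = <<s boxes >>.
Proof.
apply/seteqP; split=> [A mA|]; last first.
  apply: smallest_sub; first exact: sigma_algebra_measurable.
  by move=> _ [a [b ->]]; exact: Defs.measurable_box.
pose T := g_sigma_algebraType boxes.
have mid : measurable_fun [set: T] (fun x : T => (x : 'cV[R]_d)).
  apply: (@measurable_fun_mx R _ T d 1) => i j; rewrite (ord1 j).
  apply: (measurability _ (RGenCInfty.measurableE R)).
  move=> _ [_ [c ->] <-]; rewrite setTI.
  rewrite (_ : _ @^-1` _ = \bigcup_n stdbox
      (\col_k (if k == i then c else - n%:R)) (\col_k n%:R)).
    apply: bigcup_measurable => n _; apply: sub_sigma_algebra.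
    by exists (\col_k (if k == i then c else - n%:R)), (\col_k n%:R).
  apply/seteqP; split=> [x|x [n _ /(_ i)]]; last first.
    by rewrite /= !mxE eqxx in_itv/= andbT => /andP[].
  rewrite /= in_itv/= andbT => cx.
  have [n hn] := bound_coord (fun k => x k 0).
  exists n.+1 => // k; rewrite !mxE.
  have := hn n k (leqnn n); rewrite ler_norml => /andP[h1 h2].
  apply/andP; split; last by rewrite (le_lt_trans h2)// ltr_nat.
  case: eqP => [->//|_]; apply: le_trans h1.
  by rewrite lerN2 ler_nat.
by have := mid measurableT A mA; rewrite setTI.
Qed.

Let lebesgue_stdbox (a b : 'cV[R]_d) : lebesgue_cV (stdbox a b) =
  if [forall i, a i 0 <= b i 0] then (\prod_(i < d) (b i 0 - a i 0))%:E else 0%E.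
Proof.
case: ifPn => [/forallP h|/forallPn[i]]; first exact: lebesgue_cV_box.
rewrite -ltNge => ba; rewrite (_ : stdbox a b = set0) ?measure0//.
apply/seteqP; split=> // x /(_ i) /andP[h1 h2].
by have := lt_trans (le_lt_trans h1 h2) ba; rewrite ltxx.
Qed.

(** Uniqueness of measures on the intersection-stable family of boxes. Translation invariance and
    scaling of Lebesgue measure both reduce to it. *)
Let lebesgue_unique (nu : {measure set 'cV[R]_d -> \bar R}) :
  (forall a b, nu (stdbox a b) = lebesgue_cV (stdbox a b)) ->
  forall A, measurable A -> nu A = lebesgue_cV A.
Proof.
move=> h A mA; apply/esym.
apply: (@measure_unique _ R 'cV[R]_d boxes
  (fun n => stdbox (\col__ - n%:R) (\col__ n%:R)) boxes_gen stdboxI) => //.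
- by move=> n; exists (\col__ - n%:R), (\col__ n%:R).
- apply/seteqP; split=> // x _.
  have [n hn] := bound_coord (fun k => x k 0).
  exists n.+1 => // k; rewrite !mxE.
  have := hn n k (leqnn n); rewrite ler_norml => /andP[h1 h2].
  apply/andP; split; last by rewrite (le_lt_trans h2)// ltr_nat.
  by apply: le_trans h1; rewrite lerN2 ler_nat.
- by move=> _ [a [b ->]]; rewrite h.
- move=> k; rewrite -[ltLHS]/(lebesgue_cV (stdbox (\col__ - k%:R) (\col__ k%:R))).
  by rewrite lebesgue_stdbox; case: ifP => _; rewrite ltry.
Qed.

Lemma lebesgue_translate (g : 'cV[R]_d) (A : set 'cV[R]_d) : measurable A ->
  lebesgue_cV ((fun x => x + g) @^-1` A) = lebesgue_cV A.
Proof.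
move=> mA.
have mD (v : 'cV[R]_d) : measurable_fun setT (fun x : 'cV[R]_d => x + v).
  apply: measurable_fun_mx => i j; under eq_fun do rewrite mxE.
  by apply: measurable_funD; [exact: measurable_coord|exact: measurable_cst].
have [nu nuE] := @pushforward_iso _ _ 'cV[R]_d 'cV[R]_d R lebesgue_cV
  (fun x => x + g) (fun x => x - g) (mD g) (mD (- g)) (addrK g) (subrK g).
rewrite -/(pushforward lebesgue_cV (fun x => x + g) A) nuE.
apply: lebesgue_unique => // a b.
apply: (etrans (congr1 (@^~ (stdbox a b)) (esym nuE))); rewrite /pushforward.
rewrite (_ : _ @^-1` _ = stdbox (a - g) (b - g)).
  rewrite lebesgue_stdbox; apply: (etrans (lebesgue_stdbox _ _)).
  have -> : [forall i, (a - g) i 0 <= (b - g) i 0] = [forall i, a i 0 <= b i 0].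
    by apply: eq_forallb => i; rewrite !mxE lerD2r.
  case: ifP => // _; congr (_%:E); apply: eq_bigr => i _.
  by rewrite !mxE; ring.
by apply/seteqP; split=> x h i; have := h i; rewrite !mxE lerBlDr ltrBrDr.
Qed.

Lemma lebesgue_rescale (eps : R) (A : set 'cV[R]_d) : 0 < eps -> measurable A ->
  rescale eps lebesgue_cV A = lebesgue_cV A.
Proof.
move=> e0 mA.
have [nu nuE] := @rescale_measure R d eps lebesgue_cV e0.
rewrite nuE; apply: lebesgue_unique => // a b.
apply: (etrans (congr1 (@^~ (stdbox a b)) (esym nuE))); rewrite /rescale.
rewrite (_ : _ @` _ = stdbox (eps^-1 *: a) (eps^-1 *: b)).
  rewrite lebesgue_stdbox.
  apply: (etrans (congr1 (mule _) (lebesgue_stdbox _ _))).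
  have -> : [forall i, (eps^-1 *: a) i 0 <= (eps^-1 *: b) i 0] = [forall i, a i 0 <= b i 0].
    by apply: eq_forallb => i; rewrite !mxE ler_pM2l ?invr_gt0.
  case: ifP => _; last by rewrite mule0.
  rewrite -EFinM; congr (_%:E).
  have -> : eps ^+ d = \prod_(i < d) eps by rewrite prodr_const card_ord.
  rewrite -big_split/=; apply: eq_bigr => i _.
  by rewrite !mxE -mulrBr mulVKf ?gt_eqF.
apply/seteqP; split=> [_ [x h <-] i|x h].
  by rewrite !mxE ler_pM2l ?invr_gt0// ltr_pM2l ?invr_gt0.
exists (eps *: x); last by rewrite scalerA mulVf ?gt_eqF// scale1r.
by move=> i; have := h i; rewrite !mxE ler_pdivrMl// ltr_pdivlMl.
Qed.

Lemma lebesgue_locally_finite : locally_finite (@lebesgue_cV R d).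
Proof.
move=> x; exists (ball x 1).
  by split; [exact: ball_open|exact: ballxx].
pose a : 'cV[R]_d := \col_i (x i 0 - 1); pose b : 'cV[R]_d := \col_i (x i 0 + 1).
apply: (@le_lt_trans _ _ (lebesgue_cV (stdbox a b))).
  apply: le_measure.
  - by apply: mem_set; apply: open_measurable_mx; exact: ball_open.
  - by apply: mem_set; exact: Defs.measurable_box.
  move=> y [_ h] i; have := h i 0; rewrite /ball/= !mxE ltr_norml; lra.
by rewrite lebesgue_stdbox; case: ifP => _; rewrite ltry.
Qed.

Definition lebesgue_lf : lf_measure R d := LFMeasure lebesgue_locally_finite.

Variable V : 'M[R]_d.
Hypothesis hV : V \in unitmx.

Let ell : R := fine (lebesgue_cV (cell V)).

Let avg_lebesgue (a b : 'I_d -> int) (s : R) : 0 < s ->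
  avg V lebesgue_lf a b s =
  mass V lebesgue_lf (fun i => (a i)%:~R) (fun i => (b i)%:~R).
Proof.
move=> s0; apply: EFin_inj; rewrite /avg EFinM -!massE//=.
rewrite -(lebesgue_rescale s0); last exact: measurable_boxV.
rewrite /rescale scale_box ?invr_gt0// muleA -EFinM mulVf ?gt_eqF ?exprn_gt0// mul1e.
congr (lebesgue_cV (box V _ _)); apply/funext => i;
  by rewrite mulKf// gt_eqF.
Qed.

(** A substitute for the change of variables by V. The spatial ergodic theorem is applied to
    Lebesgue measure as a deterministic random measure over the one-point space; its averages do not
    depend on the scale, hence equal their limit. *)
Lemma mass_lebesgue (a b : 'I_d -> int) : (forall i, a i < b i) ->
  mass V lebesgue_lf (fun i => (a i)%:~R) (fun i => (b i)%:~R) =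
  \prod_i (b i - a i)%:~R * ell.
Proof.
move=> ab.
have cellE : lebesgue_cV (cell V) = (mass V lebesgue_lf (fun=> 0) (fun=> 1))%:E.
  by rewrite (cell_box hV) -(massE hV).
have cellE' : lebesgue_lf (cell V) = (mass V lebesgue_lf (fun=> 0) (fun=> 1))%:E.
  exact: cellE.
have := @spatial_ergodic_theorem R d _ unit \d_tt setT (fun _ => id) V (fun=> lebesgue_lf).
case=> //.
- by left.
- split=> //; rewrite setXTT; exact: measurable_snd.
- move=> A mA _; have [h|h] := pselect (A tt); [right|left].
    by rewrite /= diracE mem_set.
  by rewrite /= diracE memNset.
- move=> w g _ A mA; rewrite /translate /=.
  rewrite -[RHS](lebesgue_translate (V *m g)).
    congr (lebesgue_cV _); apply/seteqP; split=> [x Ax|x [y Ay]].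
      by exists x.
    by rewrite /tau => /addIr <-.
  rewrite (_ : tau V g @` A = (fun x => x + - (V *m g)) @^-1` A).
    rewrite -[X in measurable X]setTI.
    have : measurable_fun setT (fun x : 'cV[R]_d => x + - (V *m g)).
      apply: measurable_fun_mx => i j; under eq_fun do rewrite mxE.
      by apply: measurable_funD; [exact: measurable_coord|exact: measurable_cst].
    by apply.
  apply/seteqP; split=> [_ [x Ax <-]|x Ax]; first by rewrite /tau /= addrK.
  by exists (x - V *m g) => //; rewrite /tau subrK.
- exists 2; first by rewrite ltr1n.
  by rewrite cellE' poweR_EFin integral_cst_probability ltry.
move=> A [_ _ PA hA].
have Att : A tt.
  apply: contrapT => nA; move: PA; rewrite /= diracE memNset//.
  by move=> /eqP; rewrite eqe eq_sym oner_eq0.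
have := hA tt Att a b ab.
rewrite /mean_mass cellE' integral_cst_probability /= => hl.
rewrite /ell cellE /=.
apply: (@cvg_unique _ (@norm_hausdorff _ R) _ _ _ _ _ hl).
apply/cvgrPdist_le => e e0; exists 0; split=> // s s0.
by rewrite avg_lebesgue// subrr normr0 ltW.
Qed.

Lemma avg_lebesgue_cvg (a b : 'I_d -> int) : (forall i, a i < b i) ->
  avg V lebesgue_lf a b s @[s --> +oo] --> \prod_i (b i - a i)%:~R * ell.
Proof.
move=> ab; apply/cvgrPdist_le => e e0; exists 0; split=> // s s0.
by rewrite avg_lebesgue// mass_lebesgue// subrr normr0 ltW.
Qed.

(** Otherwise all the boxes [-n, n) in the coordinates of V would be null by [mass_lebesgue]; they
    cover the space, whereas the standard unit cube has volume 1. *)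
Lemma lebesgue_cell_gt0 : 0 < ell.
Proof.
rewrite lt0r fine_ge0 ?measure_ge0// andbT; apply/eqP => l0.
have B0 n : lebesgue_cV (box V (fun=> (- n.+1%:Z)%:~R) (fun=> (n.+1%:Z)%:~R)) = 0%E.
  have -> : lebesgue_cV = lebesgue_lf :> (set 'cV[R]_d -> \bar R) by [].
  rewrite massE// (mass_lebesgue (a := fun=> - n.+1%:Z) (b := fun=> n.+1%:Z)).
    by rewrite l0 mulr0.
  by move=> i; lia.
have : lebesgue_cV (stdbox 0 (\col__ 1)) = 0%E.
  apply/eqP; rewrite eq_le measure_ge0 andbT.
  apply: (@le_trans _ _ (lebesgue_cV (\bigcup_n
     box V (fun=> (- n.+1%:Z)%:~R) (fun=> (n.+1%:Z)%:~R)))).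
    apply: le_measure.
    - by apply: mem_set; exact: Defs.measurable_box.
    - by apply: mem_set; apply: bigcup_measurable => n _; exact: measurable_boxV.
    move=> x _; have [n hn] := bound_coord (coordV V x).
    exists n => // i; have := hn n i (leqnn n); rewrite ler_norml => /andP[h1 h2].
    rewrite mulrNz -pmulrn; apply/andP; split.
      by apply: le_trans h1; rewrite lerN2 ler_nat.
    by rewrite (le_lt_trans h2)// ltr_nat.
  have : (lebesgue_cV : {measure set 'cV[R]_d -> \bar R}).-negligible (\bigcup_n
     box V (fun=> (- n.+1%:Z)%:~R) (fun=> (n.+1%:Z)%:~R)).
    apply: negligible_bigcup => n; apply/negligibleP; first exact: measurable_boxV.
    exact: B0.
  move=> /negligibleP ->//; apply: bigcup_measurable => n _; exact: measurable_boxV.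
rewrite lebesgue_stdbox; case: ifPn => [_|/forallPn[i]]; last first.
  by rewrite !mxE ler01.
under eq_bigr do rewrite !mxE subr0.
by rewrite big1// => /eqP; rewrite eqe oner_eq0.
Qed.

End lebesgue_boxes.

(** * Integrals of functions with polynomial decay *)

Section euclidean_norm.
Context {R : realType} {d : nat}.
Implicit Types (x : 'cV[R]_d).

Lemma enorm_ge0 x : 0 <= enorm x.
Proof. exact: sqrtr_ge0. Qed.

Lemma enorm_coord x i : `|x i 0| <= enorm x.
Proof.
rewrite -sqrtr_sqr /enorm ler_wsqrtr// (bigD1 i)//= lerDl.
by apply: sumr_ge0 => j _; exact: sqr_ge0.
Qed.

Lemma enorm_sum x : enorm x <= \sum_i `|x i 0|.
Proof.
have s0 : 0 <= \sum_i `|x i 0| by exact: sumr_ge0.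
rewrite -[leRHS]ger0_norm// -sqrtr_sqr /enorm ler_wsqrtr//.
rewrite expr2 mulr_suml; apply: ler_sum => i _.
rewrite -real_normK ?num_real// expr2 ler_wpM2l//.
by rewrite (bigD1 i)//= lerDl sumr_ge0.
Qed.

Lemma enorm_continuous : continuous (@enorm R d).
Proof.
move=> x; apply: (@continuous_comp _ _ _ (fun x : 'cV[R]_d => \sum_(i < d) x i 0 ^+ 2) Num.sqrt).
  apply: continuous_sumr => i y.
  apply: (@continuous_comp _ _ _ (fun x : 'cV[R]_d => x i 0) (fun t : R => t ^+ 2)).
    exact: coord_continuous.
  exact: exprn_continuous.
exact: sqrt_continuous.
Qed.

Definition decay (beta : R) x : R := (1 + enorm x) `^ (- beta).

Lemma decay_ge0 beta x : 0 <= decay beta x.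
Proof. exact: powR_ge0. Qed.

Lemma measurable_decay beta : measurable_fun setT (decay beta).
Proof.
apply: (measurableT_comp (measurable_powR (- beta))).
apply: measurable_funD; first exact: measurable_cst.
by apply: continuous_measurable_mx; exact: enorm_continuous.
Qed.

Lemma decay_le beta x (t : R) : 0 <= beta -> 0 < t -> t <= enorm x ->
  decay beta x <= t `^ (- beta).
Proof.
move=> b0 t0 tx; have e0 : 0 < 1 + enorm x by rewrite ltr_pwDl ?enorm_ge0.
have te : t <= 1 + enorm x by rewrite (le_trans tx)// lerDr.
rewrite /decay !powRN lef_pV2 ?posrE ?powR_gt0//.
by apply: ge0_ler_powR => //; rewrite nnegrE ltW.
Qed.

Lemma decay_le1 beta x : 0 <= beta -> decay beta x <= 1.
Proof.
move=> b0; rewrite /decay powRN invf_le1 ?powR_gt0 ?ltr_pwDl ?enorm_ge0//.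
have := ge0_ler_powR b0 (x := 1) (y := 1 + enorm x).
by rewrite powR1; apply; rewrite ?nnegrE ?lerDl ?addr_ge0 ?enorm_ge0.
Qed.

End euclidean_norm.

Section cubes.
Context {R : realType} {d : nat}.
Variable V : 'M[R]_d.
Hypothesis hV : V \in unitmx.

Definition cube (L : R) : set 'cV[R]_d := box V (fun=> - L) (fun=> L).

Lemma measurable_cube L : measurable (cube L).
Proof. exact: measurable_boxV. Qed.

Lemma cube_sub L L' : L <= L' -> cube L `<=` cube L'.
Proof. by move=> LL; apply: box_sub => // i; rewrite lerN2. Qed.

(** The sum of the absolute values of the entries of [invmx V] bounds every coordinate by the norm;
    adding 1 keeps the constant invertible also for d = 0. *)
Lemma enorm_outside_cube : exists2 k : R, 0 < k &
  forall L x, 0 < L -> ~ cube L x -> k * L <= enorm x.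
Proof.
pose S : R := \sum_i \sum_j `|invmx V i j|.
have S0 : 0 <= S by apply: sumr_ge0 => i _; exact: sumr_ge0.
exists (1 + S)^-1; first by rewrite invr_gt0 ltr_pwDl.
move=> L x L0 nx; rewrite ler_pdivrMl ?ltr_pwDl//.
have [i hi] : exists i, L <= `|coordV V x i|.
  apply: contrapT => h; apply: nx => i; have : `|coordV V x i| < L.
    by rewrite ltNge; apply/negP => hi; apply: h; exists i.
  by rewrite ltr_norml => /andP[/ltW -> ->].
apply: (le_trans hi); rewrite /coordV mxE.
apply: (le_trans (ler_norm_sum _ _ _)).
apply: (@le_trans _ _ (\sum_j `|invmx V i j| * enorm x)).
  by apply: ler_sum => j _; rewrite normrM ler_wpM2l// enorm_coord.
rewrite -mulr_suml ler_wpM2r ?enorm_ge0//.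
rewrite /S [in leRHS](bigD1 i)//= addrCA lerDl addr_ge0//.
by apply: sumr_ge0 => k _; exact: sumr_ge0.
Qed.

Lemma coord_in_box : exists2 k : R, 0 < k &
  forall L (x : 'cV[R]_d), 0 <= L -> (forall i, `|coordV V x i| <= L) ->
  forall i, `|x i 0| <= k * L.
Proof.
pose S : R := \sum_i \sum_j `|V i j|.
have S0 : 0 <= S by apply: sumr_ge0 => i _; exact: sumr_ge0.
exists (1 + S); first by rewrite ltr_pwDl.
move=> L x L0 hx i.
have -> : x = V *m (\col_j coordV V x j).
  have -> : \col_j coordV V x j = invmx V *m x by apply/colP => j; rewrite mxE.
  by rewrite mulKVmx.
rewrite mxE; apply: (le_trans (ler_norm_sum _ _ _)).
apply: (@le_trans _ _ (\sum_j `|V i j| * L)).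
  by apply: ler_sum => j _; rewrite normrM ler_wpM2l// mxE.
rewrite -mulr_suml ler_wpM2r//.
rewrite /S [in leRHS](bigD1 i)//= addrCA lerDl addr_ge0//.
by apply: sumr_ge0 => k _; exact: sumr_ge0.
Qed.

Lemma enorm_in_cube : exists2 k : R, 0 < k &
  forall L x, 0 <= L -> cube L x -> enorm x <= k * L.
Proof.
have [k k0 hk] := coord_in_box; exists (1 + d%:R * k).
  by rewrite ltr_pwDl// mulr_ge0// ltW.
move=> L x L0 hx; apply: (le_trans (enorm_sum x)).
apply: (@le_trans _ _ (\sum_(i < d) k * L)).
  apply: ler_sum => i _; apply: hk => // j.
  by have /andP[h1 h2] := hx j; rewrite ler_norml h1 ltW.
have -> : \sum_(i < d) k * L = d%:R * k * L.
  by rewrite sumr_const card_ord -[LHS]mulr_natl mulrA.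
by rewrite mulrDl mul1r lerDr.
Qed.

(** The constant is chosen before the measure, so that it serves all rescaled measures at once. The
    growth bound is asked only for cubes of size at least K, because a rescaled measure satisfies it
    only above a multiple of [eps]. *)
Lemma decay_tail (beta : R) : d%:R < beta -> exists2 C : R, 0 < C &
  forall (nu : {measure set 'cV[R]_d -> \bar R}) (A K : R), 0 < K -> 0 <= A ->
  (forall L, K <= L -> (nu (cube L) <= (A * L ^+ d)%:E)%E) ->
  (\int[nu]_(x in ~` cube K) (decay beta x)%:E <=
    (C * A * (K ^+ d * K `^ (- beta)))%:E)%E.
Proof.
move=> db; have [k k0 hk] := enorm_outside_cube.
have b0 : 0 <= beta by rewrite (le_trans _ (ltW db)).
(* The ratio of consecutive dyadic shells: the mass bound grows by 2^d, the weight decreases by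
   2^(-beta). That q < 1 is the condition d < beta. *)
pose q : R := 2 ^+ d * 2 `^ (- beta).
have q0 : 0 < q by rewrite mulr_gt0 ?exprn_gt0 ?powR_gt0.
have q1 : q < 1.
  rewrite /q powRN ltr_pdivrMr ?powR_gt0// mul1r -powR_mulrn//.
  rewrite /powR pnatr_eq0/= ltr_expR ltr_pM2r// ln_gt0// ltr1n.
  done.
(* The first factor compares the norm with the size of the inner cube of a shell, the second
   measures the shell by its outer cube. *)
pose C : R := k `^ (- beta) * 2 ^+ d.
have C0 : 0 < C by rewrite mulr_gt0 ?exprn_gt0 ?powR_gt0.
exists (C / (1 - q)); first by rewrite divr_gt0// subr_gt0.
move=> nu A K K0 A0 hA; set g := K ^+ d * K `^ (- beta).
have g0 : 0 <= g by rewrite mulr_ge0 ?exprn_ge0 ?powR_ge0// ltW.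
pose D n := cube (2 ^+ n * K) `\` cube K.
have mc L : measurable (cube L) by exact: measurable_cube.
have mD n : measurable (D n) by exact: measurableD.
have Kn n : 0 < 2 ^+ n * K by rewrite mulr_gt0// exprn_gt0.
have KnK n : K <= 2 ^+ n * K by rewrite ler_peMl ?(ltW K0)// exprn_ege1// ler1n.
have mdE B : measurable_fun B (fun x => (decay beta x)%:E).
  apply/measurable_EFinP; apply: measurable_funTS; exact: measurable_decay.
have ring n : (\int[nu]_(x in cube (2 ^+ n.+1 * K) `\` cube (2 ^+ n * K))
    (decay beta x)%:E <= (C * A * g * q ^+ n)%:E)%E.
  apply: (@le_trans _ _ (\int[nu]_(x in cube (2 ^+ n.+1 * K) `\` cube (2 ^+ n * K))
     ((k * (2 ^+ n * K)) `^ (- beta))%:E)%E).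
    apply: ge0_le_integral => //.
    - exact: measurableD.
    - by move=> x _; rewrite lee_fin decay_ge0.
    - by move=> x [_ nx]; rewrite lee_fin decay_le ?mulr_gt0// hk.
  rewrite integral_cst; last exact: measurableD.
  apply: (@le_trans _ _ (((k * (2 ^+ n * K)) `^ (- beta))%:E * nu (cube (2 ^+ n.+1 * K)))%E).
    apply: lee_wpmul2l; first by rewrite lee_fin powR_ge0.
    apply: le_measure; first by apply: mem_set; exact: measurableD.
      by apply: mem_set.
    by move=> x [].
  apply: (le_trans (lee_wpmul2l _ (hA _ (KnK n.+1)))); first by rewrite lee_fin powR_ge0.
  rewrite -EFinM lee_fin !powRM ?mulr_ge0 ?exprn_ge0 ?(ltW k0) ?(ltW K0)//.
  have -> : (2 ^+ n) `^ (- beta) = (2 `^ (- beta)) ^+ n :> R.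
    by rewrite -!powR_mulrn ?powR_ge0// -!powRrM mulrC.
  rewrite /C /g /q !exprMn exprS exprMn -[2 ^+ n ^+ d]exprM mulnC exprM.
  by rewrite le_eqVlt; apply/orP; left; apply/eqP; ring.
have bnd n : (\int[nu]_(x in D n) (decay beta x)%:E <=
    (C * A * g * ((1 - q ^+ n) / (1 - q)))%:E)%E.
  elim: n => [|n IH].
    by rewrite /D expr0 mul1r setDv integral_set0 subrr mul0r mulr0.
  have -> : D n.+1 = D n `|` (cube (2 ^+ n.+1 * K) `\` cube (2 ^+ n * K)).
    have sub : cube (2 ^+ n * K) `<=` cube (2 ^+ n.+1 * K).
      by apply: cube_sub; rewrite ler_wpM2r ?(ltW K0)// ler_eXn2l ?ltr1n.
    have subK : cube K `<=` cube (2 ^+ n * K) by exact: cube_sub.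
    apply/seteqP; split=> x /=.
      by move=> [h1 h2]; have [h|h] := pselect (cube (2 ^+ n * K) x); [left|right].
    by case=> -[h1 h2]; split => //; [exact: sub|move=> /subK].
  rewrite ge0_integral_setU//; first last.
  - by apply/disj_setPRL => x /= [_ h]; apply/not_andP; left.
  - by move=> x _; rewrite lee_fin decay_ge0.
  - exact: measurableD.
  apply: (le_trans (leeD IH (ring n))); rewrite -EFinD lee_fin.
  rewrite le_eqVlt; apply/orP; left; apply/eqP; rewrite exprS; field.
  by rewrite subr_eq0 gt_eqF.
have nd : nondecreasing_seq D.
  apply/nondecreasing_seqP => n; rewrite subsetEset; apply: setSD.
  by apply: cube_sub; rewrite ler_wpM2r ?(ltW K0)// ler_eXn2l ?ltr1n.
have DU : \bigcup_n D n = ~` cube K.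
  apply/seteqP; split=> [x [n _ []]//|x nx].
  have [n hn] := bound_coord (fun i => coordV V x i / K).
  exists n.+1 => //; split=> // i.
  have := hn n i (leqnn n); rewrite normrM [`|K^-1|]ger0_norm ?invr_ge0 ?(ltW K0)//.
  rewrite ler_pdivrMr// ler_norml => /andP[h1 h2].
  have h3 : n%:R * K < 2 ^+ n.+1 * K.
    by rewrite ltr_pM2r// -natrX ltr_nat (leq_trans (ltn_expl n (leqnn 2)))// leq_exp2l.
  by apply/andP; split; [apply: le_trans h1; rewrite lerN2 ltW|exact: le_lt_trans h3].
have := @ge0_nondecreasing_set_cvg_integral _ _ _ _ (fun x => (decay beta x)%:E) nu nd mD.
rewrite DU => hc.
have {}hc : (\int[nu]_(x in D n) (decay beta x)%:E @[n --> \oo]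
    --> \int[nu]_(x in ~` cube K) (decay beta x)%:E)%E.
  by apply: hc => // i x _; rewrite lee_fin decay_ge0.
apply: (cvge_to_le hc); apply: nearW => n.
apply: (le_trans (bnd n)); rewrite lee_fin.
have -> : C / (1 - q) * A * g = C * A * g * (1 / (1 - q)).
  by field; rewrite subr_eq0 gt_eqF.
apply: ler_wpM2l; first exact: mulr_ge0 (mulr_ge0 (ltW C0) A0) g0.
by rewrite ler_pM2r ?invr_gt0 ?subr_gt0// gerBl exprn_ge0// ltW.
Qed.

Lemma decay_scale_cvg (beta : R) : d%:R < beta ->
  L ^+ d * L `^ (- beta) @[L --> +oo] --> (0 : R).
Proof.
move=> db.
apply/cvgrPdist_le => eps eps0.
have bd : 0 < beta - d%:R by rewrite subr_gt0.
exists (Num.max 0 (eps^-1 `^ (beta - d%:R)^-1)); split; first exact: num_real.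
move=> L; rewrite gt_max => /andP[L0 hL] /=.
rewrite -powR_mulrn ?(ltW L0)// -powRD; last by rewrite (gt_eqF L0) implybT.
rewrite sub0r normrN ger0_norm ?powR_ge0// -[d%:R - beta]opprB powRN.
rewrite -[leRHS]invrK lef_pV2 ?posrE ?invr_gt0 ?powR_gt0//.
have := ge0_ler_powR (ltW bd) (x := eps^-1 `^ (beta - d%:R)^-1) (y := L).
rewrite -powRrM mulVf ?gt_eqF// powRr1 ?invr_ge0 ?(ltW eps0)//.
by apply; rewrite ?nnegrE ?powR_ge0// ltW.
Qed.

End cubes.

(** The substitution s = 1 / (r eps), with 1 / r the mesh of a grid. *)
Lemma near_pinfty_inv {R : realType} (Q : R -> Prop) (r : R) : 0 < r ->
  (\forall s \near +oo, Q s) -> \forall eps \near 0^'+, Q (r * eps)^-1.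
Proof.
move=> r0 [M [_ hM]]; have M0 : 0 < r * (`|M| + 1) by rewrite mulr_gt0// ltr_wpDl.
near=> eps.
have e0 : 0 < eps by near: eps; exact: nbhs_right_gt.
have e1 : eps < (r * (`|M| + 1))^-1.
  by near: eps; apply: nbhs_right_lt; rewrite invr_gt0.
apply: hM; apply: (le_lt_trans (ler_norm M)).
have re : 0 < r * eps by rewrite mulr_gt0.
move: e1; rewrite -[in X in X -> _]div1r ltr_pdivlMr// => e1.
by rewrite -div1r ltr_pdivlMr//; lra.
Unshelve. all: by end_near. Qed.

(** Uniform continuity from the near-covering form of compactness, with the filter of [delta]
    tending to 0 from above as the parameter. *)
Lemma uniform_modulus {R : realType} {d : nat} (phi : 'cV[R]_d -> R) (C : set 'cV[R]_d)
    (eta : R) : continuous phi -> compact C -> 0 < eta ->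
  exists2 delta : R, 0 < delta &
    forall x y, C x -> ball x delta y -> `|phi x - phi y| <= eta.
Proof.
move=> cphi /compact_near_coveringP cC eta0.
have e20 : 0 < eta / 2 by rewrite divr_gt0.
have : \forall delta \near 0^'+,
    C `<=` (fun x => forall y, ball x delta y -> `|phi x - phi y| <= eta).
  apply: (cC R 0^'+ (fun delta x => forall y, ball x delta y -> `|phi x - phi y| <= eta)).
  move=> x Cx; have /cvgrPdist_lt/(_ _ e20)/nbhs_ballP[e /= e0 he] := cphi x.
  have e2 : 0 < e / 2 by rewrite divr_gt0.
  exists (ball x (e / 2), [set delta | delta < e / 2]) => /=.
    by split; [exact: nbhsx_ballx|exact: nbhs_right_lt].
  move=> [x' delta] /= [xx' de] y x'y.
  have h1 : `|phi x - phi x'| < eta / 2.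
    by apply: he; apply: (le_ball _ xx'); rewrite ler_pdivrMr// mulr_natr mulr2n lerDl ltW.
  have h2 : `|phi x - phi y| < eta / 2.
    apply: he; rewrite [e]splitr; apply: (ball_triangle xx').
    by apply: (le_ball _ x'y); exact: ltW.
  by move: h1 h2; rewrite !ltr_norml ler_norml; lra.
move=> h; near (0:R)^'+ => delta; exists delta.
  by near: delta; exact: nbhs_right_gt.
have hC : C `<=` (fun x => forall y, ball x delta y -> `|phi x - phi y| <= eta).
  by near: delta.
by move=> x y Cx; exact: hC.
Unshelve. all: by end_near. Qed.

(** * Tiling of a cube and approximation by step functions *)

Section partition.
Context {R : realType} {d : nat}.
Variable V : 'M[R]_d.
Hypothesis hV : V \in unitmx.
Variables (K r : nat).
Hypotheses (K0 : (0 < K)%N) (r0 : (0 < r)%N).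

(** Indices start at 0 and [corner] recentres them by K r, so that tiles of side 1 / r fill [-K,
    K)^d exactly. Their corners become integral after multiplication by r. *)
Definition grid : finType := {ffun 'I_d -> 'I_(2 * K * r)}.

Definition corner (k : grid) (i : 'I_d) : int := (k i)%:Z - (K * r)%:Z.

Definition tile (k : grid) : set 'cV[R]_d :=
  box V (fun i => r%:R^-1 * (corner k i)%:~R) (fun i => r%:R^-1 * (corner k i + 1)%:~R).

Definition tile_pt (k : grid) : 'cV[R]_d := V *m (\col_i (r%:R^-1 * (corner k i)%:~R)).

Let r0' : 0 < r%:R :> R. Proof. by rewrite ltr0n. Qed.

Lemma measurable_tile k : measurable (tile k).
Proof. exact: measurable_boxV. Qed.

Lemma tile_itv k x i : tile k x ->
  (corner k i)%:~R <= r%:R * coordV V x i < (corner k i + 1)%:~R.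
Proof.
by move=> /(_ i); rewrite ler_pdivrMl// ltr_pdivlMl.
Qed.

Lemma trivIset_tile : trivIset setT tile.
Proof.
apply/trivIsetP => k l _ _ /eqP kl; apply/seteqP; split=> // x [xk xl].
apply: kl; apply/ffunP => i; apply/val_inj => /=.
have /andP[h1 h2] := tile_itv i xk; have /andP[h3 h4] := tile_itv i xl.
have : (corner k i < corner l i + 1).
  by rewrite -(ltr_int R); exact: le_lt_trans h1 h4.
have : (corner l i < corner k i + 1).
  by rewrite -(ltr_int R); exact: le_lt_trans h3 h2.
rewrite /corner; move: (nat_of_ord (k i)) (nat_of_ord (l i)) (K * r)%N => m n z.
lia.
Qed.

Lemma cube_tile : cube V K%:R = \big[setU/set0]_(k <- enum grid) tile k.
Proof.
rewrite -bigcup_seq; apply/seteqP; split=> [x hx|x [k _ xk] i]; last first.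
  have /andP[h1 h2] := tile_itv i xk.
  have c1 : - (K * r)%:R <= (corner k i)%:~R :> R.
    by rewrite /corner intrD mulrNz -!pmulrn lerDr.
  have c2 : (corner k i + 1)%:~R <= (K * r)%:R :> R.
    have := ltn_ord (k i); rewrite pmulrn ler_int /corner.
    by move: (nat_of_ord (k i)) => m; rewrite -mulnA; move: (K * r)%N => n; lia.
  have := le_trans c1 h1; have := lt_le_trans h2 c2; rewrite !natrM => h3 h4.
  by apply/andP; split; [rewrite -(ler_pM2l r0')|rewrite -(ltr_pM2l r0')]; lra.
have u0 i : 0 <= (coordV V x i + K%:R) * r%:R.
  by have /andP[h _] := hx i; rewrite mulr_ge0//; lra.
have ui i := truncn_itv (u0 i).
have hlt i : (Num.truncn ((coordV V x i + K%:R) * r%:R) < 2 * K * r)%N.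
  rewrite -(ltr_nat R); have /andP[h _] := ui i; apply: (le_lt_trans h).
  rewrite 2!natrM ltr_pM2r//; have /andP[_ h2] := hx i; lra.
pose k : grid := [ffun i => Ordinal (hlt i)].
exists k; first by rewrite /= mem_enum.
move=> i; rewrite ler_pdivrMl// ltr_pdivlMl//.
rewrite /corner ffunE /= !intrD mulrNz -!pmulrn natrM.
have /andP[] := ui i; rewrite -natr1.
move: (Num.truncn _)%:R => t h1 h2; apply/andP; split.
  by move: h1; rewrite mulrDl; lra.
by move: h2; rewrite mulrDl; lra.
Qed.

End partition.

Lemma bounded_integrable_on {R : realType} {dT : measure_display}
    {T : measurableType dT} (nu : {measure set T -> \bar R}) (f : T -> R)
    (A : set T) (B : R) :
  measurable A -> (nu A < +oo)%E -> measurable_fun A f ->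
  (forall x, A x -> `|f x| <= B) -> nu.-integrable A (EFin \o f).
Proof.
move=> mA Aoo mf fB; apply: measurable_bounded_integrable => //.
exists B; split; first exact: num_real.
by move=> M /ltW BM x Ax; exact: le_trans (fB x Ax) BM.
Qed.

Lemma cvg_sumr {R : realType} (T : Type) (F : set_system T) (I : Type) (r : seq I)
    (f : I -> T -> R) (l : I -> R) : Filter F ->
  (forall i, f i x @[x --> F] --> l i) ->
  \sum_(i <- r) f i x @[x --> F] --> \sum_(i <- r) l i.
Proof.
move=> FF cf; apply: (@cvg_big _ _ +%R 0 xpredT add_continuous).
by move=> i _; exact: cf.
Qed.

Section step_approximation.
Context {R : realType} {d : nat}.
Variable V : 'M[R]_d.
Hypothesis hV : V \in unitmx.
Variables (K r : nat).
Hypotheses (K0 : (0 < K)%N) (r0 : (0 < r)%N).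
Variable nu : {measure set 'cV[R]_d -> \bar R}.
Hypothesis nufin : (nu (cube V K%:R) < +oo)%E.

Let D := cube V K%:R.

Let tile_sub (k : @grid d K r) : tile V k `<=` D.
Proof.
move=> x xk; rewrite /D (cube_tile hV K0 r0) -bigcup_seq.
by exists k => //=; rewrite mem_enum.
Qed.

Let tile_fin (k : @grid d K r) : (nu (tile V k) < +oo)%E.
Proof.
apply: le_lt_trans nufin; apply: le_measure; last exact: tile_sub.
  by apply: mem_set; exact: measurable_tile.
by apply: mem_set; exact: measurable_cube.
Qed.

Let Rintegral_tiles (f : 'cV[R]_d -> R) (B : R) : measurable_fun setT f ->
  (forall x, D x -> `|f x| <= B) ->
  \int[nu]_(x in D) f x = \sum_(k : @grid d K r) \int[nu]_(x in tile V k) f x.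
Proof.
move=> mf fB; rewrite /Rintegral /D (cube_tile hV K0 r0).
rewrite integral_bigsetU_EFin; first last.
- by apply/measurable_EFinP; exact: measurable_funTS.
- by apply: sub_trivIset (trivIset_tile hV K0 r0).
- exact: enum_uniq.
- by move=> k; exact: measurable_tile.
have e (k : @grid d K r) : (\int[nu]_(x in tile V k) (f x)%:E)%E =
    (fine (\int[nu]_(x in tile V k) (f x)%:E)%E)%:E.
  rewrite fineK//; apply: integrable_fin_num; first exact: measurable_tile.
  apply: (bounded_integrable_on (B := B)) => //; first exact: measurable_tile.
    exact: measurable_funTS.
  by move=> x /tile_sub; exact: fB.
under eq_bigr do rewrite e.
by rewrite sumEFin /= big_enum.
Qed.

(** The measure is arbitrary, because the estimate is used for a rescaled measure and for Lebesgue
    measure on the same grid; the two step sums are then compared tile by tile. *)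
Lemma step_approximation (f : 'cV[R]_d -> R) (B eta : R) : measurable_fun setT f ->
  (forall x, D x -> `|f x| <= B) ->
  (forall (k : @grid d K r) x, tile V k x -> `|f x - f (tile_pt V k)| <= eta) ->
  `|\int[nu]_(x in D) f x - \sum_(k : @grid d K r) f (tile_pt V k) * fine (nu (tile V k))|
    <= eta * fine (nu D).
Proof.
move=> mf fB osc.
have mD : measurable D by exact: measurable_cube.
have -> : eta * fine (nu D) = \sum_(k : @grid d K r) eta * fine (nu (tile V k)).
  have h : forall x, D x -> `|cst eta x| <= `|eta| by [].
  rewrite -(Rintegral_cst nu mD) (Rintegral_tiles (measurable_cst eta) h).
  by apply: eq_bigr => k _; rewrite -Rintegral_cst//; exact: measurable_tile.
rewrite (Rintegral_tiles mf fB) -sumrB; apply: (le_trans (ler_norm_sum _ _ _)).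
apply: ler_sum => k _.
have mt : measurable (tile V k) by exact: measurable_tile.
have int_f : nu.-integrable (tile V k) (EFin \o f).
  apply: (bounded_integrable_on (B := B)) => //; first exact: measurable_funTS.
  by move=> x /tile_sub; exact: fB.
have int_c c : nu.-integrable (tile V k) (EFin \o cst c).
  by apply: (bounded_integrable_on (B := `|c|)) => //; exact: measurable_cst.
rewrite -!(Rintegral_cst nu mt) -RintegralB//; last exact: int_c.
have int_fc : nu.-integrable (tile V k) (EFin \o (fun x => f x - f (tile_pt V k))).
  apply: (bounded_integrable_on (B := eta)) => //; last by move=> x; exact: osc.
  by apply: measurable_funB; [exact: measurable_funTS|exact: measurable_cst].
apply: (le_trans (le_normr_Rintegral mt int_fc)).
apply: le_Rintegral => //; last by move=> x; exact: osc.
  apply: (bounded_integrable_on (B := eta)) => //.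
    apply: measurableT_comp => //.
    by apply: measurable_funB; [exact: measurable_funTS|exact: measurable_cst].
  by move=> x xk; rewrite normr_id; exact: osc.
exact: int_c.
Qed.

End step_approximation.

Section vague_limit.
Context {R : realType} {d : nat}.
Variable V : 'M[R]_d.
Hypothesis hV : V \in unitmx.
Variables (nu : lf_measure R d) (c : R).
Hypothesis nu_avg : forall a b : 'I_d -> int, (forall i, a i < b i) ->
  avg V nu a b s @[s --> +oo] --> (\prod_i (b i - a i)%:~R) * c.

Let ell : R := fine (lebesgue_cV (cell V)).

Lemma rescale_box (eps : R) (a b : 'I_d -> R) : 0 < eps ->
  rescale eps nu (box V a b) =
  (eps ^+ d * mass V nu (fun i => eps^-1 * a i) (fun i => eps^-1 * b i))%:E.
Proof. by move=> e0; rewrite /rescale scale_box ?invr_gt0// massE. Qed.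

(** A box with rational corners a / r, b / r under the rescaled measure is the integral box at the
    real scale 1 / (r eps). *)
Lemma rescale_box_avg (eps : R) (r : nat) (a b : 'I_d -> int) : 0 < eps -> (0 < r)%N ->
  rescale eps nu (box V (fun i => r%:R^-1 * (a i)%:~R) (fun i => r%:R^-1 * (b i)%:~R)) =
  (r%:R ^- d * avg V nu a b (r%:R * eps)^-1)%:E.
Proof.
move=> e0 r0; have r0' : 0 < r%:R :> R by rewrite ltr0n.
rewrite rescale_box// /avg; congr (_%:E).
rewrite exprVn invrK exprMn mulrA mulKf ?expf_neq0 ?gt_eqF//.
by congr (_ * mass V nu _ _); apply/funext => i; rewrite mulrA -invfM [eps * _]mulrC.
Qed.

Lemma rescale_box_cvg (r : nat) (a b : 'I_d -> int) : (0 < r)%N ->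
  (forall i, a i < b i) ->
  fine (rescale eps nu (box V (fun i => r%:R^-1 * (a i)%:~R) (fun i => r%:R^-1 * (b i)%:~R)))
    @[eps --> 0^'+] --> r%:R ^- d * ((\prod_i (b i - a i)%:~R) * c).
Proof.
move=> r0 ab; have r0' : 0 < r%:R :> R by rewrite ltr0n.
have h : r%:R ^- d * avg V nu a b s @[s --> +oo] -->
    r%:R ^- d * ((\prod_i (b i - a i)%:~R) * c).
  by apply: cvgM; [exact: cvg_cst|exact: nu_avg].
apply/cvgrPdist_le => e e0; move/cvgrPdist_le : h => /(_ e e0)/(near_pinfty_inv r0').
apply: filterS2 (nbhs_right_gt 0) => eps eps0.
by rewrite rescale_box_avg.
Qed.

Lemma lebesgue_box (r : nat) (a b : 'I_d -> int) : (0 < r)%N ->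
  (forall i, a i < b i) ->
  lebesgue_cV (box V (fun i => r%:R^-1 * (a i)%:~R) (fun i => r%:R^-1 * (b i)%:~R)) =
  (r%:R ^- d * ((\prod_i (b i - a i)%:~R) * ell))%:E.
Proof.
move=> r0 ab; have r0' : 0 < r%:R :> R by rewrite ltr0n.
rewrite -(lebesgue_rescale (eps := r%:R^-1)) ?invr_gt0//; last exact: measurable_boxV.
rewrite /rescale scale_box ?invr_gt0 ?invrK// exprVn EFinM; congr (_ * _)%E.
rewrite /ell -(mass_lebesgue hV ab) -massE//; congr (lebesgue_cV (box V _ _));
  by apply/funext => i; rewrite mulVKf// gt_eqF.
Qed.

End vague_limit.

(** * Rescaled limits for one fixed measure with convergent box averages *)

Section rescaled_limits.
Context {R : realType} {d : nat}.
Variable V : 'M[R]_d.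
Hypothesis hV : V \in unitmx.
Variables (nu : lf_measure R d) (c : R).
Hypothesis c0 : 0 <= c.
Hypothesis nu_avg : forall a b : 'I_d -> int, (forall i, a i < b i) ->
  avg V nu a b s @[s --> +oo] --> (\prod_i (b i - a i)%:~R) * c.

Let ell : R := fine (lebesgue_cV (cell V)).

Let ell0 : 0 < ell. Proof. exact: lebesgue_cell_gt0. Qed.

Let lo (K : nat) : 'I_d -> int := fun=> - K%:Z.
Let hi (K : nat) : 'I_d -> int := fun=> K%:Z.

Let lohi K : (0 < K)%N -> forall i, lo K i < hi K i.
Proof. by move=> K0 i; rewrite /lo /hi; lia. Qed.

Let cubeE K : cube V K%:R = box V (fun i => 1%:R^-1 * (lo K i)%:~R)
  (fun i => 1%:R^-1 * (hi K i)%:~R).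
Proof.
by congr (box V _ _); apply/funext => i; rewrite invr1 mul1r ?mulrNz -pmulrn.
Qed.

Let vol K : R := \prod_i (hi K i - lo K i)%:~R.

Let vol0 K : 0 <= vol K.
Proof. by apply: prodr_ge0 => i _; rewrite ler0z /lo /hi; lia. Qed.

Let rescale_cube_cvg K : (0 < K)%N ->
  fine (rescale eps nu (cube V K%:R)) @[eps --> 0^'+] --> vol K * c.
Proof.
move=> K0; have := rescale_box_cvg hV nu_avg (ltn0Sn 0) (lohi K0).
by rewrite -cubeE expr1n invr1 mul1r.
Qed.

Let lebesgue_cube K : (0 < K)%N ->
  lebesgue_cV (cube V K%:R) = (vol K * ell)%:E.
Proof.
move=> K0; rewrite cubeE (lebesgue_box hV (ltn0Sn 0) (lohi K0)).
by rewrite expr1n invr1 mul1r.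
Qed.

Lemma bounded_on_cube (phi : 'cV[R]_d -> R) (K : R) : continuous phi ->
  exists B, forall x, cube V K x -> `|phi x| <= B.
Proof.
move=> cphi.
have cc := @cbox_compact _ _ _ hV (fun=> - K) (fun=> K).
have /compact_bounded := continuous_compact (continuous_subspaceT cphi) cc.
move=> [M [_ hM]]; exists (M + 1) => x xK.
apply: (hM (M + 1)); first by rewrite ltrDl.
by exists x => //; exact: box_cbox.
Qed.

(** A point of a tile differs from its corner by at most the mesh in the coordinates of V, hence by
    k times the mesh in the standard ones; the mesh is taken below delta / k. *)
Lemma fine_tile_mesh (phi : 'cV[R]_d -> R) (K : nat) (eta : R) :
  continuous phi -> 0 < eta -> (0 < K)%N -> exists2 r, (0 < r)%N &
  forall (k : @grid d K r) x, tile V k x -> `|phi x - phi (tile_pt V k)| <= eta.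
Proof.
move=> cphi eta0 K0.
have [delta d0 hd] := uniform_modulus cphi (@cbox_compact _ _ _ hV (fun=> - K%:R) (fun=> K%:R)) eta0.
have [k k0 hk] := coord_in_box hV.
have [n hn] := ex_nat_ge (k / delta).
exists n.+1 => // g x xg; apply: hd.
  apply: box_cbox; rewrite -/(cube V K%:R) (cube_tile hV K0 (ltn0Sn n)) -bigcup_seq.
  by exists g => //=; rewrite mem_enum.
split=> // i j; rewrite (ord1 j) /ball/=.
have -> : x i 0 - tile_pt V g i 0 = (x - tile_pt V g) i 0 by rewrite !mxE.
have h i' : `|coordV V (x - tile_pt V g) i'| <= n.+1%:R^-1.
  have -> : coordV V (x - tile_pt V g) i' = coordV V x i' - coordV V (tile_pt V g) i'.
    by rewrite -[in RHS](subrK (tile_pt V g) x) (coordVD V (x - tile_pt V g)) addrK.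
  rewrite coordV_mul// mxE; have /andP[h1 h2] := xg i'.
  move: h2; rewrite intrD mulrDr mulr1 => h2.
  move: h1 h2; rewrite ler_norml.
  have aux (a b y : R) : a <= y -> y < a + b -> - b <= y - a <= b by move=> *; lra.
  exact: aux.
apply: (le_lt_trans (hk _ _ _ h i)); first by rewrite invr_ge0.
rewrite ltr_pdivrMr// mulrC -ltr_pdivrMr//.
by rewrite (le_lt_trans (hn n (leqnn n)))// ltr_nat.
Qed.

Lemma cube_integral_cvg (phi : 'cV[R]_d -> R) (K : nat) :
  continuous phi -> (0 < K)%N ->
  fine (\int[rescale eps nu]_(x in cube V K%:R) (phi x)%:E)%E @[eps --> 0^'+] -->
  c / ell * fine (\int[lebesgue_cV]_(x in cube V K%:R) (phi x)%:E)%E.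
Proof.
move=> cphi K0.
have mphi : measurable_fun setT phi by exact: continuous_measurable_mx.
have [B hB] := bounded_on_cube K%:R cphi.
pose W := vol K * c; have W0 : 0 <= W by rewrite mulr_ge0.
apply/cvgrPdist_le => e e0.
(* The step approximation costs at most eta (W + 1) for the rescaled measure, whose cube has mass at
   most W + 1 for small [eps], and eta W on the Lebesgue side. Together this is e / 2; the rest is
   for the step sums. *)
pose eta := e / (2 * (2 * W + 1)).
have W2 : 0 < 2 * (2 * W + 1) by lra.
have eta0 : 0 < eta by rewrite divr_gt0.
have etaE : eta * (2 * W + 1) = e / 2 by rewrite /eta; field; lra.
have [r r0 osc] := fine_tile_mesh cphi eta0 K0.
have corner_lt (k : @grid d K r) i : corner k i < corner k i + 1 by rewrite ltrDl.
have prod1 (k : @grid d K r) : \prod_i (corner k i + 1 - corner k i)%:~R = 1 :> R.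
  by rewrite big1// => i _; rewrite addrAC subrr add0r.
have hsum : \sum_(k : @grid d K r) phi (tile_pt V k) * fine (rescale eps nu (tile V k))
    @[eps --> 0^'+] --> \sum_(k : @grid d K r) phi (tile_pt V k) * (r%:R ^- d * c).
  apply: cvg_sumr => k; apply: cvgM; first exact: cvg_cst.
  have := rescale_box_cvg hV nu_avg r0 (corner_lt k).
  by rewrite prod1 mul1r.
have lebfin : (lebesgue_cV (cube V K%:R) < +oo)%E by rewrite lebesgue_cube// ltry.
have hleb := step_approximation hV K0 r0 (nu := lebesgue_cV) lebfin mphi hB osc.
have lebsum : c / ell * (\sum_(k : @grid d K r) phi (tile_pt V k) *
    fine (lebesgue_cV (tile V k))) =
    \sum_(k : @grid d K r) phi (tile_pt V k) * (r%:R ^- d * c).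
  rewrite mulr_sumr; apply: eq_bigr => k _.
  rewrite /tile (lebesgue_box hV r0 (corner_lt k)) prod1 mul1r -/ell /=.
  by field; rewrite expf_neq0 ?pnatr_eq0 -?lt0n// gt_eqF.
have lebcube : c / ell * (eta * fine (lebesgue_cV (cube V K%:R))) = eta * W.
  by rewrite lebesgue_cube//= /W; field; rewrite gt_eqF.
have e20 : 0 < e / 2 by rewrite divr_gt0.
have cell0 : 0 <= c / ell by rewrite divr_ge0// ltW.
move/cvgrPdist_le : hsum => /(_ _ e20) hsum.
have /cvgrPdist_le/(_ _ ltr01) hcube := rescale_cube_cvg K0.
near=> eps.
have eps0 : 0 < eps by near: eps; exact: nbhs_right_gt.
have [nue nueE] := @rescale_measure R d eps nu eps0.
have cubefin : (nue (cube V K%:R) < +oo)%E.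
  by rewrite -nueE /cube rescale_box// ltry.
have hnue := step_approximation hV K0 r0 (nu := nue) cubefin mphi hB osc.
have h1 : `|\sum_(k : @grid d K r) phi (tile_pt V k) * (r%:R ^- d * c) -
    \sum_(k : @grid d K r) phi (tile_pt V k) * fine (rescale eps nu (tile V k))| <= e / 2.
  by near: eps.
have h2 : `|W - fine (rescale eps nu (cube V K%:R))| <= 1 by near: eps.
move: h1 h2 hnue; rewrite !nueE /Rintegral => h1 h2 hnue.
have h3 : eta * fine (nue (cube V K%:R)) <= eta * (W + 1).
  by rewrite ler_wpM2l ?(ltW eta0)//; move: h2; rewrite ler_norml; lra.
have h4 := ler_wpM2l cell0 hleb; rewrite lebcube in h4.
rewrite -{1}(ger0_norm cell0) -normrM mulrBr lebsum /Rintegral in h4.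
move: h1 hnue h4; rewrite !ler_norml; lra.
Unshelve. all: by end_near. Qed.

(** The rescaled mass of the cube of size L is L^d times the average of the single box [-1, 1) at
    scale L / eps, which is at most its limit plus 1 once this scale exceeds a threshold. *)
Lemma rescale_cube_bound : exists s0 A : R, [/\ 0 < s0, 0 <= A &
  forall eps L, 0 < eps -> s0 * eps <= L ->
    (rescale eps nu (cube V L) <= (A * L ^+ d)%:E)%E].
Proof.
have /cvgrPdist_le/(_ _ ltr01)[M [_ hM]] := nu_avg (lohi (ltn0Sn 0)).
exists (`|M| + 1), (vol 1 * c + 1); split.
- by rewrite ltr_wpDl.
- by rewrite addr_ge0// mulr_ge0.
move=> eps L eps0 hL.
have L0 : 0 < L by rewrite (lt_le_trans _ hL)// mulr_gt0// ltr_wpDl.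
have -> : rescale eps nu (cube V L) = (L ^+ d * avg V nu (lo 1) (hi 1) (L / eps))%:E.
  rewrite /cube rescale_box// /avg; congr (_%:E).
  rewrite mulrA -exprVn invfM invrK exprMn exprVn mulrA mulfV ?expf_neq0 ?gt_eqF// mul1r.
  congr (_ * mass V nu _ _); apply/funext => i; rewrite mulrC.
    by rewrite /lo mulrNz mulrN1 mulNr.
  by rewrite /hi mulr1.
rewrite lee_fin mulrC ler_wpM2r ?exprn_ge0 ?(ltW L0)//.
have := hM (L / eps); rewrite ltr_pdivlMr// => h.
have {}h : `|vol 1 * c - avg V nu (lo 1) (hi 1) (L / eps)| <= 1.
  apply: h; apply: lt_le_trans hL; rewrite ltr_pM2r//.
  by rewrite (le_lt_trans (ler_norm _))// ltrDl.
by move: h; rewrite ler_norml; lra.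
Qed.

End rescaled_limits.

Section integrals_with_decay.
Context {R : realType} {d : nat}.
Variable V : 'M[R]_d.
Variables (kappa : {measure set 'cV[R]_d -> \bar R}) (beta : R).
Hypothesis b0 : 0 <= beta.

Lemma decay_integral_fin (L T : R) : (kappa (cube V L) < +oo)%E ->
  (\int[kappa]_(x in ~` cube V L) (decay beta x)%:E <= T%:E)%E ->
  (\int[kappa]_x (decay beta x)%:E < +oo)%E.
Proof.
move=> cfin tail.
have mc : measurable (cube V L) by exact: measurable_cube.
have md A : measurable_fun A (fun x => (decay beta x)%:E).
  by apply/measurable_EFinP; apply: measurable_funTS; exact: measurable_decay.
rewrite -(setUv (cube V L)) ge0_integral_setU//; first last.
- by rewrite disj_set2E setICr.
- by move=> x _; rewrite lee_fin decay_ge0.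
- exact: measurableC.
apply: lte_add_pinfty; last by rewrite (le_lt_trans tail)// ltry.
apply: le_lt_trans cfin; rewrite -[leRHS]mul1e -integral_cst//.
apply: ge0_le_integral => //.
- by move=> x _; rewrite lee_fin decay_ge0.
- by move=> x _; rewrite lee_fin decay_le1.
Qed.

Variables (phi : 'cV[R]_d -> R) (C : R).
Hypotheses (mphi : measurable_fun setT phi) (C0 : 0 < C)
  (phiC : forall x, `|phi x| <= C * decay beta x).

Lemma decay_dominated_fin (A : set 'cV[R]_d) : measurable A ->
  (\int[kappa]_(x in A) `|phi x|%:E <= C%:E * \int[kappa]_(x in A) (decay beta x)%:E)%E.
Proof.
move=> mA.
have md : measurable_fun A (fun x => (decay beta x)%:E).
  by apply/measurable_EFinP; apply: measurable_funTS; exact: measurable_decay.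
rewrite -ge0_integralZl_EFin//; [|by move=> x _; rewrite lee_fin decay_ge0|exact: ltW].
apply: ge0_le_integral => //.
- apply/measurable_EFinP; apply: measurableT_comp => //; exact: measurable_funTS.
- exact: measurable_funeM.
- by move=> x _; rewrite lee_fin.
Qed.

Lemma decay_integrable : (\int[kappa]_x (decay beta x)%:E < +oo)%E ->
  kappa.-integrable setT (EFin \o phi).
Proof.
move=> dfin; apply/integrableP; split; first exact/measurable_EFinP.
apply: (le_lt_trans (decay_dominated_fin measurableT)).
by rewrite lte_mul_pinfty ?lee_fin// ltW.
Qed.

Lemma integral_cube_err (L T : R) : (\int[kappa]_x (decay beta x)%:E < +oo)%E ->
  (\int[kappa]_(x in ~` cube V L) (decay beta x)%:E <= T%:E)%E ->
  `|fine (\int[kappa]_x (phi x)%:E)%E -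
    fine (\int[kappa]_(x in cube V L) (phi x)%:E)%E| <= C * T.
Proof.
move=> dfin tail; have int := decay_integrable dfin.
have mc : measurable (cube V L) by exact: measurable_cube.
have mcC : measurable (~` cube V L) by exact: measurableC.
have intC : kappa.-integrable (~` cube V L) (EFin \o phi).
  exact: (integrableS measurableT mcC).
have e : \int[kappa]_x phi x = \int[kappa]_(x in cube V L) phi x +
    \int[kappa]_(x in ~` cube V L) phi x.
  by rewrite -Rintegral_setU ?setUv//; rewrite disj_set2E setICr.
rewrite -/(Rintegral kappa setT phi) -/(Rintegral kappa (cube V L) phi) e addrC addKr.
apply: (le_trans (le_normr_Rintegral mcC intC)).
rewrite -lee_fin /Rintegral fineK.
  apply: (le_trans (decay_dominated_fin mcC)); rewrite EFinM.
  by rewrite lee_pmul2l.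
apply: integrable_fin_num => //; exact: (integrable_abse intC).
Qed.

End integrals_with_decay.

(** * Passage from cubes to the whole space *)

Section deterministic_limits.
Context {R : realType} {d : nat}.
Variable V : 'M[R]_d.
Hypothesis hV : V \in unitmx.
Variables (nu : lf_measure R d) (c : R).
Hypothesis c0 : 0 <= c.
Hypothesis nu_avg : forall a b : 'I_d -> int, (forall i, a i < b i) ->
  avg V nu a b s @[s --> +oo] --> (\prod_i (b i - a i)%:~R) * c.
Variable beta : R.
Hypothesis db : d%:R < beta.

Let b0 : 0 <= beta. Proof. by rewrite (le_trans _ (ltW db)). Qed.

Let scale (L : R) := L ^+ d * L `^ (- beta).

Lemma rescale_decay_tail : exists s0 C : R, [/\ 0 < s0, 0 <= C &
  forall eps L, 0 < eps -> 0 < L -> s0 * eps <= L ->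
   (\int[rescale eps nu]_(x in ~` cube V L) (decay beta x)%:E <=
    (C * scale L)%:E)%E].
Proof.
have [s0 [A [s00 A0 hA]]] := rescale_cube_bound hV c0 nu_avg.
have [C C0 hC] := @decay_tail R d V beta db.
exists s0, (C * A); split=> //; first by rewrite mulr_ge0// ltW.
move=> eps L eps0 L0 hL.
have [nue nueE] := @rescale_measure R d eps nu eps0.
rewrite nueE; apply: hC => // L' LL'; rewrite -nueE.
by apply: hA => //; exact: le_trans LL'.
Qed.

(** The tail bound is applied outside the cube of size [s0 * eps], the smallest one allowed; this
    works for every positive [eps], not only for small ones. *)
Lemma rescale_decay_fin eps : 0 < eps ->
  (\int[rescale eps nu]_x (decay beta x)%:E < +oo)%E.
Proof.
move=> eps0; have [s0 [C [s00 C0 hC]]] := rescale_decay_tail.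
have L0 : 0 < s0 * eps by rewrite mulr_gt0.
have := hC eps _ eps0 L0 (lexx _).
have [nue nueE] := @rescale_measure R d eps nu eps0.
rewrite nueE; apply: decay_integral_fin => //.
by rewrite -nueE /cube (rescale_box hV)// ltry.
Qed.

Lemma rescale_limsup_tail :
  limf_esup (fun eps : R => \int[rescale eps nu]_(x in [set x | (l <= enorm x)%R])
     (decay beta x)%:E)%E 0^'+ @[l --> +oo] --> 0%E.
Proof.
have [s0 [C [s00 C0 hC]]] := rescale_decay_tail.
have [k k0 hk] := enorm_in_cube hV.
have k20 : 0 < 2 * k by rewrite mulr_gt0.
have lim0 : (C * scale (l / (2 * k)))%:E @[l --> +oo] --> 0%E.
  apply: cvg_EFin; first exact: nearW.
  apply/cvgrPdist_le => e e0.
  have : C * scale L @[L --> +oo] --> C * 0.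
    by apply: cvgM; [exact: cvg_cst|exact: decay_scale_cvg].
  rewrite mulr0 => /cvgrPdist_le/(_ _ e0)[M [_ hM]].
  exists (M * (2 * k)); split; first exact: num_real.
  by move=> l hl; apply: hM; rewrite ltr_pdivlMr.
apply: (squeeze_cvge _ (cvg_cst 0%E) lim0).
exists 0; split=> // l l0; apply/andP; split.
  (* The upper limit is an infimum of suprema over neighbourhoods; each neighbourhood contains a
     positive [eps], whose integral is nonnegative. *)
  apply: le_ereal_inf_tmp => _ [W hW <-].
  have : \forall eps \near 0^'+, W eps /\ 0 < eps.
    by apply: filterI => //; exact: nbhs_right_gt.
  move=> /filter_ex[eps [Weps eps0]].
  apply: (@le_trans _ _ (\int[rescale eps nu]_(x in [set x | (l <= enorm x)%R])
     (decay beta x)%:E)%E).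
    have [nue nueE] := @rescale_measure R d eps nu eps0.
    by rewrite nueE; apply: integral_ge0 => x _; rewrite lee_fin decay_ge0.
  by apply: ereal_sup_ubound; exists eps.
(* On the cube of this size the norm is at most l / 2, so the region with norm at least l lies
   outside of it. *)
have L0 : 0 < l / (2 * k) by rewrite divr_gt0.
apply: (@le_trans _ _ (ereal_sup ((fun eps : R =>
    \int[rescale eps nu]_(x in [set x | (l <= enorm x)%R]) (decay beta x)%:E)%E
    @` [set eps | 0 < eps < l / (2 * k) / s0]))).
  apply: ereal_inf_lbound; exists [set eps | 0 < eps < l / (2 * k) / s0] => //.
  apply: filterS2 (nbhs_right_gt 0) (nbhs_right_lt (divr_gt0 L0 s00)) => eps h1 h2.
  by rewrite /= h1.
apply: ge_ereal_sup => _ [eps /andP[eps0 hl] <-].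
have := hC eps _ eps0 L0; rewrite ltr_pdivlMr// in hl.
rewrite mulrC (ltW hl) => /(_ isT); apply: le_trans.
have [nue nueE] := @rescale_measure R d eps nu eps0.
rewrite nueE; apply: ge0_subset_integral.
- rewrite (_ : mkset _ = (@enorm R d) @^-1` `[l, +oo[%classic).
    rewrite -[X in measurable X]setTI.
    by apply: (continuous_measurable_mx (@enorm_continuous R d)) => //; exact: measurable_itv.
  by apply/seteqP; split=> x /=; rewrite in_itv/= andbT.
- by apply: measurableC; exact: measurable_cube.
- by apply/measurable_EFinP; apply: measurable_funTS; exact: measurable_decay.
- by move=> x _; rewrite lee_fin decay_ge0.
move=> x /= lx xc; have := hk _ _ (ltW L0) xc.
have -> : k * (l / (2 * k)) = l / 2 by field; rewrite gt_eqF.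
move: l0 lx; lra.
Qed.

Let ell : R := fine (lebesgue_cV (cell V)).

(** Lebesgue measure equals its own rescalings. For a cube of size L' the parameter may be taken as
    L' / s0, so the growth bound holds for all sizes. *)
Lemma lebesgue_decay_tail : exists2 C : R, 0 <= C & forall L : R, 0 < L ->
  (\int[lebesgue_cV]_(x in ~` cube V L) (decay beta x)%:E <= (C * scale L)%:E)%E.
Proof.
have ell0 : 0 < ell by exact: lebesgue_cell_gt0.
have [s0 [A [s00 A0 hA]]] := rescale_cube_bound hV (ltW ell0) (avg_lebesgue_cvg hV).
have [C C0 hC] := @decay_tail R d V beta db.
exists (C * A); first by rewrite mulr_ge0// ltW.
move=> L L0; apply: hC => // L' LL'.
have L'0 : 0 < L' by exact: lt_le_trans LL'.
have s0L' : s0 * (L' / s0) <= L' by rewrite mulrC divfK// gt_eqF.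
have := hA (L' / s0) L' (divr_gt0 L'0 s00) s0L'.
rewrite (_ : rescale _ _ _ = lebesgue_cV (cube V L'))//.
by apply: lebesgue_rescale; [exact: divr_gt0|exact: measurable_cube].
Qed.

Lemma lebesgue_decay_fin : (\int[@lebesgue_cV R d]_x (decay beta x)%:E < +oo)%E.
Proof.
have [C C0 hC] := lebesgue_decay_tail.
apply: (decay_integral_fin b0 _ (hC 1 ltr01)).
exact: (lf_measure_box hV (@lebesgue_lf R d)).
Qed.

Variables (phi : 'cV[R]_d -> R) (Cphi : R).
Hypotheses (cphi : continuous phi) (Cphi0 : 0 < Cphi)
  (phiC : forall x, `|phi x| <= Cphi * decay beta x).

Let mphi : measurable_fun setT phi. Proof. exact: continuous_measurable_mx. Qed.

Lemma rescale_integral_fin eps : 0 < eps ->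
  (\int[rescale eps nu]_x `|phi x|%:E < +oo)%E.
Proof.
move=> eps0; have := rescale_decay_fin eps0.
have [nue nueE] := @rescale_measure R d eps nu eps0.
rewrite nueE => dfin.
apply: (le_lt_trans (decay_dominated_fin nue mphi Cphi0 phiC measurableT)).
by rewrite lte_mul_pinfty ?lee_fin// ltW.
Qed.

Lemma rescale_integral_cvg :
  (\int[rescale eps nu]_x (phi x)%:E)%E @[eps --> 0^'+] -->
  ((c / ell)%:E * \int[lebesgue_cV]_x (phi x)%:E)%E.
Proof.
have ell0 : 0 < ell by exact: lebesgue_cell_gt0.
have lebint := decay_integrable mphi Cphi0 phiC lebesgue_decay_fin.
rewrite -(fineK (integrable_fin_num measurableT lebint)) -EFinM.
apply: cvg_EFin.
  apply: filterS (nbhs_right_gt 0) => eps eps0.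
  have := rescale_decay_fin eps0.
  have [nue nueE] := @rescale_measure R d eps nu eps0.
  rewrite nueE => dfin; apply: integrable_fin_num => //.
  exact: (decay_integrable mphi Cphi0 phiC dfin).
(* One third each for the tail of the rescaled measure, the tail of Lebesgue measure times c / ell,
   and the cube. The cube is fixed before [eps], which is possible because the first tail bound is
   uniform in [eps]. *)
apply/cvgrPdist_le => e e0; have e30 : 0 < e / 3 by rewrite divr_gt0.
have [s0 [C [s00 C0 hC]]] := rescale_decay_tail.
have [C' C'0 hC'] := lebesgue_decay_tail.
have cl0 : 0 <= c / ell by rewrite divr_ge0// ltW.
have sc (D : R) : exists M : R, forall L, M < L -> D * scale L <= e / 3.
  have : D * scale L @[L --> +oo] --> D * 0.
    by apply: cvgM; [exact: cvg_cst|exact: decay_scale_cvg].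
  rewrite mulr0 => /cvgrPdist_le/(_ _ e30)[M [_ hM]].
  exists M => L /hM; rewrite sub0r normrN; apply: le_trans; exact: ler_norm.
have [M1 hM1] := sc (Cphi * C); have [M2 hM2] := sc (c / ell * (Cphi * C')).
have [n hn] := ex_nat_ge (Num.max M1 M2).
pose K := n.+1; have nK : n%:R < K%:R :> R by rewrite ltr_nat.
have := hn n (leqnn n); rewrite ge_max => /andP[n1 n2].
have {hM1} tail1 := hM1 _ (le_lt_trans n1 nK).
have {hM2} tail2 := hM2 _ (le_lt_trans n2 nK).
have K0 : 0 < K%:R :> R by rewrite ltr0n.
have bulk := cube_integral_cvg hV c0 nu_avg cphi (ltn0Sn n).
move/cvgrPdist_le : bulk => /(_ _ e30) bulk.
have err2 := integral_cube_err mphi Cphi0 phiC lebesgue_decay_fin (hC' _ K0).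
near=> eps.
have eps0 : 0 < eps by near: eps; exact: nbhs_right_gt.
have epsK : s0 * eps <= K%:R.
  rewrite mulrC -ler_pdivlMr//; apply: ltW; near: eps.
  by apply: nbhs_right_lt; rewrite divr_gt0.
have h1 : `|c / ell * fine (\int[lebesgue_cV]_(x in cube V K%:R) (phi x)%:E)%E -
  fine (\int[rescale eps nu]_(x in cube V K%:R) (phi x)%:E)%E| <= e / 3 by near: eps.
have := rescale_decay_fin eps0; have := hC eps _ eps0 K0 epsK; move: h1.
have [nue nueE] := @rescale_measure R d eps nu eps0.
rewrite /= !nueE => h1 htail hfin.
have err1 := integral_cube_err mphi Cphi0 phiC hfin htail.
have err3 := ler_wpM2l cl0 err2.
rewrite -{1}(ger0_norm cl0) -normrM mulrBr in err3.
rewrite mulrA in err1; rewrite [_ * (C' * _)]mulrA mulrA in err3.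
have := le_trans err1 tail1; have := le_trans err3 tail2.
move: h1; rewrite !ler_norml; lra.
Unshelve. all: by end_near. Qed.

End deterministic_limits.

Unset Implicit Arguments.

Theorem corollary3p7 (R : realType) (d : nat)
    (dO : measure_display) (Omega : measurableType dO) (P : probability Omega R)
    (G : set 'cV[R]_d) (theta : 'cV[R]_d -> Omega -> Omega) (V : 'M[R]_d)
    (mu : Omega -> lf_measure R d)
    (hG : G = [set: 'cV[R]_d] \/ G = int_vectors)
    (htheta : measurable_action G theta)
    (hV : V \in unitmx)
    (hstat : stationary G theta P)
    (herg : ergodic G theta P)
    (hmu : random_measure mu)
    (hequiv : equivariant G theta V mu)
    (hmom : exists2 alpha : R, 1 < alpha &
       (\int[P]_w (mu w (cell V) `^ alpha) < +oo)%E) :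
  (exists A : set Omega,
    [/\ measurable A, invariant_set G theta A, P A = 1%E &
    forall phi : 'cV[R]_d -> R, continuous phi ->
    (exists C beta : R, [/\ 0 < C, d%:R < beta &
       forall x, `|phi x| <= C * (1 + enorm x) `^ (- beta)]) ->
    forall w, A w ->
      (forall eps : R, 0 < eps ->
         (\int[rescale eps (mu w)]_x `|phi x|%:E < +oo)%E) /\
      ((\int[rescale eps (mu w)]_x (phi x)%:E)%E @[eps --> 0^'+] -->
         (intensity P V mu * \int[lebesgue_cV]_x (phi x)%:E)%E)])
  /\
  (exists C : set Omega,
    [/\ measurable C, invariant_set G theta C, P C = 1%E &
    forall beta : R, d%:R < beta ->
    let vartheta := fun r : R => (1 + r) `^ (- beta) in
    forall w, C w ->
      (forall eps : R, 0 < eps ->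
         (\int[rescale eps (mu w)]_x (vartheta (enorm x))%:E < +oo)%E) /\
      (limf_esup (fun eps : R =>
           \int[rescale eps (mu w)]_(x in [set x | (l <= enorm x)%R])
             (vartheta (enorm x))%:E)%E 0^'+
         @[l --> +oo] --> 0%E)]).

Proof.
(* One set serves both parts: its points are used only through the convergence of box averages,
   which involves neither [phi] nor [beta]. *)
have [A [mA invA PA hA]] :=
  spatial_ergodic_theorem hG htheta hV hstat herg hmu hequiv hmom.
have m0 := mean_mass_ge0 P V mu.
(* In particular the intensity is finite, and it is the constant c / ell of the deterministic limit
   with c the mean mass of the cell. *)
have intE : intensity P V mu =
    (mean_mass P V mu / fine (lebesgue_cV (cell V)))%:E.
  by rewrite /intensity (mean_massE hV hmu hmom) -EFinM mulrC.
split; exists A; split=> //.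
  move=> phi cphi [C [beta [C0 db phiC]]] w Aw; split.
    by move=> eps; exact: (rescale_integral_fin hV m0 (hA w Aw) db cphi C0 phiC).
  by rewrite intE; exact: (rescale_integral_cvg hV m0 (hA w Aw) db cphi C0 phiC).
move=> beta db vartheta w Aw; split.
  by move=> eps; exact: (rescale_decay_fin hV m0 (hA w Aw) db).
exact: (rescale_limsup_tail hV m0 (hA w Aw) db).
Qed.
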